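(* Let $W$ be a Borel measurable, zero-mean Gaussian random element in a separable Banach space $\mathbb{B}$, defined on a probability space $(\Omega,\mathcal{U},\mathrm{P})$, with RKHS $\mathbb{H}$, and let $(h_i)$ be a complete orthonormal system in $\mathbb{H}$. Let $U:\mathbb{H}\to L_2(\Omega,\mathcal{U},\mathrm{P})$ be the isometry determined by $U(Sb^* )=b^*(W)$ for $b^*\in\mathbb{B}^*$. Then $Uh_1,Uh_2,\ldots$ is an i.i.d. sequence of standard normal variables and $$W=\sum_{i=1}^\infty(Uh_i)h_i,$$ where the series converges in the norm of $\mathbb{B}$, almost surely.
   Context: All vector spaces are real. A Borel measurable random element $W$ in a separable Banach space $(\mathbb{B},\|\cdot\|)$ is zero-mean Gaussian if $b^*(W)$ is a (possibly degenerate) normal variable with mean zero for every $b^*\in\mathbb{B}^*$; then $\mathrm{E}\|W\|^2<\infty$. For $b^*\in\mathbb{B}^*$ let $Sb^*\in\mathbb{B}$ be the Pettis integral $\mathrm{E}Wb^*(W)$, i.e. the unique element with $b_2^*(Sb^* )=\mathrm{E}b_2^*(W)b^*(W)$ for every $b_2^*\in\mathbb{B}^*$. The RKHS $\mathbb{H}$ of $W$ is the completion of $S\mathbb{B}^*$ under the inner product $\langle Sb_1^*,Sb_2^*\rangle_{\mathbb{H}}=\mathrm{E}b_1^*(W)b_2^*(W)$. Because $\|Sb^*\|\le\sigma(W)\|Sb^*\|_{\mathbb{H}}$ with $\sigma^2(W)=\sup_{\|b^*\|=1}\mathrm{E}b^*(W)^2<\infty$, this completion is identified with a subset of $\mathbb{B}$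 (an $\mathbb{H}$-Cauchy sequence in $S\mathbb{B}^*$ is identified with its limit in $\mathbb{B}$). The map $U$ is defined on $S\mathbb{B}^*$ by $U(Sb^* )=b^*(W)$ and extended to $\mathbb{H}$ by continuity. *)

(* Defs.v *)
From HB Require Import structures.
From mathcomp Require Import all_boot all_order all_algebra finmap.
From mathcomp Require Import all_classical all_reals all_analysis.

Set Implicit Arguments.
Unset Strict Implicit.
Unset Printing Implicit Defensive.

Import Order.TTheory GRing.Theory Num.Theory.
Import numFieldNormedType.Exports.

Local Open Scope classical_set_scope.
Local Open Scope ring_scope.

Definition separable (T : topologicalType) : Prop :=
  exists2 D : set T, countable D & dense D.

Definition dual (R : realType) (B : normedModType R) : Type :=
  {b : {linear B -> R^o} | continuous b}.

Definition dual_fun (R : realType) (B : normedModType R) (b : dual B) : B -> R :=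
  sval b.
Coercion dual_fun : dual >-> Funclass.

Definition borel_measurable d (T : measurableType d) (R : realType)
    (B : normedModType R) (W : T -> B) : Prop :=
  measurable_fun [set: T] (W : T -> g_sigma_algebraType (@open B)).

Section random_variables.
Context d (T : measurableType d) (R : realType) (P : probability T R).

Definition has_law (X : T -> R) (mu : set R -> \bar R) : Prop :=
  measurable_fun [set: T] X /\
  forall A : set R, measurable A -> P (X @^-1` A) = mu A.

(* [normal_prob 0 0] is the uniform law on [0, 1], not a Dirac mass, so the
   degenerate case is listed separately. *)
Definition centered_normal (X : T -> R) : Prop :=
  (exists2 s : R, 0 < s & has_law X (normal_prob 0 s)) \/
  has_law X (dirac (0 : R)).

Definition mutually_independent (I : set nat) (X : nat -> T -> R) : Prop :=
  forall (J : {fset nat}) (A : nat -> set R),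
    [set` J] `<=` I ->
    (forall i, i \in J -> measurable (A i)) ->
    P (\bigcap_(i in [set` J]) (X i @^-1` A i)) =
    (\prod_(i <- J) P (X i @^-1` A i))%E.

End random_variables.

Section rkhs.
Context d (T : measurableType d) (R : realType) (P : probability T R)
        (B : completeNormedModType R) (W : T -> B).

Definition centered_gaussian : Prop :=
  borel_measurable W /\ forall b : dual B, centered_normal P (b \o W).

Definition dual_cov (b1 b2 : dual B) : R :=
  fine 'E_P[fun w => b1 (W w) * b2 (W w)].

(* The Pettis integral E (W b(W)), with value 0 if there is none. *)
Definition pettis (b : dual B) : B :=
  xget 0 [set x : B | forall b2 : dual B, b2 x = dual_cov b2 b].

(* Inner product and norm of the range of [pettis], before completion; the
   inner product does not depend on the functionals representing x and y. *)
Definition pre_ip (x y : B) : R :=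
  xget 0 [set r | exists b1 b2 : dual B,
    [/\ x = pettis b1, y = pettis b2 & r = dual_cov b1 b2]].

Definition pre_norm (x : B) : R := Num.sqrt (pre_ip x x).

(* The functionals b n represent, through [pettis], a Cauchy sequence for
   [pre_norm], which is identified with its limit h in B. *)
Definition represents (b : nat -> dual B) (h : B) : Prop :=
  (forall e : R, 0 < e -> exists N : nat, forall m n : nat,
     (N <= m)%N -> (N <= n)%N ->
     pre_norm (pettis (b m) - pettis (b n)) < e) /\
  pettis (b n) @[n --> \oo] --> h.

Definition rkhs : set B := [set h | exists b, represents b h].

(* Extension by continuity of [pre_ip] to the completion. *)
Definition rkhs_ip (h g : B) : R :=
  xget 0 [set r | exists b c : nat -> dual B,
    [/\ represents b h, represents c g &
        pre_ip (pettis (b n)) (pettis (c n)) @[n --> \oo] --> r]].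

(* A version of the continuous extension to the RKHS of the map
   [pettis b |-> b \o W] into L_2; defined up to almost sure equality. *)
Definition rkhs_U (h : B) : T -> R :=
  xget (cst 0) [set X : T -> R | X \in Lfun P 2%:E /\
    exists b : nat -> dual B, represents b h /\
      ('N[P]_2%:E[EFin \o (fun w => b n (W w) - X w)%R] @[n --> \oo] --> 0%:E)%E].

(* The index set I is a subset of nat, so that finite-dimensional RKHSs are
   covered as well; [I = setT] gives a sequence h_0, h_1, etc. *)
Definition complete_orthonormal (I : set nat) (h : nat -> B) : Prop :=
  [/\ forall i, I i -> rkhs (h i),
      forall i j, I i -> I j -> rkhs_ip (h i) (h j) = (i == j)%:R
    & forall g, rkhs g -> (forall i, I i -> rkhs_ip g (h i) = 0) -> g = 0].

End rkhs.

(* Main.v *)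
(** The characteristic function of [b(W)] identifies its variance with
    [E b(W)^2], and tightness of [W] bounds this by [C |b|^2]; together with
    the Hahn-Banach theorem this yields the Pettis integrals [S b], as limits
    of [E W' b(W)] for discretizations [W'] of [W].  Elements of the RKHS
    correspond to the L2-limits of the variables [b(W)], all of which are
    centered Gaussian, so joint laws are determined by covariances: the
    variables [U h_i] are independent and standard normal, and, for the partial
    sums [S_n] of the series, reflecting the residual [W - S_k] into its
    opposite preserves the joint law with [U h_0, ..., U h_(k-1)].  This
    reflection gives Levy's maximal inequality for every convex Borel set.
    Completeness of [(h_i)] gives [b(S_n) -> b(W)] in L2 and, by the maximal
    inequality for the slabs [|b| <= t], almost surely.  Applied to
    neighbourhoods of compact zonotopes spanned by a dense sequence, the same
    inequality shows that almost surely all [S_n] stay close to a compact set,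
    and there convergence of countably many functionals implies convergence in
    norm.

    Uniqueness of laws is obtained without Fourier inversion: a functional
    vanishing at all [cos (l + p)] vanishes at polynomials in [sin ((l - a) / n)],
    and these approximate the indicator of the half-space [l <= a] boundedly. *)

Require Import Defs.
From HB Require Import structures.
From mathcomp Require Import all_boot all_order all_algebra finmap.
From mathcomp Require Import ring lra.
From mathcomp Require Import all_classical all_reals all_analysis.
From mathcomp Require Import measurable_realfun.

Set Implicit Arguments.
Unset Strict Implicit.
Unset Printing Implicit Defensive.

Import Order.TTheory GRing.Theory Num.Theory.
Import numFieldNormedType.Exports.

Local Open Scope classical_set_scope.
Local Open Scope ring_scope.

(** * The Hahn-Banach theorem and dual functionals *)

Section hahn_banach.
Context (R : realType) (V : lmodType R).
Implicit Types (p q : V -> R) (x y : V) (t : R).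

(** The obstacle is the passage from scalars to the norm: L2 convergence of every [b (S_n)] says
    nothing uniform in [b]. Levy's inequality only asks for a Borel set stable under midpoints, so
    one statement serves both the slabs and the zonotope neighbourhoods. Zonotopes are compact and
    convex by construction, so no closed convex hull of a compact set has to be formed.

    Random variables stay functions rather than classes modulo null sets. The map U is therefore
    handled as a relation, [isometric_image], and facts about it are stated as equalities of inner
    products, which do not see null sets.

    Joint laws never involve vectors of variables. The uniqueness theorem is stated for a linear
    class [L] of measurable functions on any measurable space; it is used with the multiples of the
    identity on the line, with the dual on [B], and with the span of finitely many coordinates on
    [Omega] itself. Phases in the cosines replace complex exponentials. *)

Definition sublinear p :=
  (forall x y, p (x + y) <= p x + p y) /\
  (forall t x, 0 <= t -> p (t *: x) = t * p x).

Lemma sublinear0 p : sublinear p -> p 0 = 0.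
Proof. by move=> [_ ph]; rewrite -(scale0r 0) ph// mul0r. Qed.

Lemma sublinearN p x : sublinear p -> - p (- x) <= p x.
Proof.
move=> sp; have := sp.1 x (- x); rewrite subrr (sublinear0 sp); lra.
Qed.

(** In the infimum over [t], the value [t = 0] gives the bound [p] and [t = 1] the increment
    [p (x + y) - p y]; it stays sublinear because the parameters chosen for two points add up. This
    is the proof of Hahn-Banach through minimal sublinear functionals, in which no subspace is
    extended. *)
Let slopes p y x := [set p (x + t *: y) - t * p y | t in [set t | 0 <= t]].

Let sublinear_slope p y x := inf (slopes p y x).

Let slopes_has_inf p y x : sublinear p -> has_inf (slopes p y x).
Proof.
move=> sp; split; first by exists (p (x + 0 *: y) - 0 * p y), 0 => /=.
exists (- p (- x)) => _ [t /= t0 <-].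
have := sp.1 (x + t *: y) (- x); rewrite addrAC subrr add0r sp.2//; lra.
Qed.

Let slope_le p y x t : sublinear p -> 0 <= t ->
  sublinear_slope p y x <= p (x + t *: y) - t * p y.
Proof.
move=> sp t0; apply: ge_inf; last by exists t.
by case: (slopes_has_inf y x sp).
Qed.

Let sublinear_slopeP p y : sublinear p -> sublinear (sublinear_slope p y).
Proof.
move=> sp; split=> [x1 x2|t x].
- apply/ler_addgt0Pr => e e0; have e20 : 0 < e / 2 by lra.
  have [_ [t1 /= t10 <-] h1] := inf_adherent e20 (slopes_has_inf y x1 sp).
  have [_ [t2 /= t20 <-] h2] := inf_adherent e20 (slopes_has_inf y x2 sp).
  have t12 : 0 <= t1 + t2 by lra.
  apply: (le_trans (slope_le y (x1 + x2) sp t12)).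
  have := sp.1 (x1 + t1 *: y) (x2 + t2 *: y).
  rewrite addrACA -scalerDl; rewrite -/(sublinear_slope p y x1) in h1.
  rewrite -/(sublinear_slope p y x2) in h2; lra.
- rewrite le_eqVlt => /predU1P[<-|t0].
    rewrite scale0r mul0r; apply/eqP; rewrite eq_le; apply/andP; split.
      have := @slope_le p y 0 0 sp (lexx _).
      rewrite scale0r addr0 (sublinear0 sp); lra.
    apply: lb_le_inf; first by case: (slopes_has_inf y 0 sp).
    by move=> _ [s /= s0 <-]; rewrite add0r sp.2// subrr.
  apply/eqP; rewrite eq_le; apply/andP; split.
    rewrite -ler_pdivrMl//; apply: lb_le_inf.
      by case: (slopes_has_inf y x sp).
    move=> _ [s /= s0 <-]; rewrite ler_pdivrMl//.
    have ts0 : 0 <= t * s by rewrite mulr_ge0// ltW.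
    apply: (le_trans (slope_le y (t *: x) sp ts0)).
    by rewrite -scalerA -scalerDr sp.2 ?(ltW t0)// mulrBr mulrA.
  apply: lb_le_inf; first by case: (slopes_has_inf y (t *: x) sp).
  move=> _ [s /= s0 <-]; rewrite -ler_pdivlMl//.
  have ts0 : 0 <= t^-1 * s by rewrite mulr_ge0// invr_ge0 ltW.
  apply: (le_trans (slope_le y x sp ts0)).
  rewrite mulrBr mulrA -[t^-1 * p _]sp.2 ?invr_ge0 ?(ltW t0)// scalerDr !scalerA.
  by rewrite mulVf ?gt_eqF// scale1r.
Qed.

Lemma sublinear_le_slope p y : sublinear p -> exists q,
  [/\ sublinear q, (forall x, q x <= p x) &
      (forall x, q x <= p (x + y) - p y)].
Proof.
move=> sp; exists (sublinear_slope p y); split; first exact: sublinear_slopeP.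
  move=> x; have := @slope_le p y x 0 sp (lexx _).
  by rewrite scale0r addr0 mul0r subr0.
by move=> x; have := @slope_le p y x 1 sp ler01; rewrite scale1r mul1r.
Qed.

(** The pointwise infimum is the lower bound that Zorn's lemma asks for. Subadditivity is where
    totality enters: of two members nearly attaining the infima at [x] and at [y], the smaller one
    serves for both. *)
Lemma sublinear_chain_inf (A : set (V -> R)) p0 :
  A p0 -> (forall p, A p -> sublinear p) ->
  (forall p q, A p -> A q ->
     (forall x, p x <= q x) \/ (forall x, q x <= p x)) ->
  exists q, sublinear q /\ forall p, A p -> forall x, q x <= p x.
Proof.
move=> Ap0 Asub Atot; pose S x := [set p x | p in A].
have Sinf x : has_inf (S x).
  split; first by exists (p0 x), p0.
  (* A bound independent of the member: [p] and [p0] are comparable, and [- q (- x) <= q x] is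
     applied to the smaller of the two. *)
  exists (- p0 (- x)) => _ [p Ap <-].
  have [le|le] := Atot _ _ Ap Ap0.
    by have := sublinearN x (Asub _ Ap); have := le (- x); lra.
  by have := sublinearN x (Asub _ Ap0); have := le x; lra.
have Sle p x : A p -> inf (S x) <= p x.
  by move=> Ap; apply: ge_inf; [case: (Sinf x)|exists p].
exists (fun x => inf (S x)); split; last by move=> p Ap x; exact: Sle.
split=> [x y|t x].
  apply/ler_addgt0Pr => e e0; have e20 : 0 < e / 2 by lra.
  have [_ [p1 Ap1 <-] h1] := inf_adherent e20 (Sinf x).
  have [_ [p2 Ap2 <-] h2] := inf_adherent e20 (Sinf y).
  have [le|le] := Atot _ _ Ap1 Ap2.
    apply: (le_trans (Sle _ _ Ap1)).
    by have := (Asub _ Ap1).1 x y; have := le y; lra.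
  apply: (le_trans (Sle _ _ Ap2)).
  by have := (Asub _ Ap2).1 x y; have := le x; lra.
rewrite le_eqVlt => /predU1P[<-|t0].
  rewrite scale0r mul0r; suff -> : S 0 = [set 0] by rewrite inf1.
  apply/seteqP; split=> [_ [p Ap <-]|_ ->] /=; first exact/sublinear0/Asub.
  by exists p0 => //; exact/sublinear0/Asub.
apply/eqP; rewrite eq_le; apply/andP; split.
  rewrite -ler_pdivrMl//; apply: lb_le_inf; first by case: (Sinf x).
  move=> _ [p Ap <-]; rewrite ler_pdivrMl//.
  by rewrite -(Asub _ Ap).2 ?(ltW t0)//; exact: Sle.
apply: lb_le_inf; first by case: (Sinf (t *: x)).
move=> _ [p Ap <-]; rewrite (Asub _ Ap).2 ?(ltW t0)// ler_pM2l//.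
exact: Sle.
Qed.

Lemma minimal_sublinear p0 : sublinear p0 -> exists p,
  [/\ sublinear p, (forall x, p x <= p0 x) &
      forall q, sublinear q -> (forall x, q x <= p x) -> q = p].
Proof.
move=> sp0; pose T := {p | sublinear p /\ forall x, p x <= p0 x}.
(* The order is reversed, so that a maximal element for Zorn's lemma is a minimal functional. *)
pose le (a b : T) : bool := `[< forall x, sval b x <= sval a x >].
have [|a b c /asboolP ab /asboolP bc|[a pa] [b pb] /asboolP /= ab /asboolP /= ba|A Atot|] :=
    @Zorn T le.
- by move=> t; apply/asboolP.
- by apply/asboolP => x; exact: le_trans (bc x) (ab x).
- apply: eq_exist; apply/funext => x.
  by apply/eqP; rewrite eq_le ab ba.
- have [A0|/set0P[a Aa]] := eqVneq A set0.
    by exists (exist _ p0 (conj sp0 (fun x => lexx (p0 x)))) => s; rewrite A0.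
  have [|||q [sq leq]] := @sublinear_chain_inf [set sval b | b in A] (sval a).
  + by exists a.
  + by move=> _ [b Ab <-]; exact: (svalP b).1.
  + move=> _ _ [b Ab <-] [c Ac <-].
    by case: (Atot _ _ Ab Ac) => /asboolP; [right|left].
  + have leq0 x : q x <= p0 x.
      by apply: le_trans ((svalP a).2 x); apply: leq; exists a.
    exists (exist _ q (conj sq leq0)) => s As; apply/asboolP => x /=.
    by apply: leq; exists s.
- move=> [p [sp pp0]] pmax; exists p; split => // q sq qp.
  have qp0 x : q x <= p0 x := le_trans (qp x) (pp0 x).
  by have := pmax (exist _ q (conj sq qp0)) (introT (asboolP _) qp); case.
Qed.

(** Minimality identifies [p] with the functional of [sublinear_le_slope] in every direction [y],
    whence [p x <= p (x + y) - p y], the half of additivity that sublinearity lacks. *)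
Lemma minimal_sublinear_linear p : sublinear p ->
  (forall q, sublinear q -> (forall x, q x <= p x) -> q = p) ->
  linear_for *%R p.
Proof.
move=> sp pmin.
have pD x y : p (x + y) = p x + p y.
  have [q [sq qp qy]] := sublinear_le_slope y sp.
  have := qy x; rewrite (pmin _ sq qp) => h.
  by apply/eqP; rewrite eq_le sp.1/=; lra.
have pN x : p (- x) = - p x.
  by apply/eqP; rewrite -addr_eq0 -pD addNr sublinear0.
move=> t x y; rewrite pD; congr (_ + _); have [t0|t0] := leP 0 t.
  exact: sp.2.
by rewrite -[t]opprK scaleNr pN sp.2 ?mulNr// oppr_ge0 ltW.
Qed.

End hahn_banach.

(** * Continuous functionals and norming functionals *)

Section dual.
Context (R : realType) (B : normedModType R).
Implicit Types (b : dual B) (x : B).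

Lemma dual_continuous b : continuous (b : B -> R).
Proof. by case: b. Qed.

Lemma dual0 b : b 0 = 0. Proof. by case: b => b bc; exact: linear0. Qed.

Lemma dualD b x y : b (x + y) = b x + b y.
Proof. by case: b => b bc; exact: linearD. Qed.

Lemma dualB b x y : b (x - y) = b x - b y.
Proof. by case: b => b bc; exact: linearB. Qed.

Lemma dualZ b t x : b (t *: x) = t * b x.
Proof. by case: b => b bc; exact: linearZ. Qed.

Lemma dual_sum b (I : Type) (r : seq I) (Q : pred I) (F : I -> B) :
  b (\sum_(i <- r | Q i) F i) = \sum_(i <- r | Q i) b (F i).
Proof. by case: b => b bc; exact: (linear_sum b). Qed.

Lemma dual_bounded b : exists2 k, 0 < k & forall x, `|b x| <= k * `|x|.
Proof.
case: b => b bc; have /linear_boundedP[k [_ bk]] := continuous_linear_bounded 0 (bc 0).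
exists (Num.max 1 (k + 1)); first by rewrite lt_max ltr01.
by move=> x; apply: bk; rewrite lt_max ltrDl ltr01 orbT.
Qed.

Lemma exists_dual (f : B -> R) k : linear_for *%R f ->
  (forall x, `|f x| <= k * `|x|) -> exists b : dual B, forall x, b x = f x.
Proof.
move=> fl fk.
pose g : {linear B -> R^o} := HB.pack f (GRing.isLinear.Build _ _ _ _ (f : B -> R^o) fl).
suff gc : continuous g by exists (exist _ g gc).
apply: bounded_linear_continuous; apply/linear_boundedP.
exists `|k|; rewrite num_real; split => // r kr x; apply: (le_trans (fk x)).
by rewrite ler_wpM2r// ltW// (le_lt_trans (ler_norm _)).
Qed.

Lemma exists_dual_comb (s t : R) (b1 b2 : dual B) :
  exists b : dual B, forall x, b x = s * b1 x + t * b2 x.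
Proof.
have [k1 k10 b1k] := dual_bounded b1; have [k2 k20 b2k] := dual_bounded b2.
apply: (@exists_dual _ (`|s| * k1 + `|t| * k2)) => [a x y|x].
  by rewrite !dualD !dualZ; ring.
rewrite mulrDl (le_trans (ler_normD _ _))// !normrM lerD// -mulrA.
  exact: ler_wpM2l.
exact: ler_wpM2l.
Qed.

(** One operation serves for sums, differences and multiples; the multiple of [b] by [t] is written
    [dual_comb t 0 b b]. *)
Definition dual_comb s t b1 b2 : dual B := projT1 (cid (exists_dual_comb s t b1 b2)).

Lemma dual_combE s t b1 b2 x : dual_comb s t b1 b2 x = s * b1 x + t * b2 x.
Proof. by rewrite /dual_comb; case: cid. Qed.

(** Minimizing below the norm alone would not control the value at [x0]. The start is instead the
    slope functional of the norm in direction [x0], for which [q (- x0) <= - |x0|]; a minimal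
    functional below it is linear, dominated by the norm, and norming at [x0]. *)
Lemma exists_norming x0 :
  exists b : dual B, (forall x, `|b x| <= `|x|) /\ b x0 = `|x0|.
Proof.
have snorm : sublinear (fun x : B => `|x|).
  by split=> [x y|t x t0]; [exact: ler_normD|rewrite normrZ ger0_norm].
have [q [sq qn qx0]] := sublinear_le_slope x0 snorm.
have [p [sp pq pmin]] := minimal_sublinear sq.
have pl := minimal_sublinear_linear sp pmin.
have pN x : p (- x) = - p x.
  by have := pl (-1) x 0; rewrite (sublinear0 sp) !addr0 scaleN1r mulN1r.
have pn x : `|p x| <= `|x|.
  rewrite ler_norml -(normrN x); apply/andP; split.
    by rewrite lerNl -pN; exact: le_trans (pq _) (qn _).
  by rewrite normrN; exact: le_trans (pq _) (qn _).
have [b bE] := @exists_dual p 1 pl (fun x => eq_ind_r (fun z => _ <= z) (pn x) (mul1r _)).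
exists b; split=> [x|]; first by rewrite bE.
rewrite bE; apply/eqP; rewrite eq_le; apply/andP; split.
  exact: le_trans (ler_norm _) (pn _).
have := le_trans (pq (- x0)) (qx0 (- x0)).
by rewrite pN addNr normr0 sub0r lerN2.
Qed.

Lemma dual_norm_le x c : (forall b, (forall y, `|b y| <= `|y|) -> `|b x| <= c) ->
  `|x| <= c.
Proof.
move=> h; have [b [bn bx]] := exists_norming x.
by have := h b bn; rewrite bx normr_id.
Qed.

Lemma dual_separated x y : (forall b, b x = b y) -> x = y.
Proof.
move=> h; apply/eqP; rewrite -subr_eq0 -normr_le0.
by apply: dual_norm_le => b _; rewrite dualB h subrr normr0.
Qed.

End dual.

(** * Cosine functionals determine measures *)

Section threshold.
Context (R : realType).

Lemma bernoulli_ge (x : R) n : 0 <= x -> 1 + n%:R * x <= (1 + x) ^+ n.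
Proof.
move=> x0; elim: n => [|n IH]; first by rewrite mul0r addr0 expr0.
rewrite exprS; have x1 : 0 <= 1 + x by lra.
apply: le_trans (ler_wpM2l x1 IH); rewrite -natr1.
have : 0 <= n%:R * x * x by rewrite !mulr_ge0.
by lra.
Qed.

Lemma bernoulli_sub_ge (x : R) n : 0 <= x <= 1 -> 1 - n%:R * x <= (1 - x) ^+ n.
Proof.
move=> /andP[x0 x1]; elim: n => [|n IH]; first by rewrite mul0r subr0 expr0.
rewrite exprS; have x1' : 0 <= 1 - x by lra.
apply: le_trans (ler_wpM2l x1' IH); rewrite -natr1.
have : 0 <= n%:R * x * x by rewrite !mulr_ge0.
by lra.
Qed.

(** The polynomials [(1 - s ^+ m) ^+ (2 ^ m)] with [m = 2 n], known from elementary proofs of the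
    Stone-Weierstrass theorem, tend to 1 below [1/2] and to 0 above. The factor [n.+1%:R^-1] makes
    the limit at [1/2] itself equal to 1 instead of [exp (- 1)], so that closed half-spaces come
    out. *)
Definition threshold_poly n (s : R) := (1 - n.+1%:R^-1 * s ^+ n.*2) ^+ (4 ^ n).

Let arg01 n (s : R) : 0 <= s <= 1 -> 0 <= n.+1%:R^-1 * s ^+ n.*2 <= 1.
Proof.
move=> /andP[s0 s1]; rewrite mulr_ge0 ?exprn_ge0 ?invr_ge0//=.
by rewrite mulr_ile1 ?exprn_ge0 ?invr_ge0 ?exprn_ile1// invf_le1 ?ler1n.
Qed.

Lemma threshold_poly01 n (s : R) : 0 <= s <= 1 -> 0 <= threshold_poly n s <= 1.
Proof.
move=> /(arg01 n) /andP[a0 a1].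
by rewrite exprn_ge0 ?subr_ge0//= exprn_ile1// ?subr_ge0// lerBlDr lerDl.
Qed.

(* [4 ^ n * s ^+ n.*2 = (2 s) ^+ n.*2] is at most 1 for [s <= 1/2] and beats
   the factor [n.+1] as soon as [1/2 < s]. *)
Lemma cvg_threshold_poly (s : R) : 0 <= s <= 1 ->
  (fun n => threshold_poly n s) @ \oo --> ((s <= 2^-1)%R%:R : R).
Proof.
move=> s01; have /andP[s0 s1] := s01.
have nE n : (4 ^ n)%:R * (n.+1%:R^-1 * s ^+ n.*2) = ((2 * s) ^+ n) ^+ 2 * n.+1%:R^-1 :> R.
  have -> : (4 ^ n)%:R = 2 ^+ n.*2 :> R.
    by rewrite natrX -mul2n exprM; congr (_ ^+ n); ring.
  by rewrite -exprM muln2 exprMn -[RHS]mulrA [X in _ = _ * X]mulrC.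
have [sh|sh] := leP s 2^-1 => /=.
  apply: (@squeeze_cvgr _ _ _ _ (fun n => 1 - harmonic n) (cst 1)).
  - apply: nearW => n; have /andP[_ ->] := threshold_poly01 n s01.
    rewrite andbT (le_trans _ (bernoulli_sub_ge _ (arg01 n s01)))// nE.
    rewrite lerD2l lerN2 ler_piMl ?invr_ge0// exprn_ile1 ?exprn_ge0 ?exprn_ile1//; lra.
  - rewrite -[X in _ --> X]subr0; apply: cvgB; first exact: cvg_cst.
    exact: cvg_harmonic.
  - exact: cvg_cst.
have d0 : 0 < 2 * s - 1 by lra.
apply: (@squeeze_cvgr _ _ _ _ (cst 0) (fun n => ((2 * s - 1) ^+ 2)^-1 * harmonic n)).
- apply: nearW => n; have /andP[-> _] /= := threshold_poly01 n s01.
  set a := n.+1%:R^-1 * s ^+ n.*2; have /andP[a0 a1] : 0 <= a <= 1 := arg01 n s01.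
  (* [(1 - a) ^+ N * (1 + a) ^+ N = (1 - a ^+ 2) ^+ N <= 1], so decay of the polynomial follows from
     growth of the second factor. *)
  have h1 : threshold_poly n s * (1 + a) ^+ (4 ^ n) <= 1.
    rewrite /threshold_poly -/a -exprMn exprn_ile1//; first by apply: mulr_ge0; lra.
    have : 0 <= a * a by rewrite mulr_ge0.
    by lra.
  (* Bernoulli twice: for [(1 + a) ^+ (4 ^ n)], whose linear term is [((2 s) ^+ n) ^+ 2 / (n + 1)],
     and for [(2 s) ^+ n], which is at least [(n + 1) (2 s - 1)] because [2 s - 1 <= 1]. *)
  have h2 : (2 * s - 1) ^+ 2 * n.+1%:R <= (1 + a) ^+ (4 ^ n).
    apply: le_trans (bernoulli_ge _ a0); rewrite nE.
    have h3 : n.+1%:R * (2 * s - 1) <= (2 * s) ^+ n.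
      have := bernoulli_ge n (ltW d0).
      rewrite (_ : 1 + (2 * s - 1) = 2 * s); last by ring.
      by rewrite -[n.+1%:R]natr1; move: (_ ^+ n) (n%:R) => p q; lra.
    have h4 : (n.+1%:R * (2 * s - 1)) ^+ 2 <= ((2 * s) ^+ n) ^+ 2.
      by rewrite lerXn2r// ?nnegrE ?mulr_ge0 ?exprn_ge0//; lra.
    have n0 : (0 : R) < n.+1%:R by rewrite ltr0n.
    apply: (@le_trans _ _ (((2 * s) ^+ n) ^+ 2 / n.+1%:R)); last by rewrite lerDr.
    by rewrite ler_pdivlMr// mulrC (le_trans _ h4)// exprMn mulrA mulrC mulrA -expr2 mulrC.
  have dn0 : 0 < (2 * s - 1) ^+ 2 * n.+1%:R by rewrite mulr_gt0 ?exprn_gt0 ?ltr0n.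
  rewrite /harmonic -invfM -[leRHS]mul1r ler_pdivlMr//.
  apply: le_trans h1; rewrite ler_wpM2l//.
  by have /andP[] := threshold_poly01 n s01.
- exact: cvg_cst.
- by rewrite -[X in _ --> X](mulr0 ((2 * s - 1) ^+ 2)^-1); apply: cvgMr; exact: cvg_harmonic.
Qed.

(** Rescaling moves [u] into []-1, 1[], where the sine has the sign of its argument; in this way
    periodic functions detect a half-line in the limit. *)
Lemma near_sin_le0 (u : R) :
  \forall n \near \oo, (sin (u / n.+1%:R) <= 0) = (u <= 0).
Proof.
near=> n.
have n0 : (0 : R) < n.+1%:R by rewrite ltr0n.
have nu : `|u| / n.+1%:R < 1.
  rewrite ltr_pdivrMr// mul1r -natr1 ltr_pwDr//.
  by near: n; exact: nbhs_infty_ger.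
have npi : 1 < pi :> R by have := @pi_ge2 R; lra.
have [u0|u0] := leP u 0.
  have u0' : `|u| = - u by rewrite ler0_norm.
  rewrite -[u]opprK mulNr sinN oppr_le0 sin_ge0_pi//.
  by rewrite -u0' divr_ge0//= (ltW (lt_trans nu npi)).
apply/negbTE; rewrite -ltNge sin_gt0_pi// divr_gt0//=.
by rewrite gtr0_norm// in nu; exact: lt_trans npi.
Unshelve. all: by end_near. Qed.

End threshold.

(** * Bounded measurable functions *)

Section bounded_measurable.
Context d (X : measurableType d) (R : realType).
Implicit Types f g : X -> R.

Definition bdd_meas f := measurable_fun setT f /\ exists M : R, forall x, `|f x| <= M.

Lemma bdd_meas_cst c : bdd_meas (cst c).
Proof. by split=> //; exists `|c|. Qed.

Lemma bdd_meas_lin a f g : bdd_meas f -> bdd_meas g ->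
  bdd_meas (fun x => a * f x + g x).
Proof.
move=> [mf [M fM]] [mg [N gN]]; split.
  by apply: measurable_funD => //; exact: measurable_funM.
exists (`|a| * M + N) => x; rewrite (le_trans (ler_normD _ _))// lerD//.
by rewrite normrM ler_wpM2l.
Qed.

Lemma bdd_measM f g : bdd_meas f -> bdd_meas g -> bdd_meas (fun x => f x * g x).
Proof.
move=> [mf [M fM]] [mg [N gN]]; split; first exact: measurable_funM.
by exists (M * N) => x; rewrite normrM ler_pM.
Qed.

Lemma bdd_meas_cos f (p : R) : measurable_fun setT f ->
  bdd_meas (fun x => cos (f x + p)).
Proof.
move=> mf; split; last by exists 1 => x; exact: cos_max.
apply: (@measurableT_comp _ _ _ _ _ _ (@cos R)).
  exact: (continuous_measurable_fun (@continuous_cos R)).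
by apply: measurable_funD.
Qed.

Lemma bdd_meas_indic (E : set X) : measurable E -> bdd_meas (\1_E : X -> R).
Proof.
move=> mE; split; first exact: measurable_indic.
by exists 1 => x; rewrite indicE normr_nat lern1 leq_b1.
Qed.

End bounded_measurable.

(** What the uniqueness argument uses of an integral. Unlike measures, such functionals can be
    subtracted, so equality of two laws becomes the vanishing of one functional. *)
Record bm_functional d (X : measurableType d) (R : realType)
    (nu : (X -> R) -> R) : Prop := BmFunctional {
  bm_lin : forall a f g, bdd_meas f -> bdd_meas g ->
    nu (fun x => a * f x + g x) = a * nu f + nu g ;
  bm_cvg : forall (F : nat -> X -> R) (f : X -> R) (M : R),
    (forall n, measurable_fun setT (F n)) -> (forall n x, `|F n x| <= M) ->
    (forall x, F n x @[n --> \oo] --> f x) -> nu (F n) @[n --> \oo] --> nu f }.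

Definition halfspaces (X : Type) (R : realType) (L : set (X -> R)) :=
  [set A : set X | exists l r, L l /\ A = [set x | l x <= r]].

(** * Functionals vanishing at cosines vanish on the sigma-algebra of half-spaces *)

Section uniqueness.
Context d (X : measurableType d) (R : realType).
Variables (nu : (X -> R) -> R) (L : set (X -> R)).
Hypothesis bm_nu : bm_functional nu.
Hypothesis mL : forall l, L l -> measurable_fun setT l.
Hypothesis linL : forall a l1 l2, L l1 -> L l2 -> L (fun x => a * l1 x + l2 x).
Hypothesis L0 : L (cst 0).
Hypothesis nu_cos : forall l p, L l -> nu (fun x => cos (l x + p)) = 0.

(** Testing [f] against all cosines, and not only asking [nu f = 0], makes the class stable under
    multiplication by cosines, hence by everything that linear combinations and bounded limits
    produce from them. *)
Let H f := bdd_meas f /\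
  forall l p, L l -> nu (fun x => f x * cos (l x + p)) = 0.

Let nuZ a f : bdd_meas f -> nu (fun x => a * f x) = a * nu f.
Proof.
move=> bf; have h0 := bm_lin bm_nu 0 (bdd_meas_cst X 0) (bdd_meas_cst X 0).
have cst0 : nu (cst 0) = 0.
  rewrite (_ : cst 0 = fun x => 0 * (cst 0 : X -> R) x + (cst 0 : X -> R) x); last first.
    by apply/funext => x /=; rewrite mul0r addr0.
  rewrite h0 mul0r add0r.
  have := bm_lin bm_nu 1 (bdd_meas_cst X 0) (bdd_meas_cst X 0).
  rewrite (_ : (fun x : X => _) = cst 0); last by apply/funext => x /=; ring.
  lra.
rewrite (_ : (fun x => a * f x) = fun x => a * f x + (cst 0 : X -> R) x).
  by rewrite (bm_lin bm_nu)//; [rewrite cst0 addr0|exact: bdd_meas_cst].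
by apply/funext => x /=; rewrite addr0.
Qed.

Let LZ a l : L l -> L (fun x => a * l x).
Proof.
move=> Ll; have := linL a Ll L0.
by congr (L _); apply/funext => x /=; rewrite addr0.
Qed.

Let H_lin a f g : H f -> H g -> H (fun x => a * f x + g x).
Proof.
move=> [bf hf] [bg hg]; split; first exact: bdd_meas_lin.
move=> l p Ll; have bc := bdd_meas_cos p (mL Ll).
rewrite (_ : (fun x => _) =
    fun x => a * (f x * cos (l x + p)) + g x * cos (l x + p)).
  by rewrite (bm_lin bm_nu) ?hf ?hg ?mulr0 ?addr0//; exact: bdd_measM.
by apply/funext => x; ring.
Qed.

(** Product-to-sum formula: the arguments [l - l'] and [l + l'] stay in the linear class [L]. *)
Let H_cos f l p : L l -> H f -> H (fun x => f x * cos (l x + p)).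
Proof.
move=> Ll [bf hf]; split; first exact/bdd_measM/bdd_meas_cos/mL.
move=> l' p' Ll'.
have Lm : L (fun x => -1 * l' x + l x) by exact: linL.
have Lp : L (fun x => 1 * l' x + l x) by exact: linL.
rewrite (_ : (fun x => _) = fun x =>
    2^-1 * (f x * cos ((-1 * l' x + l x) + (p - p'))) +
    2^-1 * (f x * cos ((1 * l' x + l x) + (p + p')))).
  have b1 := bdd_measM bf (bdd_meas_cos (p - p') (mL Lm)).
  have b2 := bdd_measM bf (bdd_meas_cos (p + p') (mL Lp)).
  rewrite (bm_lin bm_nu)//.
    by rewrite nuZ// !hf// !mulr0 addr0.
  by apply: bdd_measM => //; exact: bdd_meas_cst.
apply/funext => x.
have -> : -1 * l' x + l x + (p - p') = (l x + p) - (l' x + p') by ring.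
have -> : 1 * l' x + l x + (p + p') = (l x + p) + (l' x + p') by ring.
by move: (l x + p) (l' x + p') => u v; rewrite cosB cosD; field.
Qed.

Let H_cvg F (f : X -> R) (M : R) : (forall n, H (F n)) -> (forall n x, `|F n x| <= M) ->
  (forall x, F n x @[n --> \oo] --> f x) -> H f.
Proof.
move=> HF FM Ff; split.
  split.
    apply: (@measurable_fun_cvg _ _ _ setT F).
      by move=> n; exact: (HF n).1.1.
    by move=> x _; exact: Ff.
  by exists M => x; apply: (cvgr_to_le (cvg_norm (Ff x))); exact: nearW.
move=> l p Ll; have bc := bdd_meas_cos p (mL Ll).
have : nu (fun x => F n x * cos (l x + p)) @[n --> \oo] -->
       nu (fun x => f x * cos (l x + p)).
  apply: (bm_cvg bm_nu (M := M)) => [n|n x|x].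
  - exact: (bdd_measM (HF n).1 bc).1.
  - by rewrite normrM -[leRHS]mulr1 ler_pM// cos_max.
  - by apply: cvgMl; exact: Ff.
rewrite (_ : (fun n => _) = cst 0); last first.
  by apply/funext => n; rewrite (HF n).2.
by move=> /(cvg_unique (@Rhausdorff R) (cvg_cst _)) <-.
Qed.

Let H_ext f g : H f -> (forall x, g x = f x) -> H g.
Proof. by move=> Hf fg; rewrite (_ : g = f)//; exact/funext. Qed.

Let H1 : H (cst 1).
Proof.
split; first exact: bdd_meas_cst.
by move=> l p Ll; under eq_fun do rewrite /= mul1r; exact: nu_cos.
Qed.

Let H0 : H (cst 0).
Proof. by apply: H_ext (H_lin (-1) H1 H1) _ => x /=; lra. Qed.

Let HZ a f : H f -> H (fun x => a * f x).
Proof. by move=> Hf; apply: H_ext (H_lin a Hf H0) _ => x; rewrite addr0. Qed.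

(** The affine change puts the sign change of the sine at [1/2], the threshold of [threshold_poly].
    The sine is a cosine with phase shift [- pi / 2], so products with [half_sin] stay in [H]. *)
Let half_sin (l : X -> R) (a : R) n x : R := (1 + sin ((l x - a) / n.+1%:R)) / 2.

Let half_sin01 l a n x : 0 <= half_sin l a n x <= 1.
Proof.
rewrite /half_sin; set u := _ / n.+1%:R.
by have := @sin_le1 R u; have := @sin_geN1 R u; lra.
Qed.

Let H_half_sin f l a n : L l -> H f -> H (fun x => f x * half_sin l a n x).
Proof.
move=> Ll Hf; have Ll' := LZ n.+1%:R^-1 Ll.
have Hc := H_cos (- (a / n.+1%:R) - pi / 2) Ll' Hf.
apply: H_ext (H_lin 2^-1 Hc (HZ 2^-1 Hf)) _ => x.
rewrite /half_sin -cosBpihalf.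
rewrite (_ : n.+1%:R^-1 * l x + _ = (l x - a) / n.+1%:R - pi / 2); first by field.
by rewrite mulrBl [l x / _]mulrC addrA.
Qed.

Let H_threshold f l a n k : L l -> H f ->
  H (fun x => f x * threshold_poly k (half_sin l a n x)).
Proof.
move=> Ll Hf.
have Hpow g j : H g -> H (fun x => g x * half_sin l a n x ^+ j).
  move=> Hg; elim: j => [|j IH].
    by apply: H_ext Hg _ => x; rewrite expr0 mulr1.
  by apply: H_ext (H_half_sin a n Ll IH) _ => x; rewrite exprSr mulrA.
rewrite /threshold_poly; elim: (4 ^ k)%N => [|j IH].
  by apply: H_ext Hf _ => x; rewrite expr0 mulr1.
apply: H_ext (H_lin (- k.+1%:R^-1) (Hpow _ k.*2 IH) IH) _ => x.
by rewrite exprSr; ring.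
Qed.

Let H_le f l a : L l -> H f -> H (fun x => f x * \1_[set x | l x <= a] x).
Proof.
move=> Ll Hf; have [_ [M fM]] := Hf.1.
have M0 x : 0 <= M := le_trans (normr_ge0 _) (fM x).
(* Two successive limits: in [k] the polynomials in [half_sin] become the indicator of [sin <= 0],
   then in [n] the rescaled sine yields the indicator of [l <= a]. *)
apply: (@H_cvg (fun n x => f x * (sin ((l x - a) / n.+1%:R) <= 0)%R%:R) _ M).
- move=> n; apply: (@H_cvg (fun k x => f x * threshold_poly k (half_sin l a n x)) _ M).
  + by move=> k; exact: H_threshold.
  + move=> k x; have /andP[t0 t1] := threshold_poly01 k (half_sin01 l a n x).
    by rewrite normrM (ger0_norm t0) -[leRHS]mulr1 ler_pM.
  + move=> x; apply: cvgMr.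
    have := cvg_threshold_poly (half_sin01 l a n x).
    rewrite (_ : (half_sin l a n x <= 2^-1) = (sin ((l x - a) / n.+1%:R) <= 0))//.
    by rewrite /half_sin ler_pdivrMr// mulVf// gerDl.
- move=> n x; rewrite normrM -[leRHS]mulr1 ler_pM//.
  by rewrite normr_nat lern1 leq_b1.
- move=> x; apply: cvgMr; apply: cvg_near_cst.
  have := near_sin_le0 (l x - a); apply: filterS => n ->.
  rewrite indicE subr_le0 (_ : (x \in _) = (l x <= a))//.
  by apply/idP/idP; rewrite inE.
Qed.

Let stable := [set A : set X | measurable A /\ forall f, H f -> H (fun x => f x * \1_A x)].

Let stableC A : stable A -> stable (setT `\` A).
Proof.
move=> [mA hA]; split; first exact: measurableD.
move=> f Hf; apply: H_ext (H_lin (-1) (hA f Hf) Hf) _ => x.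
rewrite setTD indicC /= indicE; case: (x \in A) => /=; ring.
Qed.

Let stableI A B : stable A -> stable B -> stable (A `&` B).
Proof.
move=> [mA hA] [mB hB]; split; first exact: measurableI.
move=> f Hf; apply: H_ext (hB _ (hA _ Hf)) _ => x.
by rewrite indicI mulrA.
Qed.

(** Intersections are products of multipliers and complements come from linearity, so finite unions
    are stable, and countable ones follow by bounded convergence. Stability under multiplication
    replaces a pi-lambda argument. *)
Let stable_sigma_algebra : sigma_algebra setT stable.
Proof.
have s0 : stable set0.
  by split=> // f Hf; apply: H_ext H0 _ => x; rewrite indic0 mulr0.
split; [exact: s0|exact: stableC|move=> A sA].
have sU n : stable (\bigcup_(i < n) A i).
  elim: n => [|n IH]; first by rewrite bigcup_mkord big_ord0.
  rewrite bigcup_mkord big_ord_recr/= -bigcup_mkord.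
  rewrite -[X in stable X]setCK setCU -setTD.
  apply: stableC; rewrite -[X in stable (X `&` _)]setTD -[X in stable (_ `&` X)]setTD.
  by apply: stableI; apply: stableC.
split; first by apply: bigcup_measurable => k _; exact: (sA k).1.
move=> f Hf; have [_ [M fM]] := Hf.1.
apply: (@H_cvg (fun n x => f x * \1_(\bigcup_(i < n) A i) x) _ M).
- by move=> n; exact: (sU n).2.
- move=> n x; rewrite normrM -[leRHS]mulr1 ler_pM// indicE.
  by rewrite normr_nat lern1 leq_b1.
- move=> x; apply: cvgMr; apply: cvg_near_cst.
  have [[k _ Akx]|nA] := pselect ((\bigcup_k A k) x).
    exists k.+1 => // n /= kn; rewrite !indicE !mem_set//; first by exists k.
    by exists k.
  apply: nearW => n; rewrite !indicE !memNset// => -[k _ Ak].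
  by apply: nA; exists k.
Qed.

Theorem bm_functional_indic0 E : <<s halfspaces L >> E -> nu (\1_E) = 0.
Proof.
have sub : <<s halfspaces L >> `<=` stable.
  apply: smallest_sub; first exact: stable_sigma_algebra.
  move=> _ [l [r [Ll ->]]]; split; last by move=> f Hf; exact: H_le.
  have := mL Ll measurableT (measurable_itv `]-oo, r]).
  by rewrite setTI set_itvE.
(* The multiplier [\1_E] is applied to the constant 1 and tested against [cos 0]. *)
move=> /sub[mE hE]; have := (hE _ H1).2 _ 0 L0.
by under eq_fun do rewrite /= mul1r addr0 cos0 mulr1.
Qed.

End uniqueness.

(** * Dominated convergence for real integrals, and weighted laws *)

Section Rintegral_limits.
Context d (T : measurableType d) (R : realType) (mu : {measure set T -> \bar R}).
Implicit Types f g : T -> R.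

Lemma le_integrable_EFin f g : measurable_fun setT f ->
  (forall x, `|f x| <= g x) -> mu.-integrable setT (EFin \o g) ->
  mu.-integrable setT (EFin \o f).
Proof.
move=> mf fg; apply: le_integrable => //; first exact/measurable_EFinP.
by move=> x _; rewrite /= lee_fin (le_trans (fg x))// ler_norm.
Qed.

Lemma integrableZ_EFin a f : mu.-integrable setT (EFin \o f) ->
  mu.-integrable setT (EFin \o (fun x => a * f x)).
Proof.
move=> /(integrableZl measurableT a).
by congr (integrable _ _ _); apply/funext => x /=; rewrite EFinM.
Qed.

Lemma integrableD_EFin f g : mu.-integrable setT (EFin \o f) ->
  mu.-integrable setT (EFin \o g) ->
  mu.-integrable setT (EFin \o (fun x => f x + g x)).
Proof. exact: integrableD. Qed.

Lemma integrableB_EFin f g : mu.-integrable setT (EFin \o f) ->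
  mu.-integrable setT (EFin \o g) ->
  mu.-integrable setT (EFin \o (fun x => f x - g x)).
Proof. exact: integrableB. Qed.

Lemma cvg_Rintegral_dominated (F : nat -> T -> R) f g :
  (forall n, measurable_fun setT (F n)) ->
  mu.-integrable setT (EFin \o g) -> (forall n x, `|F n x| <= g x) ->
  (forall x, F n x @[n --> \oo] --> f x) ->
  (\int[mu]_x F n x) @[n --> \oo] --> \int[mu]_x f x.
Proof.
move=> mF ig Fg Ff.
have mf : measurable_fun setT f.
  by apply: (@measurable_fun_cvg _ _ _ setT F) => // x _; exact: Ff.
have [|||||_ _ h] := @dominated_convergence _ _ _ mu _ measurableT
  (fun n => EFin \o F n) (EFin \o f) (EFin \o g).
- by move=> n; exact/measurable_EFinP.
- exact/measurable_EFinP.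
- by apply: aeW => x _; apply/fine_cvgP; split; [exact: nearW|exact: Ff].
- exact: ig.
- by apply: aeW => x n _; rewrite /= lee_fin.
apply: fine_cvg; rewrite fineK; first exact: h.
apply: integrable_fin_num => //; apply: le_integrable_EFin ig => // x.
by apply: (cvgr_to_le (cvg_norm (Ff x))); exact: nearW.
Qed.

Lemma integrableM_bdd f g : bdd_meas f -> mu.-integrable setT (EFin \o g) ->
  mu.-integrable setT (EFin \o (fun x => f x * g x)).
Proof.
move=> [mf [M fM]] ig.
have mg : measurable_fun setT g by apply/measurable_EFinP; case/integrableP: ig.
apply: (@le_integrable_EFin _ (fun x => `|M| * `|g x|)).
- exact: measurable_funM.
- by move=> x; rewrite normrM ler_wpM2r// (le_trans (fM x))// ler_norm.
- exact: integrableZ_EFin (integrable_norm ig).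
Qed.

(** The weight [Z] covers several uses at once: a density for a normal law, the constant 1 for the
    law of [V], an indicator or a cosine for joint laws. *)
Lemma bm_functional_Rintegral d' (X : measurableType d') (V : T -> X) (Z : T -> R) :
  measurable_fun setT V -> mu.-integrable setT (EFin \o Z) ->
  bm_functional (fun f : X -> R => \int[mu]_x (f (V x) * Z x)).
Proof.
move=> mV iZ.
have bV (f : X -> R) : bdd_meas f -> bdd_meas (fun x => f (V x)).
  move=> [mf [M fM]]; split; first exact: (measurableT_comp mf mV).
  by exists M.
have mZ : measurable_fun setT Z by apply/measurable_EFinP; case/integrableP: iZ.
split=> [a f g /bV bf /bV bg|F f M mF FM Ff].
- rewrite -RintegralZl//; last exact: integrableM_bdd.
  rewrite -RintegralD//.
  + by congr (Rintegral _ _ _); apply/funext => x; ring.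
  + exact: integrableZ_EFin (integrableM_bdd bf iZ).
  + exact: integrableM_bdd.
- apply: (@cvg_Rintegral_dominated _ _ (fun x => M * `|Z x|)).
  + move=> n; apply: measurable_funM => //.
    exact: (measurableT_comp (mF n) mV).
  + exact: integrableZ_EFin (integrable_norm iZ).
  + by move=> n x; rewrite normrM ler_wpM2r.
  + by move=> x; apply: cvgMl; exact: Ff.
Qed.

End Rintegral_limits.

(** * From indicators to bounded measurable functions *)

Section bm_functional_theory.
Context d (X : measurableType d) (R : realType).
Implicit Types nu : (X -> R) -> R.

Lemma bm_functional_lin nu1 nu2 c : bm_functional nu1 -> bm_functional nu2 ->
  bm_functional (fun f => nu1 f - c * nu2 f).
Proof.
move=> h1 h2; split=> [a f g bf bg|F f M mF FM Ff].
- by rewrite !bm_lin//; ring.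
- apply: cvgB; first exact: bm_cvg h1 _ _ _ mF FM Ff.
  by apply: cvgMr; exact: bm_cvg h2 _ _ _ mF FM Ff.
Qed.

(** The integer part of [y] when [0 <= y <= N], written as a sum of indicators so that linearity
    applies to it. *)
Let staircase N (y : R) : R := \sum_(k < N) (k.+1%:R <= y)%R%:R.

Let staircase_bound N y : 0 <= y <= N%:R -> y - 1 <= staircase N y <= y.
Proof.
elim: N => [|N IH] /andP[y0 yN].
  by rewrite /staircase big_ord0; apply/andP; split; lra.
rewrite /staircase big_ord_recr/=; have [yN'|yN'] := leP y N%:R.
  have -> : (N.+1%:R <= y) = false.
    by apply/negbTE; rewrite -ltNge (le_lt_trans yN')// ltr_nat.
  rewrite addr0.
  by apply: IH; rewrite y0.
rewrite (eq_bigr (fun=> 1)); last first.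
  move=> k _; rewrite (le_trans _ (ltW yN'))// ler_nat; exact: ltn_ord.
rewrite sumr_const card_ord -[N.+1%:R]natr1; rewrite -[N.+1%:R]natr1 in yN.
by have [h|h] /= := leP (N%:R + 1) y; apply/andP; split; lra.
Qed.

Lemma bm_functional_eq0 nu : bm_functional nu ->
  (forall E, measurable E -> nu (\1_E) = 0) -> forall f, bdd_meas f -> nu f = 0.
Proof.
move=> h nu0.
have nuC c : nu (cst c) = 0.
  have := bm_lin h c (bdd_meas_indic R (@measurableT _ X)) (bdd_meas_indic R (@measurable0 _ X)).
  rewrite !nu0// mulr0 addr0 => <-; congr nu; apply/funext => x.
  by rewrite indicT indic0 /= mulr1 addr0.
suff pos (M : nat) (f : X -> R) : measurable_fun setT f -> (forall x, 0 <= f x <= M%:R) -> nu f = 0.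
  move=> f [mf [M fM]].
  have bf : bdd_meas f by split=> //; exists M.
  (* Adding the constant [M], on which [nu] vanishes, reduces to nonnegative functions. *)
  have := bm_lin h 1 bf (bdd_meas_cst X M); rewrite nuC mul1r addr0 => <-.
  apply: (pos (Num.trunc (2 * M)).+1).
    by apply: measurable_funD => //; exact: measurable_funM.
  move=> x; have := fM x; rewrite ler_norml => /andP[f1 f2] /=.
  rewrite mul1r; apply/andP; split; first lra.
  by have := ltW (truncnS_gt (2 * M)); apply: le_trans; lra.
move=> mf f0M.
(* [f] rounded down to a multiple of [1 / (n + 1)]; the error is uniform in [x]. *)
pose F n x : R := n.+1%:R^-1 * staircase (M * n.+1) (n.+1%:R * f x).
have Fb n x : `|F n x - f x| <= n.+1%:R^-1.
  have n0 : (0 : R) < n.+1%:R by rewrite ltr0n.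
  have /andP[f0 fM] := f0M x.
  have /staircase_bound /andP[h1 h2] : 0 <= n.+1%:R * f x <= (M * n.+1)%:R.
    by rewrite mulr_ge0//= natrM mulrC ler_wpM2r.
  rewrite /F -[X in _ - X](mulKf (lt0r_neq0 n0)) -mulrBr normrM gtr0_norm ?invr_gt0//.
  by rewrite ler_piMr ?invr_ge0// ler_norml; apply/andP; split; lra.
have mF n k : measurable [set x | (k.+1%:R <= n.+1%:R * f x)%R].
  have mnf : measurable_fun setT (fun x => n.+1%:R * f x) by exact: measurable_funM.
  have := mnf measurableT _ (measurable_itv `[k.+1%:R, +oo[).
  by rewrite setTI set_itvE.
have nuF n : nu (F n) = 0.
  suff K m : bdd_meas (fun x => n.+1%:R^-1 * staircase m (n.+1%:R * f x)) /\
      nu (fun x => n.+1%:R^-1 * staircase m (n.+1%:R * f x)) = 0.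
    by case: (K (M * n.+1)%N).
  rewrite /staircase; elim: m => [|m [bm IH]].
    rewrite (_ : (fun x => _) = cst 0); last by apply/funext => x; rewrite big_ord0 mulr0.
    by split; [exact: bdd_meas_cst|].
  rewrite (_ : (fun x => _) = fun x => n.+1%:R^-1 * \1_[set x | (m.+1%:R <= n.+1%:R * f x)%R] x +
      n.+1%:R^-1 * \sum_(k < m) (k.+1%:R <= n.+1%:R * f x)%R%:R).
    split; first by apply: bdd_meas_lin => //; exact: bdd_meas_indic.
    by rewrite bm_lin ?nu0 ?IH ?mulr0 ?addr0//; exact: bdd_meas_indic.
  apply/funext => x; rewrite big_ord_recr/= mulrDr addrC indicE; congr (_ * _ + _).
  by congr (nat_of_bool _)%:R; apply/idP/idP; rewrite inE.
have := @bm_cvg _ _ _ _ h F f (M%:R + 1).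
rewrite (_ : (fun n => nu (F n)) = cst 0); last exact/funext.
move=> /(_ _ _ _)/(cvg_unique (@Rhausdorff R) (cvg_cst _)) <- //.
- move=> n; apply: measurable_funM => //.
  apply: measurable_sum => k.
  rewrite (_ : (fun x => _) = \1_[set x | (k.+1%:R <= n.+1%:R * f x)%R]).
    exact: measurable_indic.
  by apply/funext => x; rewrite indicE; congr (nat_of_bool _)%:R; apply/idP/idP; rewrite inE.
- move=> n x; have h1 := Fb n x; have /andP[f0 fM] := f0M x.
  rewrite -[F n x](subrK (f x)) (le_trans (ler_normD _ _))//.
  rewrite (le_trans (lerD h1 (lexx _)))// [leRHS]addrC lerD ?ger0_norm//.
  by rewrite invf_le1 ?ler1n// ltr0n.
- move=> x; apply/subr_cvg0; apply/norm_cvg0P.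
  apply: (@squeeze_cvgr _ _ _ _ (cst 0) harmonic).
  + by apply: nearW => n; rewrite normr_ge0 Fb.
  + exact: cvg_cst.
  + exact: cvg_harmonic.
Qed.

End bm_functional_theory.

(** * Cosine transform of the normal density *)

Section normal_cos.
Context (R : realType) (s : R).
Hypothesis s0 : 0 < s.
Local Notation mu := (@lebesgue_measure R).

Let w := normal_pdf 0 s : R -> R.
Let c : R := normal_peak s.

Let wE x : w x = c * expR (- x ^+ 2 / (s ^+ 2 *+ 2)).
Proof. by rewrite /w normal_pdfE ?gt_eqF// /normal_fun subr0. Qed.

Let w_ge0 x : 0 <= w x. Proof. exact: normal_pdf_ge0. Qed.

Let mw : measurable_fun setT w. Proof. exact: measurable_normal_pdf. Qed.

Let iw : mu.-integrable setT (EFin \o w).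
Proof. exact: integrable_normal_pdf. Qed.

Let leI (f g : R -> R) : measurable_fun setT f -> (forall x, `|f x| <= g x) ->
  mu.-integrable setT (EFin \o g) -> mu.-integrable setT (EFin \o f).
Proof. exact: (@le_integrable_EFin _ _ _ mu f g). Qed.

Let derive_w (x : R) : is_derive x 1 w (- (x / s ^+ 2) * w x).
Proof.
rewrite (_ : w = fun x => c * expR (- x ^+ 2 / (s ^+ 2 *+ 2))); last exact/funext.
have h : is_derive x 1 (fun x : R => - x ^+ 2 / (s ^+ 2 *+ 2)) (- (x / s ^+ 2)).
  by apply: is_derive_eq; rewrite /GRing.scale/=; field; rewrite gt_eqF.
have h' := is_derive1_comp (is_derive_expR _) h.
apply: is_derive_eq; rewrite /GRing.scale/=; ring.
Qed.

(** With [u = |x| / (2 s)], the inequalities [2 u <= 1 + u ^+ 2 <= expR (u ^+ 2)] trade the factor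
    [|x|] for half of the exponent. The right-hand side is a multiple of the normal density with
    deviation [sqrt 2 * s], hence integrable. *)
Let decay x : `|x| * w x <= s * c * expR (- x ^+ 2 / (s ^+ 2 *+ 4)).
Proof.
have sn0 : s != 0 by rewrite gt_eqF.
rewrite wE mulrCA [leRHS]mulrAC [leRHS]mulrC ler_wpM2l ?normal_peak_ge0//.
set y := x ^+ 2 / (s ^+ 2 *+ 4).
have -> : - x ^+ 2 / (s ^+ 2 *+ 2) = - y + - y by rewrite /y; field.
have -> : - x ^+ 2 / (s ^+ 2 *+ 4) = - y by rewrite /y mulNr.
rewrite expRD mulrA ler_wpM2r ?expR_ge0//.
rewrite expRN -ler_pdivlMr ?invr_gt0 ?expR_gt0// invrK.
apply: (@le_trans _ _ (s * (1 + y))); last by rewrite ler_wpM2l ?(ltW s0)// expR_ge1Dx.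
have -> : y = (`|x| / (s *+ 2)) ^+ 2 by rewrite /y exprMn real_normK ?num_real//; field.
set u := `|x| / (s *+ 2).
have -> : `|x| = s * (u *+ 2) by rewrite /u; field.
rewrite ler_wpM2l ?(ltW s0)//; have := sqr_ge0 (u - 1); rewrite sqrrB1; lra.
Qed.

Let ixw : mu.-integrable setT (EFin \o (fun x => `|x| * w x)).
Proof.
have sq2 : Num.sqrt 2 * s != 0 by rewrite mulf_neq0 ?gt_eqF// sqrtr_gt0.
pose k := s * c / normal_peak (Num.sqrt 2 * s).
apply: (@leI _ (fun x => k * normal_pdf 0 (Num.sqrt 2 * s) x)).
- by apply: measurable_funM => //; exact: measurableT_comp.
- move=> x; rewrite ger0_norm ?mulr_ge0// (le_trans (decay x))//.
  rewrite /k normal_pdfE// mulrA divfK ?gt_eqF ?normal_peak_gt0//.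
  rewrite /normal_fun subr0 exprMn sqr_sqrtr//.
  by have -> : 2 * s ^+ 2 *+ 2 = s ^+ 2 *+ 4 by ring.
- exact: (@integrableZ_EFin _ _ _ mu k _ (integrable_normal_pdf 0 (Num.sqrt 2 * s))).
Qed.

Let cvg_w0 : w n.+1%:R @[n --> \oo] --> 0.
Proof.
apply: (@squeeze_cvgr _ _ _ _ (cst 0) (fun n => s * c * harmonic n)).
- apply: nearW => n; rewrite w_ge0/= /harmonic ler_pdivlMr ?ltr0n// mulrC.
  have := decay n.+1%:R; rewrite ger0_norm// => /le_trans; apply.
  rewrite ler_piMr ?mulr_ge0 ?normal_peak_ge0 ?(ltW s0)// -[leRHS]expR0 ler_expR.
  by rewrite mulNr oppr_le0 divr_ge0 ?sqr_ge0// mulrn_wge0 ?sqr_ge0.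
- exact: cvg_cst.
- by rewrite -[X in _ --> X](mulr0 (s * c)); apply: cvgMr; exact: cvg_harmonic.
Qed.

Let derive_lin (t p x : R) : is_derive x 1 (fun x => t * x + p) t.
Proof.
by apply: is_derive_eq; rewrite /GRing.scale/=; ring.
Qed.

Let mlin (t p : R) : measurable_fun setT (fun x => t * x + p).
Proof. by apply: measurable_funD => //; exact: measurable_funM. Qed.

Let msin : measurable_fun setT (@sin R).
Proof. exact: (continuous_measurable_fun (@continuous_sin R)). Qed.

Let mcos : measurable_fun setT (@cos R).
Proof. exact: (continuous_measurable_fun (@continuous_cos R)). Qed.

Let iwcos t p : mu.-integrable setT (EFin \o (fun x => cos (t * x + p) * w x)).
Proof.
apply: integrableM_bdd iw; split; first exact: (measurableT_comp mcos (mlin t p)).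
by exists 1 => x; exact: cos_max.
Qed.

Let ixwsin t p : mu.-integrable setT (EFin \o (fun x => x * (sin (t * x + p) * w x))).
Proof.
apply: (leI _ _ ixw).
  apply: measurable_funM => //; apply: measurable_funM => //.
  exact: (measurableT_comp msin (mlin t p)).
move=> x; rewrite !normrM ler_wpM2l// (ger0_norm (w_ge0 x)) ler_piMl//.
exact: sin_max.
Qed.

(* Integration by parts, as [w' x = - (x / s ^+ 2) * w x]. *)
Let stein t p : \int[mu]_x (x * (sin (t * x + p) * w x)) =
  s ^+ 2 * t * \int[mu]_x (cos (t * x + p) * w x).
Proof.
pose G (x : R) := sin (t * x + p) * w x.
pose K (x : R) := t * (cos (t * x + p) * w x) - (s ^+ 2)^-1 * (x * (sin (t * x + p) * w x)).
have dG (x : R) : is_derive x 1 G (K x).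
  have h := is_derive1_comp (is_derive_sin _) (derive_lin t p x).
  have hw := derive_w x.
  apply: is_derive_eq; rewrite /K /GRing.scale/=; ring.
have itcos t p := @integrableZ_EFin _ _ _ mu t _ (iwcos t p).
have issin t p := @integrableZ_EFin _ _ _ mu (s ^+ 2)^-1 _ (ixwsin t p).
have iK : mu.-integrable setT (EFin \o K).
  exact: (@integrableB_EFin _ _ _ mu _ _ (itcos t p) (issin t p)).
have cK : continuous K.
  move=> x; apply: differentiable_continuous; apply/derivable1_diffP.
  have h1 := is_derive1_comp (is_derive_sin _) (derive_lin t p x).
  have h2 := is_derive1_comp (is_derive_cos _) (derive_lin t p x).
  have hw := derive_w x; rewrite /K.
  by apply: ex_derive.
have FTC n : \int[mu]_(x in `[- n.+1%:R, n.+1%:R]) K x = G n.+1%:R - G (- n.+1%:R).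
  rewrite /Rintegral (continuous_FTC2 (F := G))//.
  - by rewrite (@lt_trans _ _ 0) ?oppr_lt0 ?ltr0n.
  - exact: continuous_subspaceT.
  - have cG x : G @ x --> G x.
      apply: differentiable_continuous; apply/derivable1_diffP.
      by have := dG x; case.
    split; first by move=> x _; have := dG x; case.
      exact: cvg_at_right_filter.
    exact: cvg_at_left_filter.
  - by move=> x _; rewrite derive1E; exact: derive_val.
have lim0 : \int[mu]_(x in `[- n.+1%:R, n.+1%:R]) K x @[n --> \oo] --> 0.
  apply: norm_cvg0.
  apply: (@squeeze_cvgr _ _ _ _ (cst 0) (fun n => 2 * w n.+1%:R)).
  - apply: nearW => n; rewrite normr_ge0/= FTC.
    have wN x : w (- x) = w x by rewrite !wE sqrrN.
    have Gw x : `|G x| <= w x.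
      by rewrite /G normrM (ger0_norm (w_ge0 x)) ler_piMl// sin_max.
    rewrite (le_trans (ler_normB _ _))//.
    by have := lerD (Gw n.+1%:R) (Gw (- n.+1%:R)); rewrite wN; lra.
  - exact: cvg_cst.
  - by rewrite -[X in _ --> X](mulr0 2); apply: cvgMr.
have limK : \int[mu]_(x in `[- n.+1%:R, n.+1%:R]) K x @[n --> \oo] --> \int[mu]_x K x.
  under eq_fun do rewrite Rintegral_mkcond.
  have mK : measurable_fun setT K by apply/measurable_EFinP; case/integrableP: iK.
  apply: (@cvg_Rintegral_dominated _ _ _ mu _ K (fun x => `|K x|)).
  - by move=> n; apply/(measurable_restrictT _ _).1 => //; exact: measurable_funTS.
  - exact: integrable_norm iK.
  - by move=> n x; rewrite patchE; case: ifP => // _; rewrite normr0.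
  - move=> x; apply: cvg_near_cst; near=> n.
    rewrite patchE mem_set//= in_itv/= -ler_norml -natr1.
    by rewrite ler_wpDr//; near: n; exact: nbhs_infty_ger.
have K0 : \int[mu]_x K x = 0 by exact: (cvg_unique (@Rhausdorff R) limK lim0).
move: K0.
rewrite /K RintegralB//.
rewrite (@RintegralZl _ _ _ mu _ _ t measurableT (iwcos t p)).
rewrite (@RintegralZl _ _ _ mu _ _ (s ^+ 2)^-1 measurableT (ixwsin t p)).
move=> /subr0_eq h.
by rewrite -mulrA h mulVKf// gt_eqF// exprn_gt0.
Unshelve. all: by end_near. Qed.

Let F p t := \int[mu]_x (cos (t * x + p) * w x).

(** Differentiation under the integral sign, dominated by [|x| * w x], followed by [stein]: the
    transform solves a linear differential equation. *)
Let derive_F p (t : R) : is_derive t 1 (F p) (- (s ^+ 2 * t * F p t)).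
Proof.
pose f (t x : R) := cos (t * x + p) * w x.
have df (x u : R) : is_derive u 1 (f ^~ x) (- (x * (sin (u * x + p) * w x))).
  have h0 : is_derive u 1 (fun u : R => u * x + p) x.
    by apply: is_derive_eq; rewrite /GRing.scale/=; ring.
  have h := is_derive1_comp (is_derive_cos _) h0.
  apply: is_derive_eq; rewrite /GRing.scale/=; ring.
have d1f (x u : R) : partial1of2 f u x = - (x * (sin (u * x + p) * w x)).
  by rewrite partial1of2E derive_val.
have tI : `]t - 1, t + 1[%classic t by rewrite /= in_itv/=; apply/andP; split; lra.
have Gub (x u : R) : `]t - 1, t + 1[%classic x -> setT u ->
    `|partial1of2 f x u| <= `|u| * w u.
  move=> _ _; rewrite d1f normrN !normrM ler_wpM2l// (ger0_norm (w_ge0 u)).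
  by rewrite ler_piMl// sin_max.
have G0 x : 0 <= `|x| * w x by rewrite mulr_ge0.
have der := @derivable_under_integral R _ _ mu f setT measurableT t _ _ tI
  (fun u _ => iwcos u p) (fun u x _ _ => @ex_derive _ _ _ _ _ _ _ (df x u)) _ G0 ixw Gub.
have diff := @differentiation_under_integral R _ _ mu f setT measurableT t _ _ tI
  (fun u _ => iwcos u p) (fun u x _ _ => @ex_derive _ _ _ _ _ _ _ (df x u)) _ G0 ixw Gub.
apply: DeriveDef => //; rewrite -derive1E diff -stein.
under eq_Rintegral do rewrite d1f -mulN1r.
by rewrite RintegralZl// mulN1r.
Qed.

Lemma Rintegral_cos_normal_pdf t p :
  \int[mu]_x (cos (t * x + p) * normal_pdf 0 s x) =
  cos p * expR (- (s ^+ 2 * t ^+ 2 / 2)).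
Proof.
(* The integrating factor of that equation makes the derivative vanish, so the value at [t] is read
   off at 0. *)
pose E u := F p u * expR (s ^+ 2 * u ^+ 2 / 2).
have dE (u : R) : is_derive u 1 E 0.
  have h1 : is_derive u 1 (fun u : R => s ^+ 2 * u ^+ 2 / 2) (s ^+ 2 * u).
    by apply: is_derive_eq; rewrite /GRing.scale/=; field.
  have h2 := is_derive1_comp (is_derive_expR _) h1.
  have h3 := derive_F p u.
  by apply: is_derive_eq; rewrite /GRing.scale/=; ring.
have := is_derive_0_is_cst t 0 dE; rewrite /E expr0n/= mulr0 mul0r expR0 mulr1.
have -> : F p 0 = cos p.
  rewrite /F; under eq_Rintegral do rewrite mul0r add0r.
  rewrite RintegralZl//= -[RHS]mulr1; congr (_ * _).
  by rewrite /Rintegral integral_normal_pdf.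
by move=> <-; rewrite expRN mulfK// gt_eqF// expR_gt0.
Qed.

End normal_cos.

(** * Square-integrable random variables *)

Section square_integrable.
Context d (T : measurableType d) (R : realType) (P : probability T R).
Implicit Types X Y Z : T -> R.
Local Notation E f := (\int[P]_w f w).

Lemma bdd_meas_integrable X : bdd_meas X -> P.-integrable setT (EFin \o X).
Proof.
move=> [mX [M XM]]; apply: measurable_bounded_integrable => //.
  by rewrite (le_lt_trans (probability_le1 P measurableT))// ltry.
exists M; split; first exact: num_real.
by move=> r /ltW Mr x _; exact: le_trans (XM x) Mr.
Qed.

Lemma Rintegral_indic A : measurable A -> \int[P]_w \1_A w = fine (P A).
Proof. by move=> mA; rewrite /Rintegral integral_indic// setIT. Qed.

Lemma Rintegral_cst1 c : \int[P]_w c = c.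
Proof.
transitivity (c * fine (P setT)); first exact: (Rintegral_cst P measurableT).
by have -> : P setT = 1%E := probability_setT P; rewrite /= mulr1.
Qed.

Definition sq_int X :=
  measurable_fun setT X /\ P.-integrable setT (EFin \o (fun w => X w ^+ 2)).

Lemma sq_int_bdd X : bdd_meas X -> sq_int X.
Proof.
move=> bX; split; first exact: bX.1.
have := bdd_meas_integrable (bdd_measM bX bX).
by congr (integrable _ _ _); apply/funext => x /=; rewrite expr2.
Qed.

Lemma sq_int_dominated X Y : measurable_fun setT X -> sq_int Y ->
  (forall w, `|X w| <= `|Y w|) -> sq_int X.
Proof.
move=> mX [mY iY] XY; split=> //; apply: le_integrable_EFin iY.
  exact: measurable_funX.
move=> w; rewrite ger0_norm ?sqr_ge0// -(real_normK (num_real (X w))).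
by rewrite -(real_normK (num_real (Y w))) lerXn2r// ?nnegrE.
Qed.

Lemma sq_int_mul X Y : sq_int X -> sq_int Y ->
  P.-integrable setT (EFin \o (fun w => X w * Y w)).
Proof.
move=> [mX iX] [mY iY]; apply: le_integrable_EFin (integrableD_EFin iX iY).
  exact: measurable_funM.
move=> w; rewrite normrM -[X w ^+ 2]real_normK ?num_real// -[Y w ^+ 2]real_normK ?num_real//.
have := sqr_ge0 (`|X w| - `|Y w|); rewrite sqrrB.
have : 0 <= `|X w| * `|Y w| by rewrite mulr_ge0.
by rewrite mulr2n; lra.
Qed.

Lemma sq_int_cst c : sq_int (cst c).
Proof. exact/sq_int_bdd/bdd_meas_cst. Qed.

Lemma sq_int_integrable X : sq_int X -> P.-integrable setT (EFin \o X).
Proof.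
move=> sX; have := sq_int_mul sX (sq_int_cst 1).
by congr (integrable _ _ _); apply/funext => x /=; rewrite mulr1.
Qed.

Lemma sq_int_lin a X Y : sq_int X -> sq_int Y -> sq_int (fun w => a * X w + Y w).
Proof.
move=> sX sY; split.
  by apply: measurable_funD; [apply: measurable_funM => //; exact: sX.1|exact: sY.1].
have := integrableD_EFin (integrableD_EFin (integrableZ_EFin (a ^+ 2) sX.2) sY.2)
  (integrableZ_EFin (2 * a) (sq_int_mul sX sY)).
by congr (integrable _ _ _); apply/funext => w /=; congr EFin; ring.
Qed.

Lemma sq_intB X Y : sq_int X -> sq_int Y -> sq_int (fun w => X w - Y w).
Proof.
move=> sX sY; have := sq_int_lin (-1) sY sX.
by under eq_fun do rewrite mulN1r addrC.
Qed.

Lemma sq_intZ a X : sq_int X -> sq_int (fun w => a * X w).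
Proof.
move=> sX; have := sq_int_lin a sX (sq_int_cst 0).
by under eq_fun do rewrite addr0.
Qed.

Definition ip X Y := E (fun w => X w * Y w).

Lemma ipC X Y : ip X Y = ip Y X.
Proof. by rewrite /ip; under eq_Rintegral do rewrite mulrC. Qed.

Lemma ipDl a X Y Z : sq_int X -> sq_int Y -> sq_int Z ->
  ip (fun w => a * X w + Y w) Z = a * ip X Z + ip Y Z.
Proof.
move=> sX sY sZ; rewrite /ip -RintegralZl//; last exact: sq_int_mul.
rewrite -RintegralD//; last exact: sq_int_mul.
  by apply: eq_Rintegral => w _; ring.
exact/integrableZ_EFin/sq_int_mul.
Qed.

Lemma ipDr a X Y Z : sq_int X -> sq_int Y -> sq_int Z ->
  ip Z (fun w => a * X w + Y w) = a * ip Z X + ip Z Y.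
Proof. by move=> *; rewrite ipC ipDl// ipC [ip Y Z]ipC. Qed.

Lemma ipBl X Y Z : sq_int X -> sq_int Y -> sq_int Z ->
  ip (fun w => X w - Y w) Z = ip X Z - ip Y Z.
Proof.
move=> sX sY sZ; have := ipDl (-1) sY sX sZ; rewrite mulN1r addrC => <-.
by congr ip; apply/funext => w; ring.
Qed.

Lemma ipBr X Y Z : sq_int X -> sq_int Y -> sq_int Z ->
  ip Z (fun w => X w - Y w) = ip Z X - ip Z Y.
Proof. by move=> *; rewrite ipC ipBl// ipC [ip Y Z]ipC. Qed.

Lemma ipZl a X Z : sq_int X -> sq_int Z -> ip (fun w => a * X w) Z = a * ip X Z.
Proof.
move=> sX sZ; rewrite /ip -RintegralZl//; last exact: sq_int_mul.
by apply: eq_Rintegral => w _; rewrite mulrA.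
Qed.

Lemma ip_combl a b X Y Z : sq_int X -> sq_int Y -> sq_int Z ->
  ip (fun w => a * X w + b * Y w) Z = a * ip X Z + b * ip Y Z.
Proof. by move=> sX sY sZ; rewrite ipDl ?ipZl//; exact: sq_intZ. Qed.

Lemma ip_ge0 X : 0 <= ip X X.
Proof. by apply: Rintegral_ge0 => w _; rewrite -expr2 sqr_ge0. Qed.

Lemma ip_lin a b X Y : sq_int X -> sq_int Y ->
  ip (fun w => a * X w + b * Y w) (fun w => a * X w + b * Y w) =
  a ^+ 2 * ip X X + 2 * a * b * ip X Y + b ^+ 2 * ip Y Y.
Proof.
move=> sX sY; have sbY := sq_intZ b sY; have sL := sq_int_lin a sX sbY.
rewrite ipDl// !ipDr//.
rewrite [ip X (fun w => b * Y w)]ipC !ipZl// [ip Y (fun w => b * Y w)]ipC ipZl//.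
by rewrite [ip Y X]ipC; ring.
Qed.

Lemma cauchy_schwarz X Y : sq_int X -> sq_int Y ->
  ip X Y ^+ 2 <= ip X X * ip Y Y.
Proof.
move=> sX sY; have [Y0|Y0] := eqVneq (ip Y Y) 0.
  rewrite Y0 mulr0; have [->|xy0] := eqVneq (ip X Y) 0; first by rewrite expr0n.
  (* As [ip Y Y = 0], the quadratic form is affine in the coefficient of [Y]; this coefficient gives
     it the value [-1]. *)
  have := ip_ge0 (fun w => 1 * X w + (- (ip X X + 1) / (2 * ip X Y)) * Y w).
  rewrite ip_lin// Y0.
  have -> : 1 ^+ 2 * ip X X + 2 * 1 * (- (ip X X + 1) / (2 * ip X Y)) * ip X Y +
    (- (ip X X + 1) / (2 * ip X Y)) ^+ 2 * 0 = -1 by field.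
  by rewrite ler0N1.
have Yp : 0 < ip Y Y by rewrite lt_def Y0 ip_ge0.
have := ip_ge0 (fun w => ip Y Y * X w + (- ip X Y) * Y w).
rewrite ip_lin//.
have -> : ip Y Y ^+ 2 * ip X X + 2 * ip Y Y * - ip X Y * ip X Y +
  (- ip X Y) ^+ 2 * ip Y Y = ip Y Y * (ip X X * ip Y Y - ip X Y ^+ 2) by ring.
by rewrite pmulr_rge0// subr_ge0.
Qed.

Definition nrm2 X := Num.sqrt (ip X X).

Lemma nrm2_ge0 X : 0 <= nrm2 X. Proof. exact: sqrtr_ge0. Qed.

Lemma nrm2_sqr X : nrm2 X ^+ 2 = ip X X. Proof. by rewrite sqr_sqrtr ?ip_ge0. Qed.

Lemma ip_le_nrm2 X Y : sq_int X -> sq_int Y -> `|ip X Y| <= nrm2 X * nrm2 Y.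
Proof.
move=> sX sY; rewrite -ler_sqr ?nnegrE ?mulr_ge0 ?nrm2_ge0//.
by rewrite real_normK ?num_real// exprMn !nrm2_sqr cauchy_schwarz.
Qed.

Lemma nrm2_triangle X Y : sq_int X -> sq_int Y ->
  nrm2 (fun w => X w + Y w) <= nrm2 X + nrm2 Y.
Proof.
move=> sX sY; rewrite -ler_sqr ?nnegrE ?addr_ge0 ?nrm2_ge0// sqrrD !nrm2_sqr.
have := ip_lin 1 1 sX sY; under eq_fun do rewrite !mul1r.
move=> ->; have := le_trans (ler_norm _) (ip_le_nrm2 sX sY); lra.
Qed.

Lemma nrm2N X : nrm2 (fun w => - X w) = nrm2 X.
Proof. by congr Num.sqrt; apply: eq_Rintegral => w _; rewrite mulrNN. Qed.

Lemma nrm2B_sym X Y : nrm2 (fun w => X w - Y w) = nrm2 (fun w => Y w - X w).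
Proof. by rewrite -nrm2N; congr nrm2; apply/funext => w; rewrite opprB. Qed.

Lemma nrm2_dist X Y Z : sq_int X -> sq_int Y -> sq_int Z ->
  nrm2 (fun w => X w - Z w) <= nrm2 (fun w => X w - Y w) + nrm2 (fun w => Y w - Z w).
Proof.
move=> sX sY sZ; apply: le_trans (nrm2_triangle (sq_intB sX sY) (sq_intB sY sZ)).
by rewrite (_ : (fun w => _) = (fun w => X w - Y w + (Y w - Z w)))//; apply/funext => w; ring.
Qed.

Lemma Rintegral_norm_le_nrm2 X : sq_int X -> E (fun w => `|X w|) <= nrm2 X.
Proof.
move=> sX.
have saX : sq_int (fun w => `|X w|).
  apply: (sq_int_dominated _ sX) => [|w]; last by rewrite normr_id.
  by apply: measurableT_comp => //; exact: sX.1.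
have := le_trans (ler_norm _) (ip_le_nrm2 saX (sq_int_cst 1)).
have -> : nrm2 (cst 1) = 1.
  rewrite /nrm2 /ip /=; under eq_Rintegral do rewrite mulr1.
  by rewrite -[RHS]sqrtr1; congr Num.sqrt; exact: Rintegral_cst1.
have -> : nrm2 (fun w => `|X w|) = nrm2 X.
  congr Num.sqrt; apply: eq_Rintegral => w _.
  by rewrite -normrM ger0_norm// -expr2 sqr_ge0.
by rewrite mulr1 /ip; under eq_Rintegral do rewrite mulr1.
Qed.

Definition cvgL2 (X : nat -> T -> R) Y := nrm2 (fun w => X n w - Y w) @[n --> \oo] --> 0.

Lemma nrm2Z a X : sq_int X -> nrm2 (fun w => a * X w) = `|a| * nrm2 X.
Proof.
move=> sX; rewrite /nrm2 -sqrtr_sqr -sqrtrM ?sqr_ge0//; congr Num.sqrt.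
rewrite /ip -RintegralZl//; last exact: sq_int_mul.
by apply: eq_Rintegral => w _; ring.
Qed.

Lemma nrm2_cst0 : nrm2 (cst 0) = 0.
Proof.
rewrite /nrm2 -[RHS]sqrtr0; congr Num.sqrt.
by rewrite /ip -[RHS]Rintegral_cst1; apply: eq_Rintegral => w _; exact: mul0r.
Qed.

Lemma cvgL2_cst X : cvgL2 (fun=> X) X.
Proof.
rewrite /cvgL2 (_ : (fun n => _) = cst 0); first exact: cvg_cst.
apply/funext => n; rewrite -nrm2_cst0; congr nrm2; apply/funext => w.
by rewrite subrr.
Qed.

Lemma cvgL2_lin (X Y : nat -> T -> R) X0 Y0 s t :
  (forall n, sq_int (X n)) -> sq_int X0 -> (forall n, sq_int (Y n)) -> sq_int Y0 ->
  cvgL2 X X0 -> cvgL2 Y Y0 ->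
  cvgL2 (fun n w => s * X n w + t * Y n w) (fun w => s * X0 w + t * Y0 w).
Proof.
move=> sX sX0 sY sY0 cX cY.
apply: (@squeeze_cvgr _ _ _ _ (cst 0) (fun n => `|s| * nrm2 (fun w => X n w - X0 w) +
  `|t| * nrm2 (fun w => Y n w - Y0 w))).
- apply: nearW => n; rewrite nrm2_ge0/= -!nrm2Z; [|exact: sq_intB..].
  apply: le_trans (nrm2_triangle (sq_intZ s (sq_intB (sX n) sX0)) (sq_intZ t (sq_intB (sY n) sY0))).
  rewrite (_ : (fun w => _) = fun w => s * (X n w - X0 w) + t * (Y n w - Y0 w))//.
  by apply/funext => w; ring.
- exact: cvg_cst.
- have -> : (0 : R) = `|s| * 0 + `|t| * 0 by ring.
  by apply: cvgD; apply: cvgMr.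
Qed.

Lemma cvgL2_ip (X Y : nat -> T -> R) X0 Y0 :
  (forall n, sq_int (X n)) -> sq_int X0 -> (forall n, sq_int (Y n)) -> sq_int Y0 ->
  cvgL2 X X0 -> cvgL2 Y Y0 -> ip (X n) (Y n) @[n --> \oo] --> ip X0 Y0.
Proof.
move=> sX sX0 sY sY0 cX cY; apply/subr_cvg0/norm_cvg0P.
pose u n := nrm2 (fun w => X n w - X0 w); pose v n := nrm2 (fun w => Y n w - Y0 w).
apply: (@squeeze_cvgr _ _ _ _ (cst 0)
  (fun n => u n * v n + (u n * nrm2 Y0 + nrm2 X0 * v n))).
- apply: nearW => n; rewrite normr_ge0/=.
  have -> : ip (X n) (Y n) - ip X0 Y0 =
    ip (fun w => X n w - X0 w) (fun w => Y n w - Y0 w) +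
    (ip (fun w => X n w - X0 w) Y0 + ip X0 (fun w => Y n w - Y0 w)).
    by rewrite !ipBl ?ipBr//; [ring|exact: sq_intB].
  apply: (le_trans (ler_normD _ _)); apply: lerD.
    by apply: ip_le_nrm2; exact: sq_intB.
  apply: (le_trans (ler_normD _ _)); apply: lerD; apply: ip_le_nrm2 => //; exact: sq_intB.
- exact: cvg_cst.
- have -> : (0 : R) = 0 * 0 + (0 * nrm2 Y0 + nrm2 X0 * 0) by ring.
  apply: cvgD; first exact: cvgM.
  by apply: cvgD; [apply: cvgMl|apply: cvgMr].
Qed.

End square_integrable.

(** * Fatou's lemma and completeness of L2 *)

Section riesz_fischer.
Context d (T : measurableType d) (R : realType) (P : probability T R).
Implicit Types X Y Z : T -> R.
Local Notation E f := (\int[P]_w f w).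

(** Integrability of the limit is a conclusion. This is what is needed where no dominating function
    is known beforehand: for L2 limits, and for second moments recovered from characteristic
    functions. *)
Lemma Rintegral_fatou (F : nat -> T -> R) (f : T -> R) (c : R) :
  (forall n, measurable_fun setT (F n)) -> (forall n w, 0 <= F n w) ->
  (forall n, P.-integrable setT (EFin \o F n)) ->
  (forall w, F n w @[n --> \oo] --> f w) -> (forall n, E (F n) <= c) ->
  P.-integrable setT (EFin \o f) /\ E f <= c.
Proof.
move=> mF F0 iF Ff Fc.
have mf : measurable_fun setT f.
  by apply: (@measurable_fun_cvg _ _ _ setT F) => // w _; exact: Ff.
have f0 w : 0 <= f w by apply: (cvgr_to_ge (Ff w)); exact: nearW.
have le_c : (\int[P]_w (f w)%:E <= c%:E)%E.
  have -> : (\int[P]_w (f w)%:E = \int[P]_w (limn_einf (fun n => (F n w)%:E)))%E.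
    apply: eq_integral => w _.
    have /cvg_limn_einf_sup[->//] : (F n w)%:E @[n --> \oo] --> (f w)%:E.
    by apply/fine_cvgP; split; [exact: nearW|exact: Ff].
  apply: (le_trans (fatou _ _ _ _)) => //.
  - by move=> n; exact/measurable_EFinP.
  - by move=> n w _; rewrite lee_fin.
  - rewrite limn_einf_lim; apply: lime_le; first exact: is_cvg_einfs.
    apply: nearW => n; apply: (@le_trans _ _ (\int[P]_w (F n w)%:E)%E).
      by apply: ereal_inf_lbound; exists n => /=.
    rewrite -[leLHS]fineK ?lee_fin; first exact: Fc.
    exact: integrable_fin_num (iF n).
split; last first.
  rewrite /Rintegral -lee_fin fineK//; apply: fin_real.
  rewrite (le_lt_trans le_c) ?ltry// andbT; apply: (lt_le_trans ltNy0).
  by apply: integral_ge0 => w _; rewrite lee_fin.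
apply/integrableP; split; first exact/measurable_EFinP.
under eq_integral do rewrite /= ger0_norm//.
by rewrite (le_lt_trans le_c) ?ltry.
Qed.

Lemma nrm2_ae0 X A : measurable A -> P (~` A) = 0%E -> sq_int P X ->
  nrm2 P (fun w => X w - X w * \1_A w) = 0.
Proof.
move=> mA A0 sX; rewrite /nrm2 (_ : ip _ _ _ = 0) ?sqrtr0//.
have mD : measurable_fun setT (fun w => X w - X w * \1_A w).
  apply: measurable_funB; first exact: sX.1.
  by apply: measurable_funM; [exact: sX.1|exact: measurable_indic].
rewrite /ip /Rintegral (ae_eq_integral (cst 0%E))//.
- by rewrite integral0.
- by apply/measurable_EFinP; exact: measurable_funM.
- exists (~` A); split => //; first exact: measurableC.
  move=> w /= h Aw; apply: h => _; rewrite indicE mem_set//.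
  by rewrite mulr1 subrr mul0r.
Qed.

Lemma sum_half n : \sum_(0 <= k < n) 2^-1 ^+ k <= 2 :> R.
Proof.
have : \sum_(0 <= k < n) 2^-1 ^+ k = 2 - 2 * 2^-1 ^+ n :> R.
  elim: n => [|n IH]; first by rewrite big_nil expr0 mulr1 subrr.
  by rewrite big_nat_recr//= IH exprS; field.
by move=> ->; rewrite lerBlDr lerDl mulr_ge0// exprn_ge0.
Qed.

Lemma riesz_fischer (X : nat -> T -> R) : (forall n, sq_int P (X n)) ->
  (forall e : R, 0 < e -> exists N, forall m n, (N <= m)%N -> (N <= n)%N ->
    nrm2 P (fun w => X m w - X n w) < e) ->
  exists Y, sq_int P Y /\ cvgL2 P X Y.
Proof.
move=> sX cX.
have e0 k : 0 < 2^-1 ^+ k :> R by rewrite exprn_gt0.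
(* [k <= N k] lets the subsequence tend to infinity. Summing the [N i] below makes both [u k] and
   [u k.+1] at least [N k] although [N] may fail to be monotone. *)
pose N k := maxn k (projT1 (cid (cX _ (e0 k)))).
have NP k m n : (N k <= m)%N -> (N k <= n)%N ->
    nrm2 P (fun w => X m w - X n w) < 2^-1 ^+ k.
  by rewrite /N; case: cid => ? /= h; rewrite !geq_max => /andP[_ ?] /andP[_ ?]; exact: h.
pose u k := (\sum_(i < k.+1) N i)%N.
have Nu k : (N k <= u k)%N by rewrite /u big_ord_recr/= leq_addl.
have NuS k : (N k <= u k.+1)%N.
  by rewrite (leq_trans (Nu k))// /u [in leqRHS]big_ord_recr/= leq_addr.
have uk k : (k <= u k)%N by rewrite (leq_trans _ (Nu k))// leq_maxl.
pose D k w := `|X (u k.+1) w - X (u k) w|.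
have sD k : sq_int P (fun w => X (u k.+1) w - X (u k) w) by exact: sq_intB.
have mD k : measurable_fun setT (D k).
  by apply: measurableT_comp => //; exact: (sD k).1.
have ED k : (\int[P]_w (D k w)%:E <= (2^-1 ^+ k)%:E)%E.
  have iD := integrable_norm (sq_int_integrable (sD k)).
  rewrite -[leLHS]fineK ?lee_fin; last exact: integrable_fin_num iD.
  exact: le_trans (Rintegral_norm_le_nrm2 (sD k)) (ltW (NP k _ _ (NuS k) (Nu k))).
have D0 k w : 0 <= D k w by exact: normr_ge0.
(* The L1 norm is below the L2 norm, so the increments have summable means; [S] is almost everywhere
   finite and the subsequence converges there. *)
pose S w : \bar R := (\sum_(0 <= k <oo) (D k w)%:E)%E.
have S0 w : (0 <= S w)%E by apply: nneseries_ge0 => k _ _; rewrite lee_fin.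
have mS : measurable_fun setT S.
  apply: (@ge0_emeasurable_sum _ _ _ _ (fun k w => (D k w)%:E) xpredT) => k.
    by move=> *; rewrite lee_fin.
  by move=> _; exact/measurable_EFinP.
have iS : P.-integrable setT S.
  apply/integrableP; split=> //; under eq_integral do rewrite gee0_abs//.
  rewrite integral_nneseries//; last 2 first.
    by move=> k; exact/measurable_EFinP.
    by move=> k w _; rewrite lee_fin.
  apply: (@le_lt_trans _ _ 2%:E); last by rewrite ltry.
  apply: lime_le.
    by apply: is_cvg_nneseries => k _ _; apply: integral_ge0 => w _; rewrite lee_fin.
  apply: nearW => n; apply: (le_trans (lee_sum _ (fun k _ => ED k))).
  by rewrite sumEFin lee_fin sum_half.
have [B [mB B0 Bfin]] := integrable_ae measurableT iS.
pose A := ~` B.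
have mA : measurable A by exact: measurableC.
have A0 : P (~` A) = 0%E by rewrite setCK.
have Sfin w : A w -> S w \is a fin_num.
  move=> Aw; apply: contrapT => h; apply: Aw; apply: Bfin => /= /(_ I).
  exact: h.
have cvgX w : A w -> cvgn (fun k => X (u k) w).
  move=> /Sfin Sw.
  have -> : (fun k => X (u k) w) =
      (fun k => X (u 0) w + series (fun k => X (u k.+1) w - X (u k) w) k).
    apply/funext => k; rewrite /series/= telescope_sumr// ?[_ + (_ - _)]addrC ?subrK//.
  apply: is_cvgD; first exact: is_cvg_cst.
  apply: normed_cvg; rewrite /normed_series_of; apply: nondecreasing_is_cvgn.
    by apply/nondecreasing_seqP => k; rewrite !seriesEnat/= [leRHS]big_nat_recr//= lerDl.
  exists (fine (S w)) => _ [k _ <-].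
  rewrite -lee_fin fineK// seriesEnat/= -sumEFin.
  by apply: nneseries_lim_ge => j _ _; rewrite lee_fin.
(* Setting the variables to 0 off the convergence set makes the subsequence converge everywhere, so
   that Fatou's lemma and measurability of the limit involve no exceptional set. *)
pose X' n w := X n w * \1_A w.
have sX' n : sq_int P (X' n).
  apply: (sq_int_dominated _ (sX n)) => [|w].
    by apply: measurable_funM; [exact: (sX n).1|exact: measurable_indic].
  by rewrite normrM -[leRHS]mulr1 ler_wpM2l// indicE normr_nat lern1 leq_b1.
pose Y w := limn (fun k => X' (u k) w).
have cvgY w : X' (u k) w @[k --> \oo] --> Y w.
  rewrite /Y /X' indicE; have [|_] := boolP (w \in A).
    by rewrite inE => /cvgX cw; under eq_fun do rewrite mulr1; exact: cw.
  by under eq_fun do rewrite mulr0; exact: is_cvg_cst.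
have XX' n : nrm2 P (fun w => X n w - X' n w) = 0 by exact: nrm2_ae0.
have key e n : 0 < e -> (forall k, (n <= k)%N -> nrm2 P (fun w => X n w - X k w) <= e) ->
  sq_int P (fun w => X' n w - Y w) /\ nrm2 P (fun w => X' n w - Y w) <= e.
  (* Fatou's lemma is applied along [u (k + n)], shifted so that all indices are at least [n]. *)
  move=> e_gt0 Xe; pose Z k w := X n w - X (u (k + n)%N) w.
  have sZ k : sq_int P (Z k) by exact: sq_intB.
  have sZ' k : sq_int P (fun w => X' n w - X' (u (k + n)%N) w) by exact: sq_intB.
  have mY : measurable_fun setT Y.
    by apply: (@measurable_fun_cvg _ _ _ setT (fun k => X' (u k))) => // k; exact: (sX' _).1.
  have [|||||i_ h] := @Rintegral_fatou (fun k w => (X' n w - X' (u (k + n)%N) w) ^+ 2)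
      (fun w => (X' n w - Y w) ^+ 2) (e ^+ 2).
  - by move=> k; apply: measurable_funX; exact: (sZ' k).1.
  - by move=> k w; exact: sqr_ge0.
  - by move=> k; exact: (sZ' k).2.
  - move=> w; rewrite expr2; under eq_fun do rewrite expr2.
    have c : X' n w - X' (u (k + n)%N) w @[k --> \oo] --> X' n w - Y w.
      by apply: cvgB; [exact: cvg_cst|rewrite (cvg_shiftn n (fun k => X' (u k) w))].
    exact: cvgM.
  - move=> k; have /lerXn2r := Xe _ (leq_trans (leq_addl k n) (uk _)).
    move=> /(_ 2%N); rewrite !nnegrE nrm2_ge0 (ltW e_gt0) => /(_ isT isT).
    rewrite nrm2_sqr; apply: le_trans.
    rewrite /ip; apply: le_Rintegral => //; first exact: (sZ' k).2.
      exact: (sq_int_mul (sZ k) (sZ k)).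
    move=> w _; rewrite -expr2 /X' -mulrBl exprMn ler_piMr ?sqr_ge0//.
  - split.
      by split=> //; apply: measurable_funB => //; exact: (sX' n).1.
    rewrite -ler_sqr ?nnegrE ?nrm2_ge0 ?(ltW e_gt0)// nrm2_sqr.
    by move: h; rewrite /ip; under eq_Rintegral do rewrite expr2.
have [n0 n0P] := cX 1 ltr01.
have sY : sq_int P Y.
  have [|h _] := key 1 n0 ltr01; first by move=> k nk; exact/ltW/n0P.
  have := sq_intB (sX' n0) h; congr (sq_int P _); apply/funext => w; ring.
exists Y; split=> //; apply/norm_cvg0P/cvgrPdist_le => /= e egt0.
have [n1 n1P] := cX e egt0; exists n1 => // n /= n1n.
rewrite sub0r normrN normr_id ger0_norm ?nrm2_ge0//.
have [|_ h] := key e n egt0; first by move=> k nk; apply/ltW/n1P => //; exact: leq_trans nk.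
apply: (le_trans (nrm2_dist (sX n) (sX' n) sY)); rewrite XX' add0r; exact: h.
Qed.

End riesz_fischer.

(** * Gaussian characteristic functions *)

Section trigonometric_bounds.
Context (R : realType).
Implicit Types u v x : R.

Lemma norm_sin_le u : `|sin u| <= `|u|.
Proof.
suff pos x : 0 <= x -> `|sin x| <= x.
  have [u0|u0] := leP 0 u; first by rewrite (ger0_norm u0) pos.
  by rewrite -normrN -sinN (ltr0_norm u0) pos// oppr_ge0 ltW.
rewrite le_eqVlt => /predU1P[<-|x0]; first by rewrite sin0 normr0.
have [c _] := @MVT R sin cos 0 x x0 (fun z _ => is_derive_sin z)
  (continuous_subspaceT (@continuous_sin R)).
rewrite sin0 !subr0 => ->; rewrite normrM (gtr0_norm x0) ler_piMl ?(ltW x0)//.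
exact: cos_max.
Qed.

Lemma one_sub_cosE u : 1 - cos u = 2 * sin (u / 2) ^+ 2.
Proof.
rewrite {1}[u](_ : u = (u / 2) *+ 2); last by field.
by rewrite cos_mulr2n cos2sin2; ring.
Qed.

Lemma one_sub_cos_le u : 1 - cos u <= u ^+ 2 / 2.
Proof.
rewrite one_sub_cosE; have := norm_sin_le (u / 2).
rewrite -ler_sqr ?nnegrE// !real_normK ?num_real// exprMn; lra.
Qed.

Lemma norm_cosB_le u v : `|cos u - cos v| <= `|u - v|.
Proof.
have -> : cos u - cos v = - (2 * sin ((u + v) / 2) * sin ((u - v) / 2)).
  have key a b : cos (a + b) - cos (a - b) = - (2 * sin a * sin b) :> R.
    by rewrite cosB cosD; ring.
  by rewrite -key; congr (_ - _); congr cos; field.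
rewrite normrN !normrM ger0_norm//.
have e : `|(u - v) / 2| = `|u - v| / 2 by rewrite normrM normfV (ger0_norm (ler0n R 2)).
have := norm_sin_le ((u - v) / 2); rewrite e.
have := sin_max ((u + v) / 2) => h1 h2.
have := ler_pM (normr_ge0 _) (normr_ge0 _) h1 h2; lra.
Qed.

Lemma norm_sinB_id_le u : `|sin u - u| <= `|u| ^+ 3 / 2.
Proof.
suff pos x : 0 <= x -> `|sin x - x| <= x ^+ 3 / 2.
  have [u0|u0] := leP 0 u; first by rewrite (ger0_norm u0) pos.
  rewrite -normrN opprD -sinN (ltr0_norm u0) pos// oppr_ge0 ltW//.
rewrite le_eqVlt => /predU1P[<-|x0].
  by rewrite sin0 subrr normr0 expr0n mul0r.
have d z : z \in `]0, x[ -> is_derive z 1 (fun y : R => sin y - y) (cos z - 1).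
  by move=> _; apply: is_derive_eq.
have [|c cx] := @MVT R (fun y : R => sin y - y) (fun y => cos y - 1) 0 x x0 d.
  apply: continuous_subspaceT => y; apply: cvgB; last exact: cvg_id.
  exact: continuous_sin.
rewrite sin0 !subr0 => ->; rewrite normrM (gtr0_norm x0).
move: cx; rewrite in_itv/= => /andP[c0 cx].
have c1 := cos_le1 c.
rewrite ler0_norm ?subr_le0// opprB exprSr mulrAC ler_wpM2r ?(ltW x0)//.
apply: (le_trans (one_sub_cos_le c)); rewrite ler_wpM2r//.
by rewrite lerXn2r ?nnegrE ?ltW.
Qed.

(** The second difference quotient at 0 of [t -> - cos (t x)] with step [1 / (n + 1)]: bounded in
    [x] for fixed [n], below [x ^+ 2], and convergent to it. *)
Definition cos_quot n x : R := 2 * n.+1%:R ^+ 2 * (1 - cos (x / n.+1%:R)).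

Lemma cos_quot_ge0 n x : 0 <= cos_quot n x.
Proof. by rewrite mulr_ge0 ?mulr_ge0 ?exprn_ge0// subr_ge0 cos_le1. Qed.

Lemma cos_quot_le n x : cos_quot n x <= x ^+ 2.
Proof.
have n0 : n.+1%:R != 0 :> R by rewrite pnatr_eq0.
have -> : x ^+ 2 = 2 * n.+1%:R ^+ 2 * ((x / n.+1%:R) ^+ 2 / 2) by field; rewrite addrC natr1.
by rewrite ler_wpM2l ?mulr_ge0 ?exprn_ge0// one_sub_cos_le.
Qed.

Lemma cvg_cos_quot x : cos_quot n x @[n --> \oo] --> x ^+ 2.
Proof.
have -> : cos_quot ^~ x = (fun n => (2 * n.+1%:R * sin (x / n.+1%:R / 2)) ^+ 2).
  by apply/funext => n; rewrite /cos_quot one_sub_cosE; ring.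
suff h : 2 * n.+1%:R * sin (x / n.+1%:R / 2) @[n --> \oo] --> x.
  by under eq_fun do rewrite expr2; rewrite expr2; exact: cvgM.
apply/subr_cvg0/norm_cvg0P.
apply: (@squeeze_cvgr _ _ _ _ (cst 0) (fun n => `|x| ^+ 3 / 8 * harmonic n)).
- apply: nearW => n; rewrite normr_ge0/= /harmonic.
  have n0 : n.+1%:R != 0 :> R by rewrite pnatr_eq0.
  have n1 : 1 <= n.+1%:R :> R by rewrite ler1n.
  set y := x / n.+1%:R / 2.
  have -> : 2 * n.+1%:R * sin y - x = 2 * n.+1%:R * (sin y - y).
    by rewrite mulrBr; congr (_ - _); rewrite /y; field; rewrite addrC natr1.
  rewrite normrM ger0_norm ?mulr_ge0//.
  apply: (@le_trans _ _ (2 * n.+1%:R * (`|y| ^+ 3 / 2))).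
    by rewrite ler_wpM2l ?mulr_ge0// norm_sinB_id_le.
  rewrite /y !normrM !normfV (ger0_norm (ler0n R 2)) (ger0_norm (ler0n R n.+1)).
  have -> : 2 * n.+1%:R * ((`|x| / n.+1%:R / 2) ^+ 3 / 2) =
      `|x| ^+ 3 / 8 * (n.+1%:R^-1 * n.+1%:R^-1) by field; rewrite addrC natr1.
  rewrite ler_wpM2l ?divr_ge0 ?exprn_ge0// ler_piMr ?invr_ge0// invf_le1//.
- exact: cvg_cst.
- by rewrite -[X in _ --> X](mulr0 (`|x| ^+ 3 / 8)); apply: cvgMr; exact: cvg_harmonic.
Qed.

(** The same quotient for the characteristic function [expR (- (v * t ^+ 2 / 2))]; it is the mean of
    [cos_quot n] for a Gaussian of variance [v]. *)
Definition expR_quot n v : R := 2 * n.+1%:R ^+ 2 * (1 - expR (- (v * n.+1%:R^-1 ^+ 2 / 2))).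

Lemma expR_quot_le n v : expR_quot n v <= v.
Proof.
have n0 : n.+1%:R != 0 :> R by rewrite pnatr_eq0.
rewrite [leRHS](_ : v = 2 * n.+1%:R ^+ 2 * (v * n.+1%:R^-1 ^+ 2 / 2)); last first.
  by field; rewrite addrC natr1.
rewrite ler_wpM2l ?mulr_ge0 ?exprn_ge0//.
move: (_ / 2) => y; have := expR_ge1Dx (- y); move: (expR _) => z; lra.
Qed.

Lemma cvg_expR_quot v : 0 <= v -> expR_quot n v @[n --> \oo] --> v.
Proof.
move=> v0.
apply: (@squeeze_cvgr _ _ _ _ (fun n => v - v ^+ 2 * harmonic n) (cst v)).
- apply: nearW => n; rewrite expR_quot_le andbT /harmonic /expR_quot.
  have n0 : n.+1%:R != 0 :> R by rewrite pnatr_eq0.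
  have n1 : 1 <= n.+1%:R :> R by rewrite ler1n.
  set y := v * n.+1%:R^-1 ^+ 2 / 2.
  have y0 : 0 <= y by rewrite /y !mulr_ge0 ?invr_ge0 ?exprn_ge0.
  have vE : v = 2 * n.+1%:R ^+ 2 * y by rewrite /y; field; rewrite addrC natr1.
  have h : y - y ^+ 2 <= 1 - expR (- y).
    have := expR_ge1Dx y; have := expR_gt0 y; rewrite expRN; move: (expR y) => z z0 zy.
    have : z^-1 <= (1 + y)^-1 by rewrite lef_pV2 ?posrE//; lra.
    have : (1 + y)^-1 = 1 - y + y ^+ 2 / (1 + y) by field; lra.
    have : y ^+ 2 / (1 + y) <= y ^+ 2.
      by rewrite ler_piMr ?sqr_ge0// invf_le1; lra.
    by lra.
  apply: (@le_trans _ _ (2 * n.+1%:R ^+ 2 * (y - y ^+ 2))); last first.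
    by rewrite ler_wpM2l ?mulr_ge0 ?exprn_ge0.
  rewrite mulrBr -vE lerD2l lerN2.
  have -> : 2 * n.+1%:R ^+ 2 * y ^+ 2 = v ^+ 2 * (n.+1%:R^-1 ^+ 2 / 2).
    by rewrite /y; field; rewrite addrC natr1.
  rewrite ler_wpM2l ?sqr_ge0// expr2 -mulrA ler_piMr ?invr_ge0//.
  by rewrite mulr_ile1 ?invr_ge0 ?invf_le1// ?ltr0n// ler1n.
- rewrite -[X in _ --> X]subr0 -(mulr0 (v ^+ 2)); apply: cvgB; first exact: cvg_cst.
  by apply: cvgMr; exact: cvg_harmonic.
- exact: cvg_cst.
Qed.

End trigonometric_bounds.

(** * [nrm2] and the L2 norm *)

Section Lnorm2.
Context d (T : measurableType d) (R : realType) (P : probability T R).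
Implicit Types X Y : T -> R.

Lemma Lnorm2E X : sq_int P X -> ('N[P]_2%:E[EFin \o X] = (nrm2 P X)%:E)%E.
Proof.
move=> sX; rewrite unlock /Lnorm.
have -> : (\int[P]_x `|(EFin \o X) x| `^ 2 = (ip P X X)%:E)%E.
  rewrite /ip /Rintegral fineK; last exact: integrable_fin_num (sq_int_mul sX sX).
  apply: eq_integral => w _; rewrite [(EFin \o X) w]/= abse_EFin poweR_EFin powR_mulrn//.
  by rewrite real_normK ?num_real// expr2.
by rewrite poweR_EFin powR12_sqrt// ip_ge0.
Qed.

Lemma Lfun2P X : X \in Lfun P 2%:E <-> sq_int P X.
Proof.
split=> [LX|sX].
  split; last exact: Lfun2_integrable_sqr LX.
  by move: LX; rewrite inE => /andP[]; rewrite inE.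
rewrite inE; apply/andP; split; rewrite inE/=; first exact: sX.1.
by rewrite /finite_norm Lnorm2E// ltry.
Qed.

Lemma cvgL2P (X : nat -> T -> R) Y : (forall n, sq_int P (X n)) -> sq_int P Y ->
  ('N[P]_2%:E[EFin \o (fun w => X n w - Y w)%R] @[n --> \oo] --> 0%:E)%E <->
  cvgL2 P X Y.
Proof.
move=> sX sY; rewrite /cvgL2.
under eq_fun => n do rewrite (Lnorm2E (sq_intB (sX n) sY)).
split; first exact: fine_cvg.
by move=> h; apply/fine_cvgP; split; [exact: nearW|].
Qed.

End Lnorm2.

(** * Variables with a Gaussian characteristic function *)

Section characteristic_function.
Context d (T : measurableType d) (R : realType) (P : probability T R).
Implicit Types X Y : T -> R.
Local Notation E f := (\int[P]_w f w).

(** Here [v] is the variance, with [v = 0] for the degenerate case; the phase [p] encodes real and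
    imaginary part of the characteristic function together. This form passes to L2 limits with no
    case distinction. *)
Definition gauss_char X (v : R) := measurable_fun setT X /\
  forall t p, E (fun w => cos (t * X w + p)) = cos p * expR (- (v * t ^+ 2 / 2)).

Lemma bm_functional_law X : measurable_fun setT X ->
  bm_functional (fun f : R -> R => E (fun w => f (X w))).
Proof.
move=> mX; have := bm_functional_Rintegral (R := R) mX
  (bdd_meas_integrable P (bdd_meas_cst T (1 : R))).
by congr bm_functional; apply/funext => f; apply: eq_Rintegral => w _ /=; rewrite mulr1.
Qed.

Lemma bm_functional_normal s :
  bm_functional (fun f : R -> R => \int[lebesgue_measure]_x (f x * normal_pdf 0 s x)).
Proof.
have := @bm_functional_Rintegral _ _ R lebesgue_measure _ R (id : R -> R) (normal_pdf 0 s).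
by apply; [exact: measurable_id|exact: integrable_normal_pdf].
Qed.

Lemma law_indic X A : measurable_fun setT X -> measurable A ->
  E (fun w => \1_A (X w)) = fine (P (X @^-1` A)).
Proof.
move=> mX mA; rewrite -Rintegral_indic; first exact: eq_Rintegral.
by rewrite -[X in measurable X]setTI; exact: mX.
Qed.

Lemma normal_indic s (A : set R) : measurable A ->
  \int[lebesgue_measure]_x (\1_A x * normal_pdf 0 s x) = fine (normal_prob 0 s A).
Proof.
move=> mA; rewrite /normal_prob /Rintegral [in RHS]integral_mkcond.
congr fine; apply: eq_integral => x _; rewrite patchE indicE.
by case: (x \in A); rewrite ?mul1r ?mul0r.
Qed.

(** The law is given on sets: the functional [E f(X)] minus the integral of [f] against the law
    vanishes on indicators, hence on cosines. In the degenerate case that second integral is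
    [f 0]. *)
Lemma centered_normal_char X : centered_normal P X -> exists2 v, 0 <= v & gauss_char X v.
Proof.
move=> [[s s0 [mX lX]]|[mX lX]].
  exists (s ^+ 2); first exact: sqr_ge0.
  split=> // t p; rewrite -(Rintegral_cos_normal_pdf s0).
  apply/eqP; rewrite -subr_eq0; apply/eqP.
  have bn := bm_functional_lin 1 (bm_functional_law mX) (bm_functional_normal s).
  have := bm_functional_eq0 bn _ (bdd_meas_cos p _ (f := fun x => t * x)).
  rewrite mul1r; apply.
  - by move=> A mA; rewrite mul1r law_indic// normal_indic// lX// subrr.
  - exact: measurable_funM.
exists 0 => //; split=> // t p; rewrite mul0r mul0r oppr0 expR0 mulr1.
apply/eqP; rewrite -subr_eq0; apply/eqP.
have bd : bm_functional (fun f : R -> R => f 0).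
  by split => // F f M _ _; exact.
have bn := bm_functional_lin 1 (bm_functional_law mX) bd.
have := bm_functional_eq0 bn _ (bdd_meas_cos p _ (f := fun x => t * x)).
rewrite mul1r mulr0 add0r; apply.
- by move=> A mA; rewrite mul1r law_indic// lX// diracE indicE subrr.
- exact: measurable_funM.
Qed.

Definition scalar_set : set (R -> R) := [set l | exists t : R, l = fun x => t * x].

Lemma measurable_scalar_halfspaces (A : set R) :
  measurable A -> <<s halfspaces scalar_set >> A.
Proof.
rewrite [X in X A -> _]RGenCInfty.measurableE; apply: smallest_sub.
  exact: smallest_sigma_algebra.
move=> _ [r ->]; apply: sub_sigma_algebra; exists (fun x => -1 * x), (- r).
split; first by exists (-1).
by apply/seteqP; split=> x /=; rewrite in_itv/= andbT mulN1r lerN2.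
Qed.

(** Both laws have the same cosine integrals, and the half-spaces [t x <= r] generate the Borel sets
    of the line. *)
Lemma gauss_char_law X : gauss_char X 1 -> has_law P X (normal_prob 0 1).
Proof.
move=> [mX cX]; split => // A mA.
have bn := bm_functional_lin 1 (bm_functional_law mX) (bm_functional_normal 1).
have := @bm_functional_indic0 _ R R _ scalar_set bn.
move=> /(_ _ _ _ _ A) h.
have : fine (P (X @^-1` A)) = fine (normal_prob 0 1 A).
  apply/eqP; rewrite -subr_eq0 -law_indic// -normal_indic// -[X in _ - X]mul1r; apply/eqP.
  apply: h.
  - by move=> _ [t ->]; exact: measurable_funM.
  - by move=> a _ _ [t ->] [u ->]; exists (a * t + u); apply/funext => x; ring.
  - by exists 0; apply/funext => x; rewrite mul0r.
  - move=> _ p [t ->]; rewrite mul1r cX (Rintegral_cos_normal_pdf ltr01).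
    by rewrite expr1n !mul1r subrr.
  - exact: measurable_scalar_halfspaces.
move=> e; rewrite -[LHS]fineK; last first.
  by apply: fin_num_measure; rewrite -[X in measurable X]setTI; exact: mX.
by rewrite e fineK//; exact: fin_num_measure.
Qed.

(** Square integrability is not assumed: the means [expR_quot n v <= v] of [cos_quot] give it by
    Fatou's lemma. Only then can [X w ^+ 2] dominate, which turns the bound on the second moment
    into an equality. *)
Lemma gauss_char_sq_int X v : 0 <= v -> gauss_char X v -> sq_int P X /\ ip P X X = v.
Proof.
move=> v0 [mX cX].
have mF n : measurable_fun setT (fun w => cos_quot n (X w)).
  apply: measurable_funM => //; apply: measurable_funB => //.
  have mXn : measurable_fun setT (fun w => X w / n.+1%:R) by exact: measurable_funM.
  exact: (measurableT_comp (continuous_measurable_fun (@continuous_cos R)) mXn).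
have bF n : bdd_meas (fun w => cos_quot n (X w)).
  split=> //; exists (2 * n.+1%:R ^+ 2 * 2) => w.
  rewrite ger0_norm ?cos_quot_ge0// ler_wpM2l ?mulr_ge0 ?exprn_ge0//.
  by have := cos_geN1 (X w / n.+1%:R); lra.
have EF n : E (fun w => cos_quot n (X w)) = expR_quot n v.
  have bc : bdd_meas (fun w => cos (X w / n.+1%:R)).
    have := bdd_meas_cos 0 (measurable_funM mX (measurable_cst (n.+1%:R^-1 : R))).
    by under eq_fun do rewrite addr0.
  rewrite /cos_quot RintegralZl//; last first.
    exact: integrableB_EFin (bdd_meas_integrable P (bdd_meas_cst T (1 : R)))
       (bdd_meas_integrable P bc).
  congr (_ * _); rewrite RintegralB//; last 2 first.
    exact: (bdd_meas_integrable P (bdd_meas_cst T (1 : R))).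
    exact: (bdd_meas_integrable P bc).
  rewrite Rintegral_cst1; congr (_ - _).
  have := cX n.+1%:R^-1 0; rewrite cos0 mul1r => <-.
  by apply: eq_Rintegral => w _; rewrite addr0 mulrC.
have [||||i2 E2] := @Rintegral_fatou _ _ _ P (fun n w => cos_quot n (X w)) (fun w => X w ^+ 2) v mF.
- by move=> n w; exact: cos_quot_ge0.
- by move=> n; exact: bdd_meas_integrable.
- by move=> w; exact: cvg_cos_quot.
- by move=> n; rewrite EF expR_quot_le.
split=> //; rewrite /ip; under eq_Rintegral do rewrite -expr2.
have h : E (fun w => cos_quot n (X w)) @[n --> \oo] --> E (fun w => X w ^+ 2).
  apply: (cvg_Rintegral_dominated mF i2).
  - by move=> n w; rewrite ger0_norm ?cos_quot_ge0// cos_quot_le.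
  - by move=> w; exact: cvg_cos_quot.
move: h; under eq_fun do rewrite EF.
by move=> /(cvg_unique (@Rhausdorff R) (cvg_expR_quot v0)).
Qed.

Lemma cvgL2_cos (X : nat -> T -> R) Y (p : R) :
  (forall n, sq_int P (X n)) -> sq_int P Y -> cvgL2 P X Y ->
  E (fun w => cos (X n w + p)) @[n --> \oo] --> E (fun w => cos (Y w + p)).
Proof.
move=> sX sY XY; apply/subr_cvg0/norm_cvg0P.
apply: (@squeeze_cvgr _ _ _ _ (cst 0) (fun n => nrm2 P (fun w => X n w - Y w))) => //.
  apply: nearW => n; rewrite normr_ge0/=.
  have i1 := bdd_meas_integrable P (bdd_meas_cos p (sX n).1).
  have i2 := bdd_meas_integrable P (bdd_meas_cos p sY.1).
  rewrite -RintegralB//; apply: le_trans (Rintegral_norm_le_nrm2 (sq_intB (sX n) sY)).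
  apply: (le_trans (le_normr_Rintegral _ _)) => //; first exact: integrableB_EFin.
  apply: le_Rintegral => //.
  - exact: integrable_norm (integrableB_EFin i1 i2).
  - exact: integrable_norm (sq_int_integrable (sq_intB (sX n) sY)).
  - move=> w _; apply: (le_trans (norm_cosB_le _ _)).
    by rewrite opprD addrACA subrr addr0.
exact: cvg_cst.
Qed.

(** The cosine is 1-Lipschitz, so the left-hand sides converge; the right-hand sides do since the
    variances are squared norms. *)
Lemma gauss_char_cvgL2 (X : nat -> T -> R) Y (v : nat -> R) :
  (forall n, 0 <= v n) -> (forall n, gauss_char (X n) (v n)) -> sq_int P Y ->
  cvgL2 P X Y -> gauss_char Y (ip P Y Y).
Proof.
move=> v0 cX sY XY.
have sX n := (gauss_char_sq_int (v0 n) (cX n)).1.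
have vE n : v n = ip P (X n) (X n) := esym (gauss_char_sq_int (v0 n) (cX n)).2.
have cv : v n @[n --> \oo] --> ip P Y Y.
  by under eq_fun do rewrite vE; exact: cvgL2_ip.
split; first exact: sY.1.
move=> t p.
have tXY : cvgL2 P (fun n w => t * X n w) (fun w => t * Y w).
  have := cvgL2_lin t 0 sX sY sX sY XY XY.
  have -> : (fun n w => t * X n w + 0 * X n w) = (fun n w => t * X n w).
    by apply/funext => n; apply/funext => w; rewrite mul0r addr0.
  have -> : (fun w => t * Y w + 0 * Y w) = (fun w => t * Y w).
    by apply/funext => w; rewrite mul0r addr0.
  by [].
have := @cvgL2_cos _ _ p (fun n => sq_intZ t (sX n)) (sq_intZ t sY) tXY.
under eq_fun do rewrite (cX _).2.
move=> /(cvg_unique (@Rhausdorff R)); apply.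
apply: cvgMr; apply: continuous_cvg; first exact: continuous_expR.
by apply: cvgN; do 2 apply: cvgMl.
Qed.

End characteristic_function.

(** * Gaussian random elements and their RKHS *)

Lemma measurable_fun_le d (T : measurableType d) (R : realType) (f : T -> R) :
  (forall r, measurable [set t | f t <= r]) -> measurable_fun setT f.
Proof.
move=> mf; apply: (measurability _ (RGenOInfty.measurableE R)) => _ [_ [r ->] <-].
rewrite setTI (_ : _ @^-1` _ = ~` [set t | f t <= r]).
  exact: measurableC.
by apply/seteqP; split=> t /=; rewrite in_itv/= andbT ltNge => /negP.
Qed.

Section separable_space.
Context (R : realType) (B : completeNormedModType R).
Hypothesis sepB : separable B.

Lemma separable_dense_seq :
  exists x : nat -> B, forall y (e : R), 0 < e -> exists n, `|y - x n| < e.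
Proof.
have [D cD dD] := sepB.
have [x xsurj] := elimT pcard_surjP cD.
exists x => y e e0.
have [|z [yz Dz]] := dD (ball y e) _ (ball_open y e).
  by exists y; exact: ballxx.
have [n _ xn] := xsurj _ Dz; exists n; rewrite xn.
by move: yz; rewrite -ball_normE.
Qed.

Definition dense_seq : nat -> B := projT1 (cid separable_dense_seq).

Lemma dense_seqP y (e : R) : 0 < e -> exists n, `|y - dense_seq n| < e.
Proof. by rewrite /dense_seq; case: cid => x /= h; exact: h. Qed.

Definition norming_seq n : dual B := projT1 (cid (exists_norming (dense_seq n))).

Lemma norming_seq_le n y : `|norming_seq n y| <= `|y|.
Proof. by rewrite /norming_seq; case: cid => b /= [h _]. Qed.

(** The norming functional of a dense point close to [y] is nearly norming at [y]. Thus countably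
    many functionals determine the norm, which makes the events about norms below measurable. *)
Lemma norm_le_norming_seq y r : (forall n, norming_seq n y <= r) -> `|y| <= r.
Proof.
move=> h; apply/ler_addgt0Pr => e e0; have e2 : 0 < e / 2 by lra.
have [n yn] := dense_seqP y e2.
have bn : norming_seq n (dense_seq n) = `|dense_seq n|.
  by rewrite /norming_seq; case: cid => b /= [_].
have h1 := h n; have h2 := norming_seq_le n (dense_seq n - y).
have h3 := ler_normD (y - dense_seq n) (dense_seq n).
rewrite subrK in h3; rewrite distrC dualB bn in h2.
have := ler_norm (`|dense_seq n| - norming_seq n y); lra.
Qed.

(** Pettis' measurability theorem: a closed ball is a countable intersection of half-spaces, and an
    open set is the countable union of the closed balls with dense centres and radii [1 / (k + 1)]
    that it contains. *)
Lemma borel_measurableP d (T : measurableType d) (f : T -> B) :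
  (forall b : dual B, measurable_fun setT (b \o f)) -> borel_measurable f.
Proof.
move=> mf.
have mball x (r : R) : measurable (f @^-1` [set y | `|y - x| <= r]).
  rewrite (_ : _ @^-1` _ = \bigcap_n [set t | norming_seq n (f t) <= norming_seq n x + r]).
    apply: bigcapT_measurable => n.
    have := mf (norming_seq n) measurableT _ (measurable_itv `]-oo, norming_seq n x + r]).
    by rewrite setTI set_itvE.
  apply/seteqP; split=> t /= ft.
    move=> n _ /=; have := le_trans (ler_norm _) (norming_seq_le n (f t - x)).
    by rewrite dualB; lra.
  apply: norm_le_norming_seq => n; have := ft n I; rewrite dualB /=; lra.
rewrite /borel_measurable.
apply: (@measurability _ _ T (g_sigma_algebraType (@open B)) setT f (@open B) erefl) => _ [U oU <-].
rewrite setTI.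
pose Cl n (k : nat) := [set y : B | `|y - dense_seq n| <= k.+1%:R^-1].
rewrite (_ : _ @^-1` _ = \bigcup_n \bigcup_k
    (if `[< Cl n k `<=` U >] then f @^-1` Cl n k else set0)).
  apply: bigcupT_measurable => n; apply: bigcupT_measurable => k.
  by case: ifP => // _; exact: mball.
apply/seteqP; split=> t /=; last first.
  by move=> [n _ [k _]]; case: ifP => // /asboolP; exact.
move=> Uft; have /nbhs_ballP[e /= e0 eU] : nbhs (f t) U by exact: open_nbhs_nbhs.
have [k ke] : exists k, k.+1%:R^-1 < e / 2 :> R.
  have e2 : 0 < e / 2 by lra.
  by have [k _ h] := near_infty_natSinv_lt (PosNum e2); exists k; exact: (h k (leqnn k)).
have k0 : 0 < k.+1%:R^-1 :> R by rewrite invr_gt0 ltr0n.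
have [n fn] := dense_seqP (f t) k0.
exists n => //; exists k => //; rewrite asboolT; first exact: ltW.
move=> y; rewrite /Cl/= => yn; apply: eU; rewrite -ball_normE /=.
have := ler_normD (f t - dense_seq n) (dense_seq n - y).
rewrite addrA subrK (distrC (dense_seq n) y).
by move: yn fn ke; move: (k.+1%:R^-1) => z; lra.
Qed.

Lemma borel_measurable_dual d (T : measurableType d) (f : T -> B) (b : dual B) :
  borel_measurable f -> measurable_fun setT (fun t => b (f t)).
Proof.
move=> mf; apply: measurable_fun_le => r.
rewrite -[X in measurable X]setTI.
have -> : [set t | b (f t) <= r] = f @^-1` (~` [set y | r < b y]).
  by apply/seteqP; split=> t /=; rewrite leNgt => /negP.
apply: mf => //; apply: measurableC; apply: sub_sigma_algebra.
have -> : [set y | r < b y] = b @^-1` [set x | r < x].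
  by [].
apply: open_comp; last exact: open_gt.
by move=> y _; exact: dual_continuous.
Qed.

Lemma measurable_dual (b : dual B) :
  measurable_fun setT (b : g_sigma_algebraType (@open B) -> R).
Proof.
apply: (@borel_measurable_dual _ (g_sigma_algebraType (@open B)) id b).
exact: (@measurable_id _ (g_sigma_algebraType (@open B))).
Qed.

Definition dual_set : set (B -> R) := [set l | exists b : dual B, l = dual_fun b].

(** Pettis' theorem applied to the identity of [B], the source carrying the sigma-algebra generated
    by half-spaces. *)
Lemma borel_halfspaces (E : set B) : <<s @open B >> E -> <<s halfspaces dual_set >> E.
Proof.
move=> bE.
have : borel_measurable (id : g_sigma_algebraType (halfspaces dual_set) -> B).
  apply: borel_measurableP => b; apply: measurable_fun_le => r.
  by apply: sub_sigma_algebra; exists b, r; split=> //; exists b.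
by move=> /(_ measurableT E bE); rewrite setTI.
Qed.

End separable_space.

Lemma cauchy_seq_cvg (R : realType) (B : completeNormedModType R) (y : nat -> B) :
  (forall e : R, 0 < e -> exists N, forall m n, (N <= m)%N -> (N <= n)%N ->
     `|y m - y n| < e) -> exists l : B, y n @[n --> \oo] --> l.
Proof.
move=> cy; suff : cvgn y by move=> /cvg_ex.
apply/cauchy_cvgP/cauchy_exP => e e0; have [N NP] := cy e e0.
exists (y N); exists N => // n /= Nn; rewrite -ball_normE /=; exact: NP.
Qed.

(** * Tightness, variances and Pettis integrals *)

Section gaussian_element.
Context (R : realType) (B : completeNormedModType R) (sepB : separable B)
  (d : measure_display) (Omega : measurableType d) (P : probability Omega R)
  (W : Omega -> B) (gaussW : centered_gaussian P W).
Implicit Types (b : dual B) (X Y : Omega -> R).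

Local Notation E f := (\int[P]_w f w).
Local Notation W_ b := (fun w => dual_fun b (W w)).

Let mW : borel_measurable W := gaussW.1.

Lemma measurable_W_le x (r : R) : measurable [set w | `|W w - x| <= r].
Proof.
have -> : [set w | `|W w - x| <= r] = \bigcap_n
    [set w | norming_seq sepB n (W w) <= norming_seq sepB n x + r].
  apply/seteqP; split=> w /=.
    move=> h n _ /=; have := le_trans (ler_norm _) (norming_seq_le sepB n (W w - x)).
    by rewrite dualB; lra.
  move=> h; apply: norm_le_norming_seq => n; have := h n I; rewrite dualB /=; lra.
apply: bigcapT_measurable => n.
have := borel_measurable_dual (norming_seq sepB n) mW measurableT
  (measurable_itv `]-oo, norming_seq sepB n x + r]).
by rewrite setTI set_itvE.
Qed.

Lemma dual_gauss_char b : exists2 v, 0 <= v & gauss_char P (W_ b) v.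
Proof. exact: centered_normal_char (gaussW.2 b). Qed.

Lemma sq_int_dual b : sq_int P (W_ b).
Proof. by have [v v0 /(gauss_char_sq_int v0) []] := dual_gauss_char b. Qed.

Lemma gauss_char_dual b : gauss_char P (W_ b) (ip P (W_ b) (W_ b)).
Proof.
have [v v0 cv] := dual_gauss_char b.
by have [_ ->] := gauss_char_sq_int v0 cv.
Qed.

Lemma dual_covE b1 b2 : dual_cov P W b1 b2 = ip P (W_ b1) (W_ b2).
Proof. by rewrite /dual_cov unlock. Qed.

Lemma norm_W_tight (p : R) : p < 1 -> exists2 M : R, 0 < M &
  p < E (fun w => \1_[set w | `|W w - 0| <= M] w).
Proof.
move=> p1.
have : E (fun w => \1_[set w | `|W w - 0| <= n.+1%:R] w) @[n --> \oo] --> E (fun w => (1 : R)).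
  apply: (@cvg_Rintegral_dominated _ _ _ P 
    (fun n w => \1_[set w | `|W w - 0| <= n.+1%:R] w) _ (cst 1)).
  - by move=> n; exact/measurable_indic/measurable_W_le.
  - exact: bdd_meas_integrable (bdd_meas_cst _ _).
  - by move=> n w; rewrite indicE normr_nat lern1 leq_b1.
  - move=> w; apply: cvg_near_cst; near=> n.
    rewrite indicE mem_set//= -natr1 ler_wpDr//.
    by near: n; exact: nbhs_infty_ger.
rewrite Rintegral_cst1 => /cvgr_gt /(_ _ p1) [n _ h].
by exists n.+1%:R => //; exact: (h n (leqnn n)).
Unshelve. all: by end_near. Qed.

(* On [|W| <= M] one has [cos (b(W) / (k M)) >= 1/2], so the characteristic
   function of [b(W)] at [1 / (k M)] is bounded away from 0. *)
Lemma dual_variance_bound : exists2 C : R, 0 < C & forall b (k : R), 0 < k ->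
  (forall x, `|b x| <= k * `|x|) -> ip P (W_ b) (W_ b) <= C * k ^+ 2.
Proof.
(* The cosine is at least [3 / 2 * \1_A - 1], so [P A > 5 / 6] bounds the characteristic function
   below by [1 / 4]. Then [1 + x <= expR x <= 4] for [x = v * t ^+ 2 / 2] yields
   [v <= 6 * (k * M) ^+ 2]. *)
have [|M M0 PM] := @norm_W_tight (5 / 6); first lra.
exists (6 * M ^+ 2); first by rewrite mulr_gt0// exprn_gt0.
move=> b k k0 bk; set v := ip P _ _; pose t := (k * M)^-1.
have kM0 : 0 < k * M by rewrite mulr_gt0.
have [_ /(_ t 0)] := gauss_char_dual b; rewrite cos0 mul1r -/v => cE.
set A := [set w | `|W w - 0| <= M] in PM.
have mA : measurable A by exact: measurable_W_le.
have mtW : measurable_fun setT (fun w => t * b (W w)).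
  by apply: measurable_funM => //; exact: (sq_int_dual b).1.
have le_cos : E (fun w => 3 / 2 * \1_A w + -1) <= E (fun w => cos (t * b (W w) + 0)).
  apply: le_Rintegral => //.
  - exact: bdd_meas_integrable (bdd_meas_lin _ (bdd_meas_indic _ mA) (bdd_meas_cst _ _)).
  - exact: bdd_meas_integrable (bdd_meas_cos 0 mtW).
  - move=> w _; rewrite addr0 indicE; have [|_] := boolP (w \in A); last first.
      by have := cos_geN1 (t * b (W w)); rewrite mulr0 add0r.
    rewrite inE /A/= subr0 => WM.
    have : `|t * b (W w)| <= 1.
      rewrite normrM /t normfV (gtr0_norm kM0) mulrC ler_pdivrMr// mul1r.
      by rewrite (le_trans (bk _))// ler_wpM2l// ltW.
    rewrite -ler_sqr ?nnegrE// real_normK ?num_real// expr1n => tb.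
    have := one_sub_cos_le (t * b (W w)); rewrite mulr1; lra.
have EA : E (fun w => 3 / 2 * \1_A w + -1) = 3 / 2 * E (fun w => \1_A w) - 1.
  have iA := bdd_meas_integrable P (bdd_meas_indic R mA).
  rewrite RintegralD//; last 2 first.
    exact: integrableZ_EFin.
    exact: bdd_meas_integrable (bdd_meas_cst _ _).
  by rewrite RintegralZl// Rintegral_cst1.
rewrite cE EA in le_cos.
have e4 : 4^-1 <= expR (- (v * t ^+ 2 / 2)) by lra.
have : v * t ^+ 2 / 2 <= 3.
  rewrite expRN lef_pV2 ?posrE ?expR_gt0// in e4.
  by have := expR_ge1Dx (v * t ^+ 2 / 2); lra.
rewrite /t exprVn ler_pdivrMr// ler_pdivrMr ?exprn_gt0// exprMn; lra.
Qed.

(** [W] is replaced by the discretization [Wn] on disjoint cells around finitely many dense points,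
    and [y] is the finite sum [E (Wn b(W))]. The point is that the error is uniform over functionals
    of norm at most 1: this is what makes the approximations Cauchy in [B]. *)
Let pettis_approx b (e : R) : 0 < e -> exists y, forall b2,
  (forall x, `|b2 x| <= `|x|) -> `|b2 y - ip P (W_ b2) (W_ b)| <= e.
Proof.
move=> e0; have [C C0 Cb] := dual_variance_bound.
pose V := nrm2 P (W_ b); have V0 : 0 <= V by exact: nrm2_ge0.
(* [E |b(W)| <= V], so the cells contribute at most [e / 2]; the summand 1 guards against
   [V = 0]. *)
pose eta := e / (2 * (V + 1)).
have eta0 : 0 < eta by rewrite divr_gt0//; lra.
pose x := dense_seq sepB.
pose F i := [set w | `|W w - x i| <= eta].
pose A := seqDU F.
have mF i : measurable (F i) by exact: measurable_W_le.
have mA i : measurable (A i).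
  by apply: measurableD => //; exact: bigsetU_measurable.
have tA : trivIset setT A := trivIset_seqDU F.
pose Wn n w : B := \sum_(i < n) (\1_(A i) w : R) *: x i.
pose out n := ~` (\bigcup_(i < n) A i).
have mout n : measurable (out n) by apply: measurableC; exact: bigcup_measurable.
pose y n : B := \sum_(i < n) E (fun w => \1_(A i) w * b (W w)) *: x i.
have yE b2 n : sq_int P (fun w => b2 (Wn n w)) /\
    ip P (fun w => b2 (Wn n w)) (W_ b) = b2 (y n).
  elim: n => [|n [sn IH]].
    rewrite /Wn /y big_ord0 dual0.
    have -> : (fun w => b2 (\sum_(i < 0) (\1_(A i) w : R) *: x i)) = cst 0.
      by apply/funext => w; rewrite big_ord0 dual0.
    split; first exact: sq_int_cst.
    rewrite /ip -[RHS](Rintegral_cst1 P); apply: eq_Rintegral => w _ /=.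
    exact: mul0r.
  have -> : (fun w => b2 (Wn n.+1 w)) = fun w => b2 (x n) * \1_(A n) w + b2 (Wn n w).
    by apply/funext => w; rewrite /Wn big_ord_recr/= dualD dualZ addrC mulrC.
  have sA := sq_int_bdd P (bdd_meas_indic R (mA n)).
  split; first exact: sq_int_lin.
  rewrite ipDl//; last exact: sq_int_dual.
  by rewrite IH /y big_ord_recr/= dualD dualZ addrC mulrC.
have UA : \bigcup_i A i = setT.
  rewrite /A -seqDU_bigcup_eq; apply/seteqP; split=> // w _.
  by have [n h] := dense_seqP sepB (W w) eta0; exists n => //; exact: ltW.
have close b2 n w : (forall x, `|b2 x| <= `|x|) ->
    `|b2 (Wn n w) - b2 (W w)| <= eta + `|b2 (W w)| * \1_(out n) w.
  move=> b2n; have [[i /= ni Aiw]|nA] := pselect ((\bigcup_(i < n) A i) w).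
    have -> : Wn n w = x i.
      rewrite /Wn (bigD1 (Ordinal ni))//= indicE mem_set// scale1r big1 ?addr0// => j ji.
      rewrite indicE memNset ?scale0r// => Ajw; move/eqP: ji; apply; apply/val_inj => /=.
      by apply: (tA j i I I); exists w.
    rewrite indicE memNset ?mulr0 ?addr0; last by apply; exists i.
    rewrite -dualB (le_trans (b2n _))// distrC.
    by have := Aiw; rewrite /A /seqDU /setD => -[].
  have -> : Wn n w = 0.
    rewrite /Wn big1// => j _; rewrite indicE memNset ?scale0r// => Ajw.
    by apply: nA; exists (val j) => //=; exact: ltn_ord.
  by rewrite dual0 sub0r normrN indicE mem_set// mulr1 lerDr ltW.
have sout n : sq_int P (fun w => \1_(out n) w * b (W w)).
  apply: (sq_int_dominated _ (sq_int_dual b)) => [|w].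
    by apply: measurable_funM; [exact: measurable_indic|exact: (sq_int_dual b).1].
  by rewrite normrM ler_piMl// indicE normr_nat lern1 leq_b1.
have out0 : nrm2 P (fun w => \1_(out n) w * b (W w)) @[n --> \oo] --> 0.
  rewrite -(@sqrtr0 R); apply: continuous_cvg; first exact: sqrt_continuous.
  rewrite -[X in _ --> X](Rintegral_cst1 P 0).
  apply: (cvg_Rintegral_dominated _ (sq_int_dual b).2).
  - by move=> n; apply: measurable_funM; exact: (sout n).1.
  - move=> n w; rewrite -expr2 ger0_norm ?sqr_ge0// exprMn.
    by rewrite ler_piMl ?sqr_ge0// indicE; case: (w \in _); rewrite ?expr1n// expr0n.
  - move=> w; apply: cvg_near_cst.
    have [i _ Aiw] : (\bigcup_i A i) w by rewrite UA.
    exists i.+1 => // n /= ni; rewrite indicE memNset ?mul0r//.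
    by apply; exists i.
pose c := nrm2 P (fun w => b (W w)).
(* [C] bounds the variance of [b2 (W)] for every [b2] of norm at most 1, so [n] can be chosen before
   [b2]. *)
have [n nP] : exists n, Num.sqrt C * nrm2 P (fun w => \1_(out n) w * b (W w)) <= e / 2.
  have e2 : 0 < e / 2 by lra.
  have : Num.sqrt C * nrm2 P (fun w => \1_(out n) w * b (W w)) @[n --> \oo] --> 0.
    by rewrite -(mulr0 (Num.sqrt C)); apply: cvgMr.
  move=> /cvgr_le/(_ _ e2)[n _ h]; exists n; exact: (h n (leqnn n)).
exists (y n) => b2 b2n; have [sWn <-] := yE b2 n.
have sb := sq_int_dual b; have sb2 := sq_int_dual b2.
rewrite -ipBl//; have sD := sq_intB sWn sb2.
have sab : sq_int P (fun w => `|b (W w)|).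
  apply: (sq_int_dominated _ sb) => [|w]; last by rewrite normr_id.
  by apply: measurableT_comp => //; exact: sb.1.
have sab2 : sq_int P (fun w => `|b2 (W w)|).
  apply: (sq_int_dominated _ sb2) => [|w]; last by rewrite normr_id.
  by apply: measurableT_comp => //; exact: sb2.1.
have sao : sq_int P (fun w => `|\1_(out n) w * b (W w)|).
  apply: (sq_int_dominated _ (sout n)) => [|w]; last by rewrite normr_id.
  by apply: measurableT_comp => //; exact: (sout n).1.
have ia := sq_int_integrable sab; have io := sq_int_mul sab2 sao.
apply: (@le_trans _ _ (E (fun w => eta * `|b (W w)| +
    `|b2 (W w)| * `|\1_(out n) w * b (W w)|))).
  apply: (le_trans (le_normr_Rintegral _ _)) => //; first exact: sq_int_mul.
  apply: le_Rintegral => //.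
  - exact: integrable_norm (sq_int_mul sD sb).
  - exact: integrableD_EFin (integrableZ_EFin eta ia) io.
  - move=> w _; rewrite normrM (le_trans (ler_wpM2r _ (close b2 n w b2n)))//.
    have i0 : 0 <= \1_(out n) w :> R by rewrite indicE.
    by rewrite (normrM (\1_(out n) w)) (ger0_norm i0) mulrDl mulrA.
rewrite RintegralD//; last exact: integrableZ_EFin.
rewrite RintegralZl//.
have h1 : eta * E (fun w => `|b (W w)|) <= e / 2.
  apply: (@le_trans _ _ (eta * (V + 1))).
    by rewrite ler_wpM2l ?(ltW eta0)// (le_trans (Rintegral_norm_le_nrm2 sb))// lerDl.
  by rewrite /eta invfM mulrA divfK//; lra.
have h2 : E (fun w => `|b2 (W w)| * `|\1_(out n) w * b (W w)|) <= e / 2.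
  apply: le_trans nP; apply: (le_trans (le_trans (ler_norm _) (ip_le_nrm2 sab2 sao))).
  have nabs X : nrm2 P (fun w => `|X w|) = nrm2 P X.
    congr Num.sqrt; apply: eq_Rintegral => w _.
    by rewrite -normrM ger0_norm// -expr2 sqr_ge0.
  rewrite !nabs ler_wpM2r ?nrm2_ge0// ler_wsqrtr//.
  have := @Cb b2 1 ltr01; rewrite expr1n mulr1; apply=> z.
  by rewrite mul1r.
lra.
Qed.

Lemma pettis_exists b : exists y, forall b2, b2 y = ip P (W_ b2) (W_ b).
Proof.
pose y k := projT1 (cid (pettis_approx b (harmonic_gt0 k : 0 < harmonic k :> R))).
have yP k b2 : (forall x, `|b2 x| <= `|x|) ->
    `|b2 (y k) - ip P (W_ b2) (W_ b)| <= harmonic k.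
  by rewrite /y; case: cid => z /= h; exact: h.
have [l yl] : exists l : B, y n @[n --> \oo] --> l.
  apply: cauchy_seq_cvg => e e0; have e2 : 0 < e / 2 by lra.
  have /cvgr_lt/(_ _ e2)[N _ Nh] := @cvg_harmonic R.
  exists N => m n Nm Nn.
  apply: (@le_lt_trans _ _ (harmonic m + harmonic n)); last first.
    by rewrite [ltRHS](_ : e = e / 2 + e / 2); [exact: ltrD (Nh m Nm) (Nh n Nn)|field].
  apply: dual_norm_le => b2 b2n; rewrite dualB.
  have h1 := yP m b2 b2n; have h2 := yP n b2 b2n; rewrite distrC in h2.
  have := ler_normD (b2 (y m) - ip P (W_ b2) (W_ b)) (ip P (W_ b2) (W_ b) - b2 (y n)).
  by rewrite addrA subrK; lra.
exists l.
have unit b2 : (forall x, `|b2 x| <= `|x|) -> b2 l = ip P (W_ b2) (W_ b).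
  move=> b2n; have c1 : b2 (y n) @[n --> \oo] --> b2 l.
    by apply: continuous_cvg => //; exact: dual_continuous.
  apply: (cvg_unique (@Rhausdorff R) c1); apply/subr_cvg0/norm_cvg0P.
  apply: (@squeeze_cvgr _ _ _ _ (cst 0) (@harmonic R)).
  - by apply: nearW => n; rewrite normr_ge0/= yP.
  - exact: cvg_cst.
  - exact: cvg_harmonic.
(* A general functional is rescaled by a bound [k] of its norm. *)
move=> b2; have [k k0 b2k] := dual_bounded b2.
have := unit (dual_comb k^-1 0 b2 b2).
rewrite dual_combE mul0r addr0.
under [fun w => _]eq_fun do rewrite dual_combE mul0r addr0.
rewrite ipZl; [|exact: sq_int_dual..].
move=> h; apply: (mulfI (_ : k^-1 != 0)); first by rewrite invr_eq0 gt_eqF.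
apply: h => x; rewrite dual_combE mul0r addr0 normrM normfV (gtr0_norm k0).
by rewrite ler_pdivrMl.
Qed.

End gaussian_element.

(** * The RKHS as a space of L2 limits *)

Section rkhs_theory.
Context (R : realType) (B : completeNormedModType R) (sepB : separable B)
  (d : measure_display) (Omega : measurableType d) (P : probability Omega R)
  (W : Omega -> B) (gaussW : centered_gaussian P W).
Implicit Types (b : dual B) (X Y : Omega -> R) (h g : B).

Local Notation W_ b := (fun w => dual_fun b (W w)).
Local Notation pettis := (pettis P W).
Local Notation represents := (represents P W).
Local Notation pre_ip := (pre_ip P W).
Local Notation pre_norm := (pre_norm P W).

Let sW b : sq_int P (W_ b) := sq_int_dual gaussW b.

Lemma pettisP b b2 : b2 (pettis b) = ip P (W_ b2) (W_ b).
Proof.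
rewrite -dual_covE; have [y yP] := pettis_exists sepB gaussW b.
apply: (@xgetPex _ 0 [set x : B | forall b2 : dual B, b2 x = dual_cov P W b2 b]).
by exists y => b3 /=; rewrite yP dual_covE.
Qed.

Lemma dual_comb_cov s t b1 b2 : W_ (dual_comb s t b1 b2) = fun w => s * b1 (W w) + t * b2 (W w).
Proof. by apply/funext => w; rewrite dual_combE. Qed.

Lemma pettis_comb s t b1 b2 :
  pettis (dual_comb s t b1 b2) = s *: pettis b1 + t *: pettis b2.
Proof.
apply: dual_separated => b; rewrite dualD !dualZ !pettisP dual_comb_cov.
by rewrite ipC ip_combl// ipC [ip P (W_ b2) _]ipC.
Qed.

Lemma pettisB b1 b2 : pettis b1 - pettis b2 = pettis (dual_comb 1 (-1) b1 b2).
Proof. by rewrite pettis_comb scale1r scaleN1r. Qed.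

(** The covariance equals [b1 (pettis b2)], so it depends on [b2] only through [pettis b2], and by
    symmetry likewise on [b1]; hence any representatives picked by [xget] give the same value. *)
Lemma pre_ipE b1 b2 : pre_ip (pettis b1) (pettis b2) = ip P (W_ b1) (W_ b2).
Proof.
rewrite /Defs.pre_ip; case: xgetP => [r _ [c1 [c2 [e1 e2 ->]]]|/(_ (ip P (W_ b1) (W_ b2)))[]].
  by rewrite dual_covE -pettisP -e2 pettisP ipC -pettisP -e1 pettisP ipC.
by exists b1, b2; rewrite dual_covE.
Qed.

Lemma pre_normE b : pre_norm (pettis b) = nrm2 P (W_ b).
Proof. by rewrite /Defs.pre_norm pre_ipE. Qed.

Lemma pre_normB b1 b2 : pre_norm (pettis b1 - pettis b2) =
  nrm2 P (fun w => b1 (W w) - b2 (W w)).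
Proof.
rewrite pettisB pre_normE dual_comb_cov; congr nrm2.
by apply/funext => w; rewrite mul1r mulN1r.
Qed.

(** Continuity of the inclusion of the RKHS in [B], by Cauchy-Schwarz and the uniform variance bound
    on the unit ball of the dual. *)
Lemma norm_pettisB : exists2 C : R, 0 < C & forall b1 b2,
  `|pettis b1 - pettis b2| <= C * nrm2 P (fun w => b1 (W w) - b2 (W w)).
Proof.
have [C C0 Cb] := dual_variance_bound sepB gaussW.
exists (Num.sqrt C); first by rewrite sqrtr_gt0.
move=> b1 b2; apply: dual_norm_le => b bn.
rewrite dualB !pettisP -ipBr//; apply: (le_trans (ip_le_nrm2 (sW b) (sq_intB (sW b1) (sW b2)))).
rewrite ler_wpM2r ?nrm2_ge0// ler_wsqrtr//.
have := Cb b 1 ltr01; rewrite expr1n mulr1; apply => x.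
by rewrite mul1r.
Qed.

(* [X] is the image of [h] under the isometry U, up to almost sure equality. *)
Definition isometric_image h X :=
  exists b : nat -> dual B, [/\ represents b h, sq_int P X & cvgL2 P (fun n => W_ (b n)) X].

Lemma isometric_image_sq_int h X : isometric_image h X -> sq_int P X.
Proof. by case=> b []. Qed.

(** The reproducing formula. It recovers [h] from [X], as functionals separate points. *)
Lemma isometric_image_dual h X b : isometric_image h X -> b h = ip P (W_ b) X.
Proof.
move=> [c [[_ ch] sX cX]].
have c1 : b (pettis (c n)) @[n --> \oo] --> b h.
  by apply: continuous_cvg => //; exact: dual_continuous.
apply: (cvg_unique (@Rhausdorff R) c1).
rewrite (_ : (fun n => b (pettis (c n))) = fun n => ip P (W_ b) (W_ (c n))).
  by apply: cvgL2_ip => //; exact: cvgL2_cst.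
by apply/funext => n; rewrite pettisP.
Qed.

Lemma cvgL2_cauchy (Z : nat -> Omega -> R) X : (forall n, sq_int P (Z n)) -> sq_int P X ->
  cvgL2 P Z X -> forall e : R, 0 < e -> exists N, forall m n, (N <= m)%N -> (N <= n)%N ->
    nrm2 P (fun w => Z m w - Z n w) < e.
Proof.
move=> sZ sX cZ e e0; have e2 : 0 < e / 2 by lra.
have /cvgr_lt/(_ _ e2)[N _ Nh] := cZ; exists N => m n Nm Nn.
apply: (le_lt_trans (nrm2_dist (sZ m) sX (sZ n))).
rewrite [ltRHS](_ : e = e / 2 + e / 2); last by field.
by apply: ltrD; [exact: Nh|rewrite nrm2B_sym; exact: Nh].
Qed.

Lemma cvgL2_represents (b : nat -> dual B) X : sq_int P X ->
  cvgL2 P (fun n => W_ (b n)) X -> exists h, represents b h.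
Proof.
move=> sX cX; have cauchy := cvgL2_cauchy (fun n => sW (b n)) sX cX.
have [C C0 CB] := norm_pettisB.
have [h bh] : exists h : B, pettis (b n) @[n --> \oo] --> h.
  apply: cauchy_seq_cvg => e e0; have eC : 0 < e / C by rewrite divr_gt0.
  have [N NP] := cauchy _ eC; exists N => m n Nm Nn.
  by rewrite (le_lt_trans (CB _ _))// mulrC -ltr_pdivlMr// NP.
exists h; split=> // e e0; have [N NP] := cauchy _ e0.
by exists N => m n Nm Nn; rewrite pre_normB; exact: NP.
Qed.

Lemma represents_isometric_image (b : nat -> dual B) h : represents b h ->
  exists X, [/\ isometric_image h X, sq_int P X & cvgL2 P (fun n => W_ (b n)) X].
Proof.
move=> bh; have [|X [sX cX]] := riesz_fischer (fun n => sW (b n)).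
  move=> e e0; have [N NP] := bh.1 e e0.
  by exists N => m n Nm Nn; rewrite -pre_normB; exact: NP.
by exists X; split=> //; exists b.
Qed.

Lemma isometric_image_comb s t h g X Y : isometric_image h X -> isometric_image g Y ->
  isometric_image (s *: h + t *: g) (fun w => s * X w + t * Y w).
Proof.
move=> [b [bh sX cX]] [c [cg sY cY]].
exists (fun n => dual_comb s t (b n) (c n)).
have sXY : sq_int P (fun w => s * X w + t * Y w) by apply: sq_int_lin => //; exact: sq_intZ.
have cXY : cvgL2 P (fun n => W_ (dual_comb s t (b n) (c n))) (fun w => s * X w + t * Y w).
  by under eq_fun => n do rewrite dual_comb_cov; exact: cvgL2_lin.
split=> //.
have [k [ck bk]] := cvgL2_represents sXY cXY.
suff -> : s *: h + t *: g = k by split.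
have c1 : pettis (dual_comb s t (b n) (c n)) @[n --> \oo] --> s *: h + t *: g.
  under eq_fun do rewrite pettis_comb.
  by apply: cvgD; apply: cvgZl_tmp; [exact: bh.2|exact: cg.2].
exact: (cvg_unique (@norm_hausdorff _ B) c1 bk).
Qed.

(** [X - X'] is orthogonal to every [b (W)], since both variables pair with it to [b h]; as an L2
    limit of such variables it has norm 0. This is why identifying elements of the completion with
    their limits in [B] loses nothing, and why U is well defined. *)
Lemma isometric_image_unique h X X' Z : isometric_image h X -> isometric_image h X' ->
  sq_int P Z -> ip P X Z = ip P X' Z.
Proof.
move=> hX hX' sZ; apply/eqP; rewrite -subr_eq0.
have [sX sX'] := (isometric_image_sq_int hX, isometric_image_sq_int hX').
rewrite -ipBl// -normr_le0; have sD := sq_intB sX sX'.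
apply: (le_trans (ip_le_nrm2 sD sZ)).
suff D0 : ip P (fun w => X w - X' w) (fun w => X w - X' w) = 0.
  by rewrite /nrm2 D0 sqrtr0 mul0r.
have [b [_ _ cX]] := hX; have [b' [_ _ cX']] := hX'.
have ort c : ip P (W_ c) (fun w => X w - X' w) = 0.
  by rewrite ipBr// -(isometric_image_dual c hX) -(isometric_image_dual c hX') subrr.
rewrite ipBl//.
have lim0 (c : nat -> dual B) Y : sq_int P Y -> cvgL2 P (fun n => W_ (c n)) Y ->
    ip P Y (fun w => X w - X' w) = 0.
  move=> sY cY; have := cvgL2_ip (fun n => sW (c n)) sY (fun=> sD) sD cY (cvgL2_cst _ _).
  under eq_fun do rewrite ort.
  by move=> /(cvg_unique (@Rhausdorff R) (cvg_cst _)) <-.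
by rewrite (lim0 _ _ sX cX) (lim0 _ _ sX' cX') subrr.
Qed.

Lemma isometric_image_ip h g X X' Y Y' : isometric_image h X -> isometric_image h X' ->
  isometric_image g Y -> isometric_image g Y' -> ip P X Y = ip P X' Y'.
Proof.
move=> hX hX' gY gY'.
rewrite (isometric_image_unique hX hX' (isometric_image_sq_int gY)) ipC.
by rewrite (isometric_image_unique gY gY' (isometric_image_sq_int hX')) ipC.
Qed.

Lemma rkhs_ipE h g X Y : isometric_image h X -> isometric_image g Y ->
  rkhs_ip P W h g = ip P X Y.
Proof.
move=> hX gY.
have conv (b c : nat -> dual B) X' Y' : sq_int P X' -> sq_int P Y' ->
    cvgL2 P (fun n => W_ (b n)) X' -> cvgL2 P (fun n => W_ (c n)) Y' ->
    pre_ip (pettis (b n)) (pettis (c n)) @[n --> \oo] --> ip P X' Y'.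
  by move=> sX' sY' cX' cY'; under eq_fun do rewrite pre_ipE; exact: cvgL2_ip.
rewrite /rkhs_ip; case: xgetP => [r _ [b [c [bh cg lim]]]|/(_ (ip P X Y))[]].
  have [X' [hX' sX' cX']] := represents_isometric_image bh.
  have [Y' [gY' sY' cY']] := represents_isometric_image cg.
  rewrite (isometric_image_ip hX hX' gY gY').
  exact: (cvg_unique (@Rhausdorff R) lim (conv _ _ _ _ sX' sY' cX' cY')).
have [b [bh sX cX]] := hX; have [c [cg sY cY]] := gY.
by exists b, c; split=> //; exact: conv.
Qed.

(** Existence of a version comes from completeness of L2. From here on [rkhs_U] enters only through
    this property. *)
Lemma rkhs_UP h : rkhs P W h -> isometric_image h (rkhs_U P W h).
Proof.
move=> [b bh]; rewrite /rkhs_U; case: xgetP => [X _ [LX [c [ch cX]]]|].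
  have sX := (Lfun2P P X).1 LX.
  by exists c; split=> //; exact/(cvgL2P (fun n => sW (c n)) sX).
have [X [_ sX cX]] := represents_isometric_image bh.
move=> /(_ X)[]; split; first exact/Lfun2P.
by exists b; split=> //; apply/(cvgL2P (fun n => sW (b n)) sX).
Qed.

Lemma isometric_image_dualW b : isometric_image (pettis b) (W_ b).
Proof.
exists (fun=> b); split=> //; last exact: cvgL2_cst.
split; last exact: cvg_cst.
by move=> e e0; exists 0%N => m n _ _; rewrite pre_normB (_ : (fun w => _) = cst 0) ?nrm2_cst0//;
   apply/funext => w; rewrite subrr.
Qed.

Lemma isometric_image_gauss_char h X : isometric_image h X -> gauss_char P X (ip P X X).
Proof.
move=> [b [_ sX cX]].
exact: (gauss_char_cvgL2 (fun n => ip_ge0 P (W_ (b n)))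
   (fun n => gauss_char_dual gaussW (b n)) sX cX).
Qed.

End rkhs_theory.

(** * Joint laws *)

Section joint_laws.
Context d (T : measurableType d) (R : realType) (P : probability T R).
Local Notation E f := (\int[P]_w f w).

Lemma cosM_E (f g : T -> R) (q p : R) : measurable_fun setT f -> measurable_fun setT g ->
  E (fun w => cos (f w + q) * cos (g w + p)) =
  2^-1 * (E (fun w => cos (f w + -1 * g w + (q - p))) + E (fun w => cos (f w + 1 * g w + (q + p)))).
Proof.
move=> mf mg.
have m1 : measurable_fun setT (fun w => f w + -1 * g w).
  by apply: measurable_funD => //; exact: measurable_funM.
have m2 : measurable_fun setT (fun w => f w + 1 * g w).
  by apply: measurable_funD => //; exact: measurable_funM.
have i1 := bdd_meas_integrable P (bdd_meas_cos (q - p) m1).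
have i2 := bdd_meas_integrable P (bdd_meas_cos (q + p) m2).
rewrite -RintegralD// -RintegralZl//; last exact: integrableD_EFin.
apply: eq_Rintegral => w _.
have -> : f w + -1 * g w + (q - p) = (f w + q) - (g w + p) by ring.
have -> : f w + 1 * g w + (q + p) = (f w + q) + (g w + p) by ring.
by move: (f w + q) (g w + p) => u v; rewrite cosB cosD; field.
Qed.

(** The uniqueness theorem for the difference of two weighted laws. The constant [c] allows
    factorized right-hand sides, as independence requires. *)
Lemma weighted_indic_eq d' (X : measurableType d') (L : set (X -> R)) (V V' : T -> X)
    (Z Z' : T -> R) (c : R) A :
  (forall l, L l -> measurable_fun setT l) ->
  (forall a l1 l2, L l1 -> L l2 -> L (fun x => a * l1 x + l2 x)) -> L (cst 0) ->
  measurable_fun setT V -> measurable_fun setT V' -> bdd_meas Z -> bdd_meas Z' ->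
  (forall l q, L l -> E (fun w => cos (l (V w) + q) * Z w) =
                      c * E (fun w => cos (l (V' w) + q) * Z' w)) ->
  <<s halfspaces L >> A ->
  E (fun w => \1_A (V w) * Z w) = c * E (fun w => \1_A (V' w) * Z' w).
Proof.
move=> mL linL L0 mV mV' /(bdd_meas_integrable P) iZ /(bdd_meas_integrable P) iZ' h sA.
apply/eqP; rewrite -subr_eq0; apply/eqP.
have bn := bm_functional_lin c (bm_functional_Rintegral mV iZ) (bm_functional_Rintegral mV' iZ').
apply: (bm_functional_indic0 bn mL linL L0 _ sA) => l q Ll.
by rewrite h// subrr.
Qed.

Section sub_sigma_algebra.
Variable L : set (T -> R).
Hypothesis mL : forall l, L l -> measurable_fun setT l.
Hypothesis linL : forall a l1 l2, L l1 -> L l2 -> L (fun w => a * l1 w + l2 w).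
Hypothesis L0 : L (cst 0).

Lemma halfspaces_measurable A : <<s halfspaces L >> A -> measurable A.
Proof.
apply: smallest_sub; first exact: sigma_algebra_measurable.
move=> _ [l [r [Ll ->]]].
have := mL Ll measurableT (measurable_itv `]-oo, r]).
by rewrite setTI set_itvE.
Qed.

Lemma Rintegral_indicM (A A' : set T) : measurable A -> measurable A' ->
  E (fun w => \1_A w * \1_A' w) = fine (P (A `&` A')).
Proof.
move=> mA mA'; rewrite -(Rintegral_indic P); last exact: measurableI.
by apply: eq_Rintegral => w _; rewrite indicI.
Qed.

(** The assumption on [l + t Y] says that variances add, which factorizes the cosine integrals.
    Indicators replace cosines in two rounds, first on [T] for the sigma-algebra of [L], then on the
    line for [Y]. *)
Lemma gaussian_independent (Y : T -> R) (v : R) (vL : (T -> R) -> R) A E' :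
  gauss_char P Y v ->
  (forall l, L l -> gauss_char P l (vL l)) ->
  (forall l t, L l -> gauss_char P (fun w => l w + t * Y w) (vL l + t ^+ 2 * v)) ->
  <<s halfspaces L >> A -> measurable E' ->
  (P (A `&` Y @^-1` E') = P A * P (Y @^-1` E'))%E.
Proof.
move=> [mY cY] cL cLY sA mE; have mA := halfspaces_measurable sA.
have mYE : measurable (Y @^-1` E') by rewrite -[X in measurable X]setTI; exact: mY.
have bA := bdd_meas_indic R mA.
(* First round: [V = id], so that [L] is a class of functions on the probability space itself, with
   weight [cos (t * Y w + p)]. *)
have step t p : E (fun w => \1_A w * cos (t * Y w + p)) =
    E (fun w => cos (t * Y w + p)) * E (fun w => \1_A w * cst 1 w).
  have mtY : measurable_fun setT (fun w => t * Y w) by exact: measurable_funM.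
  apply: (@weighted_indic_eq _ T L id id) sA => //;
    [exact: bdd_meas_cos|exact: bdd_meas_cst|].
  move=> l q Ll; have [ml cl] := cL l Ll.
  rewrite cosM_E// cY.
  have tl u x : E (fun w => cos (l w + u * (t * Y w) + x)) =
      cos x * expR (- (vL l / 2)) * expR (- (v * (u * t) ^+ 2 / 2)).
    have := (cLY l (u * t) Ll).2 1 x; rewrite expr1n mulr1 => e.
    transitivity (cos x * expR (- ((vL l + (u * t) ^+ 2 * v) / 2))).
      by rewrite -e; apply: eq_Rintegral => w _; rewrite mul1r mulrA.
    by rewrite -mulrA -expRD; congr (_ * expR _); field.
  rewrite !tl; have -> : E (fun w => cos (l (id w) + q) * cst 1 w) = cos q * expR (- (vL l / 2)).
    have := cl 1 q; rewrite expr1n mulr1 => <-.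
    by apply: eq_Rintegral => w _; rewrite mul1r /= mulr1.
  by rewrite !mulN1r mul1r sqrrN cosB cosD; field.
have PA : E (fun w => \1_A w * cst 1 w) = fine (P A).
  by rewrite -(Rintegral_indic P mA); apply: eq_Rintegral => w _; exact: mulr1.
(* Second round: the roles are exchanged, [\1_A] becoming the weight. *)
have : E (fun w => \1_E' (Y w) * \1_A w) = fine (P A) * E (fun w => \1_E' (Y w) * cst 1 w).
  apply: (@weighted_indic_eq _ R (@scalar_set R) Y Y \1_A (cst 1) (fine (P A)) E') => //.
  - by move=> _ [t ->]; exact: measurable_funM.
  - by move=> a _ _ [t ->] [u ->]; exists (a * t + u); apply/funext => x; ring.
  - by exists 0; apply/funext => x; rewrite mul0r.
  - exact: bdd_meas_cst.
  - move=> _ p [t ->]; have := step t p; rewrite PA => h.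
    transitivity (E (fun w => cos (t * Y w + p)) * fine (P A)).
      by rewrite -h; apply: eq_Rintegral => w _; rewrite mulrC.
    by rewrite mulrC; congr (_ * _); apply: eq_Rintegral => w _; rewrite mulr1.
  - exact: measurable_scalar_halfspaces.
have -> : E (fun w => \1_E' (Y w) * \1_A w) = fine (P (A `&` Y @^-1` E')).
  rewrite -Rintegral_indicM//; by apply: eq_Rintegral => w _; rewrite mulrC.
have -> : E (fun w => \1_E' (Y w) * cst 1 w) = fine (P (Y @^-1` E')).
  by rewrite -law_indic//; apply: eq_Rintegral => w _; exact: mulr1.
move=> e; have f1 : P (A `&` Y @^-1` E') \is a fin_num.
  by apply: fin_num_measure; exact: measurableI.
by rewrite -(fineK f1) e EFinM !fineK ?fin_num_measure//.
Qed.

(** The same two rounds, with the dual of [B] in place of the multiples of [Y]: [V] and [V'] get the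
    same law jointly with the variables in [L]. *)
Lemma equal_law_on (B : completeNormedModType R) (sepB : separable B)
    (V V' : T -> B) A (E' : set B) :
  borel_measurable V -> borel_measurable V' ->
  (forall l (b : dual B) q, L l -> E (fun w => cos (l w + b (V w) + q)) =
                                   E (fun w => cos (l w + b (V' w) + q))) ->
  <<s halfspaces L >> A -> <<s @open B >> E' ->
  P (A `&` V @^-1` E') = P (A `&` V' @^-1` E').
Proof.
move=> mV mV' h sA mE; have mA := halfspaces_measurable sA.
have bA := bdd_meas_indic R mA.
have mpre (U : T -> B) : borel_measurable U -> measurable (U @^-1` E').
  by move=> mU; rewrite -[X in measurable X]setTI; exact: mU.
have mb (U : T -> B) b : borel_measurable U -> measurable_fun setT (fun w => dual_fun b (U w)).
  exact: borel_measurable_dual.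
have step (b : dual B) p : E (fun w => \1_A w * cos (b (V w) + p)) =
    1 * E (fun w => \1_A w * cos (b (V' w) + p)).
  apply: (@weighted_indic_eq _ T L id id) sA => //;
    [exact/bdd_meas_cos/mb|exact/bdd_meas_cos/mb|].
  move=> l q Ll; have ml := mL Ll; rewrite mul1r !cosM_E//; try exact: mb.
  have hN c t : E (fun w => cos (l w + t * b (V w) + c)) =
      E (fun w => cos (l w + t * b (V' w) + c)).
    have := h l (dual_comb t 0 b b) c Ll.
    have -> : (fun w => cos (l w + dual_comb t 0 b b (V w) + c)) =
      (fun w => cos (l w + t * b (V w) + c)) by apply/funext => w; rewrite dual_combE mul0r addr0.
    have -> : (fun w => cos (l w + dual_comb t 0 b b (V' w) + c)) =
      (fun w => cos (l w + t * b (V' w) + c)) by apply/funext => w; rewrite dual_combE mul0r addr0.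
    by [].
  by rewrite !hN.
have : E (fun w => \1_E' (V w) * \1_A w) = 1 * E (fun w => \1_E' (V' w) * \1_A w).
  apply: (@weighted_indic_eq _ (g_sigma_algebraType (@open B)) (@dual_set _ B)
    V V' \1_A \1_A 1 E') => //.
  - by move=> _ [b ->]; exact: measurable_dual.
  - move=> a _ _ [b1 ->] [b2 ->]; exists (dual_comb a 1 b1 b2).
    by apply/funext => x; rewrite dual_combE mul1r.
  - exists (dual_comb 0 0 (norming_seq sepB 0) (norming_seq sepB 0)).
    by apply/funext => x; rewrite dual_combE !mul0r addr0.
  - move=> _ p [b ->]; have := step b p; rewrite !mul1r => e.
    transitivity (E (fun w => \1_A w * cos (b (V w) + p))).
      by apply: eq_Rintegral => w _; rewrite mulrC.
    by rewrite e; apply: eq_Rintegral => w _; rewrite mulrC.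
  - exact: borel_halfspaces.
have EI (U : T -> B) : borel_measurable U ->
    E (fun w => \1_E' (U w) * \1_A w) = fine (P (A `&` U @^-1` E')).
  move=> mU; rewrite -Rintegral_indicM//; last exact: mpre.
  by apply: eq_Rintegral => w _; rewrite mulrC.
rewrite mul1r !EI// => e.
have fI (U : T -> B) : borel_measurable U -> P (A `&` U @^-1` E') \is a fin_num.
  by move=> mU; apply: fin_num_measure; apply: measurableI => //; exact: mpre.
by rewrite -(fineK (fI V mV)) e (fineK (fI V' mV')).
Qed.

End sub_sigma_algebra.
End joint_laws.

(** * Compact convex sets exhausting a sequence *)

Section zonotopes.
Context (R : realType) (B : completeNormedModType R).
Implicit Types (x : nat -> B).

(** The Minkowski sum of the segments from [- x i] to [x i] for [i < n]. The recursion exhibits it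
    as a continuous image of a product of compact sets. *)
Fixpoint zonotope x n : set B := if n is n'.+1 then
  (fun tc : R * B => tc.1 *: x n' + tc.2) @` (`[-1, 1]%classic `*` zonotope x n')
  else [set 0].

Lemma zonotope_compact x n : compact (zonotope x n).
Proof.
elim: n => [|n IH] /=; first exact: compact_set1.
apply: continuous_compact; last by apply: compact_setX => //; exact: segment_compact.
apply: continuous_subspaceT => tc.
apply: cvgD; last exact: cvg_snd.
by apply: cvgZr_tmp; exact: cvg_fst.
Qed.

Lemma zonotope0 x n : zonotope x n 0.
Proof.
elim: n => [//|n IH] /=; exists (0, 0); last by rewrite scale0r addr0.
by split=> //=; rewrite in_itv/=; apply/andP; split; lra.
Qed.

Lemma zonotope_mem x n i : (i < n)%N -> zonotope x n (x i).
Proof.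
elim: n => [//|n IH]; rewrite ltnS leq_eqVlt => /predU1P[->|ni] /=.
  exists (1, 0); last by rewrite scale1r addr0.
  by split=> /=; [rewrite in_itv/=; apply/andP; split; lra|exact: zonotope0].
exists (0, x i); last by rewrite scale0r add0r.
by split=> /=; [rewrite in_itv/=; apply/andP; split; lra|exact: IH].
Qed.

Lemma zonotope_midpoint x n y z : zonotope x n y -> zonotope x n z ->
  zonotope x n (2^-1 *: (y + z)).
Proof.
elim: n y z => [|n IH] y z /=; first by move=> -> ->; rewrite addr0 scaler0.
move=> [[t c] [/= t1 zc] <-] [[u e] [/= u1 ze] <-].
exists (2^-1 * (t + u), 2^-1 *: (c + e)); last first.
  by rewrite /= addrACA -scalerDl [in RHS]scalerDr scalerA.
split=> /=; last exact: IH.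
move: t1 u1; rewrite !in_itv/= => /andP[t1 t2] /andP[u1 u2].
by apply/andP; split; lra.
Qed.

Definition zonotope_nbhd x n (e : R) := [set y | exists2 c, zonotope x n c & `|y - c| < e].

Lemma zonotope_nbhd_open x n e : open (zonotope_nbhd x n e).
Proof.
have -> : zonotope_nbhd x n e = \bigcup_(c in zonotope x n) ball c e.
  apply/seteqP; split=> y [c zc yc]; exists c => //; move: yc.
    by rewrite -ball_normE/= distrC.
  by rewrite -ball_normE/= distrC.
by apply: bigcup_open => c _; exact: ball_open.
Qed.

(** [y] is the midpoint of [y + z] and [y - z]; the hypotheses have the form that the reflection
    argument produces. *)
Lemma zonotope_nbhd_midpoint x n e y z :
  zonotope_nbhd x n e (y + z) -> zonotope_nbhd x n e (y - z) -> zonotope_nbhd x n e y.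
Proof.
move=> [c1 z1 h1] [c2 z2 h2]; exists (2^-1 *: (c1 + c2)).
  exact: zonotope_midpoint.
have -> : y - 2^-1 *: (c1 + c2) = 2^-1 *: ((y + z - c1) + (y - z - c2)).
  have -> : (y + z - c1) + (y - z - c2) = 2 *: y - (c1 + c2).
    rewrite scaler_nat mulr2n opprD addrACA; congr (_ + _).
    by rewrite addrACA subrr addr0.
  by rewrite scalerBr scalerA mulVf ?scale1r.
rewrite normrZ gtr0_norm ?invr_gt0//.
have := ler_normD (y + z - c1) (y - z - c2); lra.
Qed.

End zonotopes.

(* A cluster point, in [Z], of approximants of the [S k] is close to [x]
   because the functionals [b n] cannot separate them. *)
Lemma cvg_near_compact (R : realType) (B : completeNormedModType R) (sepB : separable B)
    (S : nat -> B) (x : B) :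
  (forall e : R, 0 < e -> exists2 Z : set B, compact Z &
     forall k, exists2 c, Z c & `|S k - c| < e) ->
  (forall n, norming_seq sepB n (S k) @[k --> \oo] --> norming_seq sepB n x) ->
  S k @[k --> \oo] --> x.
Proof.
move=> nearZ bS; apply/cvgrPdist_le => e e0.
have e4 : 0 < e / 4 by lra.
have [Z cZ SZ] := nearZ _ e4.
pose c k := projT1 (cid2 (SZ k)).
have Zc k : Z (c k) by rewrite /c; case: cid2.
have Sc k : `|S k - c k| < e / 4 by rewrite /c; case: cid2.
pose bad := [set k | e < `|x - S k|].
apply: contrapT => nS.
have bad_freq N : exists2 k, (N <= k)%N & bad k.
  apply: contrapT => h; apply: nS; exists N => // k /= Nk.
  by rewrite leNgt; apply/negP => xk; apply: h; exists k.
(* If convergence fails, the bad indices are cofinal, so tails restricted to them form a proper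
   filter; its image under [c] clusters in the compact set [Z]. *)
pose F := within bad (nbhs \oo : set_system nat).
have FF : ProperFilter (c @ F).
  apply: fmap_proper_filter; apply: Build_ProperFilter_ex.
  move=> A [N _ NA]; have [k Nk bk] := bad_freq N.
  by exists k; exact: NA.
have FZ : F (c @^-1` Z) by apply: filterE => k; exact: Zc.
have [z [Zz clz]] := cZ _ FF FZ.
have close N : exists k, [/\ (N <= k)%N, bad k & `|c k - z| < e / 4].
  have [||y [[k [Nk bk ->]] ]] :=
    clz [set y | exists k, [/\ (N <= k)%N, bad k & y = c k]] (ball z (e / 4)).
  - by exists N => // k /= Nk bk; exists k.
  - exact: nbhsx_ballx.
  - by rewrite -ball_normE/= distrC => kz; exists k.
(* Each functional at [x - z] is the limit of its values at [S k - z], which are below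
   [e / 4 + e / 4] for arbitrarily large [k]. *)
have xz : `|x - z| <= e / 2.
  apply: norm_le_norming_seq => n; apply/ler_addgt0Pr => a a0.
  have /cvgrPdist_lt/(_ _ a0)[N _ Nb] := bS n.
  have [k [Nk bk kz]] := close N.
  have h1 := Nb k Nk; have h2 := Sc k.
  have h3 := norming_seq_le sepB n (S k - z).
  have h4 := ler_normD (S k - c k) (c k - z).
  rewrite addrA subrK in h4; rewrite dualB in h3; rewrite dualB.
  have h5 := ler_norm (norming_seq sepB n x - norming_seq sepB n (S k)).
  have h6 := ler_norm (norming_seq sepB n (S k) - norming_seq sepB n z).
  by move: h1 => /=; lra.
have [k [_ bk kz]] := close 0; move: bk; rewrite /bad/= => bk.
have h1 := ler_normD (S k - c k) (c k - z); rewrite addrA subrK in h1.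
have h2 := ler_normD (x - z) (z - S k); rewrite addrA subrK (distrC z) in h2.
have h3 := Sc k; lra.
Qed.

(** * The orthonormal expansion *)

Section orthonormal_expansion.
Context (R : realType) (B : completeNormedModType R) (sepB : separable B)
  (d : measure_display) (Omega : measurableType d) (P : probability Omega R)
  (W : Omega -> B) (gaussW : centered_gaussian P W)
  (I : set nat) (h : nat -> B) (onh : complete_orthonormal P W I h).
Implicit Types (b : dual B) (Y Z : Omega -> R) (s : seq nat) (t : nat -> R).

Local Notation E f := (\int[P]_w f w).
Local Notation W_ b := (fun w => dual_fun b (W w)).

Let X i : Omega -> R := rkhs_U P W (h i).
Let sW b : sq_int P (W_ b) := sq_int_dual gaussW b.

Lemma coord_image i : I i -> isometric_image P W (h i) (X i).
Proof. by case: onh => rh _ _ /rh; exact: rkhs_UP. Qed.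

Lemma coord_sq_int i : I i -> sq_int P (X i).
Proof. by move=> /coord_image /isometric_image_sq_int. Qed.

Lemma coord_ip i j : I i -> I j -> ip P (X i) (X j) = (i == j)%:R.
Proof.
move=> Ii Ij; rewrite -(rkhs_ipE sepB gaussW (coord_image Ii) (coord_image Ij)).
by case: onh => _ + _; exact.
Qed.

Lemma coord_law i : I i -> has_law P (X i) (normal_prob 0 1).
Proof.
move=> Ii; apply: gauss_char_law.
have := isometric_image_gauss_char gaussW (coord_image Ii).
by rewrite coord_ip// eqxx.
Qed.

Definition lincomb s t : Omega -> R := fun w => \sum_(i <- s) t i * X i w.

Lemma lincomb_image s t : (forall i, i \in s -> I i) ->
  isometric_image P W (\sum_(i <- s) t i *: h i) (lincomb s t).
Proof.
elim: s => [|i s IH] sI.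
  (* The zero vector is 0 times the Pettis integral of an arbitrary functional. *)
  rewrite big_nil; have im := isometric_image_dualW sepB gaussW (norming_seq sepB 0).
  have := isometric_image_comb sepB gaussW 0 0 im im.
  rewrite !scale0r addr0; congr isometric_image; apply/funext => w.
  by rewrite /lincomb big_nil !mul0r addr0.
have Ii : I i by apply: sI; rewrite mem_head.
have is_ : isometric_image P W (\sum_(j <- s) t j *: h j) (lincomb s t).
  by apply: IH => j js; apply: sI; rewrite in_cons js orbT.
have := isometric_image_comb sepB gaussW (t i) 1 (coord_image Ii) is_.
rewrite scale1r big_cons; congr isometric_image; apply/funext => w.
by rewrite /lincomb big_cons mul1r.
Qed.

Lemma lincomb_ip s t Y : (forall i, i \in s -> I i) -> sq_int P Y ->
  ip P (lincomb s t) Y = \sum_(i <- s) t i * ip P (X i) Y.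
Proof.
move=> sI sY; elim: s sI => [|i s IH] sI.
  rewrite big_nil -[RHS](Rintegral_cst1 P); apply: eq_Rintegral => w _.
  by rewrite /lincomb big_nil mul0r.
have sI' j : j \in s -> I j by move=> js; apply: sI; rewrite in_cons js orbT.
rewrite big_cons -IH// -ipDl//.
- by congr ip; apply/funext => w; rewrite /lincomb big_cons.
- by apply: coord_sq_int; apply: sI; rewrite mem_head.
- exact: isometric_image_sq_int (lincomb_image t sI').
Qed.

Lemma lincomb_coord s t i : uniq s -> (forall i, i \in s -> I i) -> I i ->
  ip P (lincomb s t) (X i) = if i \in s then t i else 0.
Proof.
move=> us sI Ii; rewrite lincomb_ip//; last exact: coord_sq_int.
rewrite big_seq (eq_bigr (fun j => if j == i then t j else 0)); last first.
  move=> j js; rewrite coord_ip//; last exact: sI.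
  by case: eqP => _; rewrite ?mulr1 ?mulr0.
rewrite -big_seq -big_mkcond/=; have [si|si] := boolP (i \in s).
  by rewrite -big_filter filter_pred1_uniq// big_seq1.
rewrite big_seq_cond big_pred0// => j; apply/negbTE; apply: contra si.
by move=> /andP[js /eqP <-].
Qed.

Definition span s : set (Omega -> R) := [set l | exists t, l = lincomb s t].

Lemma span_lin s a l1 l2 : span s l1 -> span s l2 -> span s (fun w => a * l1 w + l2 w).
Proof.
move=> [t1 ->] [t2 ->]; exists (fun i => a * t1 i + t2 i); apply/funext => w.
rewrite /lincomb mulr_sumr -big_split/=; apply: eq_bigr => i _; ring.
Qed.

Lemma span0 s : span s (cst 0).
Proof.
exists (fun=> 0); apply/funext => w; rewrite /lincomb big1// => i _.
exact: mul0r.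
Qed.

Lemma span_measurable s l : (forall i, i \in s -> I i) -> span s l -> measurable_fun setT l.
Proof.
by move=> sI [t ->]; have := isometric_image_sq_int (lincomb_image t sI); case.
Qed.

Lemma span_coord s i : uniq s -> i \in s -> span s (X i).
Proof.
move=> us si; exists (fun j => (j == i)%:R); apply/funext => w.
rewrite /lincomb (eq_bigr (fun j => if j == i then X j w else 0)); last first.
  by move=> j _; case: eqP => _; rewrite ?mul1r ?mul0r.
by rewrite -big_mkcond/= -big_filter filter_pred1_uniq// big_seq1.
Qed.

Local Notation sigma s := (g_sigma_algebraType (halfspaces (span s))).

Lemma sigma_coord s i : uniq s -> i \in s -> measurable_fun setT (X i : sigma s -> R).
Proof.
move=> us si; apply: measurable_fun_le => r; apply: sub_sigma_algebra.
by exists (X i), r; split=> //; exact: span_coord.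
Qed.

Lemma sigma_lincomb s' s t : uniq s -> {subset s' <= s} ->
  measurable_fun setT (lincomb s' t : sigma s -> R).
Proof.
move=> us; elim: s' => [|i s' IH] ss.
  rewrite (_ : lincomb _ _ = cst 0); first exact: measurable_cst.
  by apply/funext => w; rewrite /lincomb big_nil.
rewrite (_ : lincomb _ _ = fun w : sigma s => t i * X i w + lincomb s' t w).
  apply: measurable_funD; last by apply: IH => j js; apply: ss; rewrite in_cons js orbT.
  by apply: measurable_funM => //; apply: sigma_coord => //; apply: ss; rewrite mem_head.
by apply/funext => w; rewrite /lincomb big_cons.
Qed.

(** Induction on the list: by orthonormality the variance of [l + a X j] is the sum of the two
    variances, so the head is independent of the sigma-algebra generated by the tail. *)
Lemma coord_independent s (A : nat -> set R) : uniq s -> (forall i, i \in s -> I i) ->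
  (forall i, i \in s -> measurable (A i)) ->
  P (\bigcap_(i in [set` s]) (X i @^-1` A i)) = (\prod_(i <- s) P (X i @^-1` A i))%E.
Proof.
elim: s => [|j s IH] /= us sI mA.
  rewrite big_nil (_ : [set` [::]] = set0) ?bigcap_set0 ?probability_setT//.
  by apply/seteqP; split.
have /andP[js us'] := us.
have Ij : I j by apply: sI; rewrite mem_head.
have sI' i : i \in s -> I i by move=> si; apply: sI; rewrite in_cons si orbT.
have mA' i : i \in s -> measurable (A i) by move=> si; apply: mA; rewrite in_cons si orbT.
rewrite big_cons -IH// (_ : [set` j :: s] = j |` [set` s]); last first.
  apply/seteqP; split=> i /=; rewrite in_cons.
    by move=> /predU1P[->|]; [left|right].
  by move=> [->|->]; rewrite ?eqxx ?orbT.
rewrite bigcap_setU1 setIC muleC.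
have [mXj cXj] := isometric_image_gauss_char gaussW (coord_image Ij).
rewrite coord_ip// eqxx in cXj.
apply: (@gaussian_independent _ _ _ _ (span s) _ _ _ (X j) 1 (fun l => ip P l l)).
- by move=> l; exact: span_measurable.
- exact: span_lin.
- exact: span0.
- by split.
- by move=> l [t ->]; exact: isometric_image_gauss_char (lincomb_image t sI').
- move=> l a [t ->].
  have im := isometric_image_comb sepB gaussW 1 a (lincomb_image t sI') (coord_image Ij).
  have := isometric_image_gauss_char gaussW im.
  rewrite ip_lin; last 2 first.
    exact: isometric_image_sq_int (lincomb_image t sI').
    exact: coord_sq_int.
  rewrite lincomb_coord// (negbTE js) coord_ip// eqxx expr1n mul1r !mulr0 addr0.
  by under eq_fun do rewrite mul1r.
- have : measurable (\bigcap_(i in [set` s]) (X i @^-1` A i) : set (sigma s)).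
    apply: fin_bigcap_measurable => // i /= si.
    by have := sigma_coord us' si measurableT (mA' i si); rewrite setTI.
  by [].
- by apply: mA; rewrite mem_head.
Qed.

Definition coords n := [seq i <- index_iota 0 n | i \in I].

Lemma coords_uniq n : uniq (coords n).
Proof. by rewrite filter_uniq// iota_uniq. Qed.

Lemma coords_mem n i : (i \in coords n) = (i \in I) && (i < n)%N.
Proof. by rewrite mem_filter mem_index_iota. Qed.

Lemma coords_index n i : i \in coords n -> I i.
Proof. by rewrite coords_mem => /andP[/set_mem]. Qed.

Lemma coords_sub m n i : (m <= n)%N -> i \in coords m -> i \in coords n.
Proof. by move=> mn; rewrite !coords_mem => /andP[-> /leq_trans]; exact. Qed.

Definition psum n w : B := \sum_(i <- coords n) X i w *: h i.

Lemma psumE n w : psum n w = \sum_(0 <= i < n | i \in I) X i w *: h i.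
Proof. by rewrite /psum /coords big_filter. Qed.

Lemma psum_dual b n : (fun w => b (psum n w)) = lincomb (coords n) (fun i => b (h i)).
Proof.
apply/funext => w; rewrite /psum dual_sum; apply: eq_bigr => i _.
by rewrite dualZ mulrC.
Qed.

Lemma psum_dual_image b n : isometric_image P W
  (\sum_(i <- coords n) b (h i) *: h i) (fun w => b (psum n w)).
Proof. by rewrite psum_dual; apply: lincomb_image => i; exact: coords_index. Qed.

Lemma psum_dual_sq_int b n : sq_int P (fun w => b (psum n w)).
Proof. exact: isometric_image_sq_int (psum_dual_image b n). Qed.

(** The reproducing formula gives [E (X i * b (W)) = b (h i)], and orthonormality gives the same
    value with [b (psum n)]. *)
Lemma residual_orthogonal b n s t : {subset s <= coords n} ->
  ip P (lincomb s t) (fun w => b (W w) - b (psum n w)) = 0.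
Proof.
move=> sn; have sI i : i \in s -> I i by move=> /sn; exact: coords_index.
rewrite lincomb_ip//; last exact: sq_intB (sW b) (psum_dual_sq_int b n).
rewrite big_seq big1// => i si; have Xi := coord_sq_int (sI i si).
rewrite ipBr//; last exact: psum_dual_sq_int.
rewrite ipC -(isometric_image_dual sepB gaussW b (coord_image (sI i si))).
rewrite ipC psum_dual lincomb_coord ?sn ?subrr ?mulr0//.
- exact: coords_uniq.
- by move=> j; exact: coords_index.
- exact: sI.
Qed.

Lemma psum_sub_measurable n m k : (n <= k)%N -> (m <= k)%N ->
  borel_measurable (fun w : sigma (coords k) => psum n w - psum m w).
Proof.
move=> nk mk; apply: borel_measurableP => // b.
have mS j : (j <= k)%N -> measurable_fun setT (fun w : sigma (coords k) => b (psum j w)).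
  move=> jk; rewrite psum_dual; apply: sigma_lincomb; first exact: coords_uniq.
  by move=> i; exact: coords_sub.
rewrite (_ : b \o _ = fun w => b (psum n w) - b (psum m w)).
  by apply: measurable_funB; exact: mS.
by apply/funext => w /=; rewrite dualB.
Qed.

(** Against a functional [b] and an element of the span, the two sides become [Q + D] and [Q - D],
    with [D] the residual of [b (W)] after [k] and [Q] in the span of the coordinates below [k].
    They are orthogonal, so both combinations are Gaussian with variance [ip Q Q + ip D D]. *)
Lemma reflection m k A (E' : set B) : (m <= k)%N ->
  <<s halfspaces (span (coords k)) >> A -> <<s @open B >> E' ->
  P (A `&` [set w | E' ((psum k w - psum m w) + (W w - psum k w))]) =
  P (A `&` [set w | E' ((psum k w - psum m w) - (W w - psum k w))]).
Proof.
move=> mk sA mE; have skI i : i \in coords k -> I i by exact: coords_index.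
have mWd b : measurable_fun setT (W_ b) := (sW b).1.
have mpd b n : measurable_fun setT (fun w => b (psum n w)) := (psum_dual_sq_int b n).1.
apply: (@equal_law_on _ _ _ _ (span (coords k)) _ _ _ _ sepB
  (fun w => (psum k w - psum m w) + (W w - psum k w))
  (fun w => (psum k w - psum m w) - (W w - psum k w))) => //.
- by move=> l; exact: span_measurable.
- exact: span_lin.
- exact: span0.
- apply: borel_measurableP => // b; rewrite /comp.
  under eq_fun do rewrite dualD !dualB.
  by apply: measurable_funD; apply: measurable_funB.
- apply: borel_measurableP => // b; rewrite /comp.
  under eq_fun do rewrite dualB !dualB.
  by apply: measurable_funB; apply: measurable_funB.
move=> _ b q [t ->].
pose D w := b (W w) - b (psum k w).
pose Q w := 1 * lincomb (coords k) t w + 1 * (1 * b (psum k w) + (-1) * b (psum m w)).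
have imD := isometric_image_comb sepB gaussW 1 (-1) (isometric_image_dualW sepB gaussW b)
  (psum_dual_image b k).
have imQ := isometric_image_comb sepB gaussW 1 1 (lincomb_image t skI)
  (isometric_image_comb sepB gaussW 1 (-1) (psum_dual_image b k) (psum_dual_image b m)).
have DE : (fun w => 1 * b (W w) + -1 * b (psum k w)) = D.
  by apply/funext => w; rewrite mul1r mulN1r.
rewrite DE -/Q in imD imQ.
have [sD sQ] := (isometric_image_sq_int imD, isometric_image_sq_int imQ).
have QD : ip P Q D = 0.
  have sl := isometric_image_sq_int (lincomb_image t skI).
  have sk := psum_dual_sq_int b k; have sm := psum_dual_sq_int b m.
  rewrite /Q ip_combl//; last by apply: sq_int_lin => //; exact: sq_intZ.
  rewrite ip_combl// !psum_dual !residual_orthogonal//.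
    by ring.
  by move=> i; exact: coords_sub.
have imS a : E (fun w => cos (Q w + a * D w + q)) =
    cos q * expR (- ((ip P Q Q + a ^+ 2 * ip P D D) / 2)).
  have im := isometric_image_comb sepB gaussW 1 a imQ imD.
  have [_ /(_ 1 q)] := isometric_image_gauss_char gaussW im.
  rewrite ip_lin// QD expr1n mulr1 mul1r !mulr0 addr0 => <-.
  by apply: eq_Rintegral => w _; rewrite !mul1r.
transitivity (E (fun w => cos (Q w + 1 * D w + q))).
  by apply: eq_Rintegral => w _; rewrite dualD !dualB /Q /D; congr cos; ring.
have -> : E (fun w => cos (Q w + 1 * D w + q)) = E (fun w => cos (Q w + -1 * D w + q)).
  by rewrite (imS 1) (imS (-1)) sqrrN.
by apply: eq_Rintegral => w _; rewrite !dualB /Q /D; congr cos; ring.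
Qed.

End orthonormal_expansion.

Section almost_sure.
Context d (T : measurableType d) (R : realType) (P : probability T R).

(** The intersection of the bad events has probability at most every [c m]; no summability is
    involved. *)
Lemma ae_exists_not (bad : nat -> set T) (c : nat -> R) :
  (forall m, measurable (bad m)) -> (forall m, (P (bad m) <= (c m)%:E)%E) ->
  c m @[m --> \oo] --> 0 -> {ae P, forall w, exists m, ~ bad m w}.
Proof.
move=> mb bc c0; exists (\bigcap_m bad m); split.
- exact: bigcapT_measurable.
- apply/eqP; rewrite eq_le measure_ge0 andbT; apply/lee_addgt0Pr => e e0.
  rewrite add0e; have /cvgr_lt/(_ _ e0)[m _ mc] := c0.
  apply: (@le_trans _ _ (P (bad m))).
    by apply: le_measure; rewrite ?inE//; [exact: bigcapT_measurable|exact: bigcap_inf].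
  by apply: (le_trans (bc m)); rewrite lee_fin ltW//; exact: (mc m (leqnn m)).
- move=> w /= h m _; apply: contrapT => nb; apply: h; by exists m.
Qed.

End almost_sure.

(** * Levy's inequality and almost sure convergence *)

Section expansion_convergence.
Context (R : realType) (B : completeNormedModType R) (sepB : separable B)
  (d : measure_display) (Omega : measurableType d) (P : probability Omega R)
  (W : Omega -> B) (gaussW : centered_gaussian P W)
  (I : set nat) (h : nat -> B) (onh : complete_orthonormal P W I h).
Implicit Types (b : dual B).

Local Notation E f := (\int[P]_w f w).
Local Notation W_ b := (fun w => dual_fun b (W w)).
Local Notation coord i := (rkhs_U P W (h i)).
Local Notation psum := (psum P W I h).
Local Notation sigma n := (g_sigma_algebraType (halfspaces (span P W h (coords I n)))).

Let sW b : sq_int P (W_ b) := sq_int_dual gaussW b.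
Let sS b n : sq_int P (fun w => b (psum n w)) := psum_dual_sq_int sepB gaussW onh b n.

Lemma borel_residual m : borel_measurable (fun w => W w - psum m w).
Proof.
apply: borel_measurableP => // b; rewrite /comp; under eq_fun do rewrite dualB.
by apply: measurable_funB; [exact: (sW b).1|exact: (sS b m).1].
Qed.

Lemma borel_reflected m k :
  borel_measurable (fun w => (psum k w - psum m w) - (W w - psum k w)).
Proof.
apply: borel_measurableP => // b; rewrite /comp; under eq_fun do rewrite !dualB.
have mS n := (sS b n).1; have mWb := (sW b).1.
by do 2![apply: measurable_funB => //].
Qed.

Lemma borel_increment m n : borel_measurable (fun w => psum n w - psum m w).
Proof.
apply: borel_measurableP => // b; rewrite /comp; under eq_fun do rewrite dualB.
by apply: measurable_funB; [exact: (sS b n).1|exact: (sS b m).1].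
Qed.

Lemma measurable_exits (C : set B) m : <<s @open B >> C ->
  measurable (\bigcup_j [set w | ~ C (psum (m + j) w - psum m w)]) /\
  measurable [set w | ~ C (W w - psum m w)].
Proof.
move=> bC.
have bCc : <<s @open B >> (~` C).
  exact: (@measurableC _ (g_sigma_algebraType (@open B)) C bC).
split; last by have := borel_residual m measurableT bCc; rewrite setTI.
apply: bigcupT_measurable => j.
by have := borel_increment m (m + j) measurableT bCc; rewrite setTI.
Qed.

(* [S k - S m] is the midpoint of [W - S m] and of its reflection, which has
   the same law jointly with the coordinates below [k]. *)
Lemma levy_inequality (C : set B) m : <<s @open B >> C ->
  (forall x y, C (x + y) -> C (x - y) -> C x) ->
  (P (\bigcup_j [set w | ~ C (psum (m + j) w - psum m w)%R]) <=
   2%:E * P [set w | ~ C (W w - psum m w)%R])%E.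
Proof.
move=> bC midC.
have bCc : <<s @open B >> (~` C).
  exact: (@measurableC _ (g_sigma_algebraType (@open B)) C bC).
pose F j := [set w | ~ C (psum (m + j) w - psum m w)].
(* [A j] is the event that the first exit happens at [j]; it is decided by the coordinates below
   [m + j], as [reflection] requires. *)
pose A := seqDU F.
have sA j : <<s halfspaces (span P W h (coords I (m + j))) >> (A j).
  have mF i : (i <= j)%N -> measurable (F i : set (sigma (m + j)%N)).
    move=> ij; have mij : (m + i <= m + j)%N by rewrite leq_add2l.
    have := @psum_sub_measurable _ _ sepB _ _ P W I h _ _ _ mij (leq_addr j m) measurableT _ bCc.
    by rewrite setTI.
  suff : measurable (A j : set (sigma (m + j)%N)) by [].
  rewrite /A /seqDU; apply: measurableD; first exact: mF.
  by apply: bigsetU_measurable => i _; apply: mF; exact: ltnW (ltn_ord i).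
have mA j : measurable (A j).
  apply: (halfspaces_measurable _ (sA j)) => l.
  by apply: (span_measurable sepB gaussW onh) => i; exact: coords_index.
pose G := [set w | ~ C (W w - psum m w)].
have mG : measurable G.
  by have := borel_residual m measurableT bCc; rewrite setTI.
have mAG j : measurable (A j `&` G) by exact: measurableI.
(* On [A j] the midpoint is outside [C], so [W - S_m] or its reflection is outside too, and within
   [A j] these two events are equally likely. *)
have half j : (P (A j) <= 2%:E * P (A j `&` G))%E.
  have refl := reflection sepB gaussW onh (leq_addr j m) (sA j) bCc.
  set G1 := [set w | _] in refl; set G2 := [set w | _] in refl.
  have VE w : psum (m + j) w - psum m w + (W w - psum (m + j) w) = W w - psum m w.
    by rewrite addrC addrA subrK.
  have GE : G1 = G by apply/seteqP; split=> w; rewrite /G1 /G /= VE.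
  have mG2 : measurable (A j `&` G2).
    apply: measurableI => //; have := borel_reflected m (m + j) measurableT bCc.
    by rewrite setTI.
  have sub : A j `<=` (A j `&` G) `|` (A j `&` G2).
    move=> w Aw; have Fw : F j w by have := Aw; rewrite /A /seqDU => -[].
    have [Gw|nGw] := pselect (G w); [by left|right; split => //].
    rewrite /G2/= => CV'; apply: Fw; apply: midC CV'.
    apply: contrapT => nC; apply: nGw; rewrite -GE; exact: nC.
  apply: (@le_trans _ _ (P ((A j `&` G) `|` (A j `&` G2)))).
    by apply: le_measure; rewrite ?inE//; exact: measurableU.
  apply: (@le_trans _ _ (P (A j `&` G) + P (A j `&` G2))%E); first exact: measureU2.
  have -> : (2%:E = 1 + 1 :> \bar R)%E by rewrite -EFinD.
  by rewrite -refl GE ge0_muleDl// !mul1e.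
rewrite -/G [V in P V](seqDU_bigcup_eq F) -/A.
have tA : trivIset setT A := trivIset_seqDU F.
have -> : P (\bigcup_j A j) = (\sum_(0 <= j <oo) P (A j))%E.
  apply/esym/cvg_lim => //; apply: measure_semi_sigma_additive => //.
  exact: bigcupT_measurable.
have UAG : (\sum_(0 <= j <oo) P (A j `&` G))%E = P (\bigcup_j (A j `&` G)).
  apply/cvg_lim => //; apply: measure_semi_sigma_additive => //.
    exact: trivIset_setIr.
  exact: bigcupT_measurable.
apply: (@le_trans _ _ (2%:E * P (\bigcup_j (A j `&` G)))%E); last first.
  rewrite lee_pmul2l// le_measure ?inE//; first exact: bigcupT_measurable.
  by move=> w [j _ []].
apply: lime_le; first by apply: is_cvg_nneseries => j _ _.
apply: nearW => n; apply: (@le_trans _ _ (2%:E * \sum_(0 <= j < n) P (A j `&` G))%E).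
  rewrite ge0_sume_distrr; last by move=> *; exact: measure_ge0.
  by apply: lee_sum => j _; exact: half.
by rewrite lee_pmul2l// -UAG; apply: nneseries_lim_ge => j _ _.
Qed.

(** A diagonal choice: a functional of [W] within [1 / (n + 1)] of [Z n] in L2 for each [n]. *)
Lemma isometric_image_closed (Z : nat -> Omega -> R) (Y : Omega -> R) :
  (forall n, exists g, isometric_image P W g (Z n)) -> sq_int P Y -> cvgL2 P Z Y ->
  exists g, isometric_image P W g Y.
Proof.
move=> imZ sY cZ.
have sZ n : sq_int P (Z n) by have [g /isometric_image_sq_int] := imZ n.
have approx n : exists c : dual B, nrm2 P (fun w => c (W w) - Z n w) < n.+1%:R^-1.
  have [g [b [_ _ cb]]] := imZ n.
  have n0 : 0 < n.+1%:R^-1 :> R by rewrite invr_gt0 ltr0n.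
  by have /cvgr_lt/(_ _ n0)[k _ kb] := cb; exists (b k); exact: (kb k (leqnn k)).
pose c n := projT1 (cid (approx n)).
have cP n : nrm2 P (fun w => c n (W w) - Z n w) < n.+1%:R^-1 by rewrite /c; case: cid.
have cY : cvgL2 P (fun n => W_ (c n)) Y.
  apply: (@squeeze_cvgr _ _ _ _ (cst 0) (fun n => harmonic n + nrm2 P (fun w => Z n w - Y w))).
  - apply: nearW => n; rewrite nrm2_ge0/=.
    by rewrite (le_trans (nrm2_dist (sW (c n)) (sZ n) sY))// lerD2r ltW// cP.
  - exact: cvg_cst.
  - by rewrite -[X in _ --> X]addr0; apply: cvgD => //; exact: cvg_harmonic.
have [g rg] := cvgL2_represents sepB gaussW sY cY.
by exists g, c.
Qed.

(** The variables [b (psum n)] are orthogonal projections of [b (W)]: by Bessel's inequality their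
    energies [e n] increase to a finite limit, which makes them Cauchy. Completeness of the system
    then identifies the limit. *)
Lemma psum_cvgL2 b : cvgL2 P (fun n w => b (psum n w)) (W_ b).
Proof.
pose y n w := b (psum n w); pose e n := ip P (y n) (y n).
have orth n m : (n <= m)%N -> ip P (y n) (fun w => b (W w) - b (psum m w)) = 0.
  move=> nm; rewrite /y psum_dual residual_orthogonal// => i.
  exact: coords_sub.
have yW n m : (n <= m)%N -> ip P (y n) (y m) = ip P (y n) (W_ b).
  move=> nm; apply/esym/eqP; rewrite -subr_eq0 -ipBr ?orth//; [exact: sS|exact: sS].
have yy n m : (n <= m)%N -> nrm2 P (fun w => y m w - y n w) ^+ 2 = e m - e n.
  move=> nm; have sD := sq_intB (sS b m) (sS b n).
  rewrite nrm2_sqr ipBl ?ipBr//; try exact: sS.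
  by rewrite [ip P (y m) (y n)]ipC (yW n m)// -(yW n n)// -/(e m) -/(e n); ring.
have e_ub n : e n <= ip P (W_ b) (W_ b).
  have := ip_ge0 P (fun w => b (W w) - y n w); have sD := sq_intB (sW b) (sS b n).
  rewrite ipBl ?ipBr//; try exact: sS.
  by rewrite [ip P (W_ b) (y n)]ipC -(yW n n)// -/(e n); lra.
have e_nd : nondecreasing_seq e.
  by move=> n m nm; rewrite -subr_ge0 -yy// sqr_ge0.
have e_cvg : cvgn e.
  apply: nondecreasing_is_cvgn => //; exists (ip P (W_ b) (W_ b)) => _ [n _ <-].
  exact: e_ub.
have [a a0 | Y [sY cY]] := riesz_fischer (sS b).
  have a20 : 0 < a ^+ 2 / 2 by rewrite divr_gt0 ?exprn_gt0.
  have /cvgrPdist_lt/(_ _ a20)[N _ Nh] := e_cvg.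
  exists N => m n Nm Nn.
  wlog nm : m n Nm Nn / (n <= m)%N.
    by move=> wl; have [/wl|/ltnW/wl] := leqP n m; [exact|rewrite nrm2B_sym; exact].
  rewrite -ltr_sqr ?nnegrE ?nrm2_ge0 ?(ltW a0)// (yy n m nm).
  have h1 := Nh m Nm; have h2 := Nh n Nn; rewrite /= distrC in h1; rewrite /= in h2.
  have := ler_norm (e m - limn e); have := ler_norm (limn e - e n); lra.
pose Z w := b (W w) - Y w.
have sZ : sq_int P Z := sq_intB (sW b) sY.
have cZ : cvgL2 P (fun n w => b (W w) - y n w) Z.
  have := cvgL2_lin 1 (-1) (fun=> sW b) (sW b) (sS b) sY (cvgL2_cst P (W_ b)) cY.
  have -> : (fun n w => 1 * b (W w) + -1 * b (psum n w)) = (fun n w => b (W w) - y n w).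
    by apply/funext => n; apply/funext => w; rewrite mul1r mulN1r.
  have -> : (fun w => 1 * b (W w) + -1 * Y w) = Z.
    by apply/funext => w; rewrite mul1r mulN1r.
  by [].
(* The remainder must come from an element of the RKHS before completeness of [h] can be applied to
   it. *)
have [g gZ] : exists g, isometric_image P W g Z.
  apply: isometric_image_closed sZ cZ => n.
  have := isometric_image_comb sepB gaussW 1 (-1) (isometric_image_dualW sepB gaussW b)
    (psum_dual_image sepB gaussW onh b n).
  set g' := (X in isometric_image P W X) => im; exists g'; move: im.
  by congr (isometric_image P W _ _); apply/funext => w; rewrite /y; ring.
have ZX i : I i -> ip P Z (coord i) = 0.
  move=> Ii; have sXi := coord_sq_int sepB gaussW onh Ii.
  have lim := cvgL2_ip (fun n => sq_intB (sW b) (sS b n)) sZ (fun=> sXi) sXi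
    cZ (cvgL2_cst P (coord i)).
  apply: (cvg_unique (@Rhausdorff R) lim); apply: cvg_near_cst.
  exists i.+1 => // n /= ni.
  have sub : {subset [:: i] <= coords I n}.
    by move=> j; rewrite mem_seq1 => /eqP ->; rewrite coords_mem ni mem_set.
  rewrite ipC -[RHS](residual_orthogonal sepB gaussW onh b (fun=> 1) sub).
  by congr ip; apply/funext => w; rewrite /lincomb big_seq1 mul1r.
have g0 : g = 0.
  case: onh => _ _; apply; first by case: gZ => c [rc _ _]; exists c.
  move=> i Ii; rewrite (rkhs_ipE sepB gaussW gZ (coord_image sepB gaussW onh Ii)).
  exact: ZX.
(* [Z] is an L2 limit of variables [c n (W)], and each of them has inner product [c n g = 0] with
   [Z]. *)
have ZZ : nrm2 P Z = 0.
  rewrite /nrm2; case: (gZ) => c [_ _ cc].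
  have lim := cvgL2_ip (fun n => sW (c n)) sZ (fun=> sZ) sZ cc (cvgL2_cst P Z).
  rewrite -(sqrtr0 R); congr Num.sqrt; apply: (cvg_unique (@Rhausdorff R) lim).
  apply: cvg_near_cst; apply: nearW => n.
  by rewrite -(isometric_image_dual sepB gaussW (c n) gZ) g0 dual0.
apply: (@squeeze_cvgr _ _ _ _ (cst 0) (fun n => nrm2 P (fun w => y n w - Y w))) => //.
- apply: nearW => n; rewrite nrm2_ge0/=.
  apply: (le_trans (nrm2_dist (sS b n) sY (sW b))).
  by rewrite (nrm2B_sym P Y) -/Z ZZ addr0.
- exact: cvg_cst.
Qed.

(** Chebyshev's inequality makes the slab exit of [W - S_m] unlikely, and Levy's inequality
    transfers this to all [S_n - S_m] with [n >= m] simultaneously. *)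
Lemma psum_dual_ae b :
  {ae P, forall w, b (psum n w) @[n --> \oo] --> b (W w)}.
Proof.
suff small : forall k : nat, {ae P, forall w, exists m, forall n, (m <= n)%N ->
    `|b (W w) - b (psum n w)| <= 2 * k.+1%:R^-1}.
  have /ae_foralln : forall k, {ae P, forall w, exists m, forall n, (m <= n)%N ->
    `|b (W w) - b (psum n w)| <= 2 * k.+1%:R^-1} := small.
  apply: filterS => w h'; apply/cvgrPdist_le => e e0.
  have [k ke] : exists k, k.+1%:R^-1 < e / 2 :> R.
    have e2 : 0 < e / 2 by lra.
    by have [k _ hk] := near_infty_natSinv_lt (PosNum e2); exists k; exact: (hk k (leqnn k)).
  have [m hm] := h' k; exists m => // n /= mn; apply: (le_trans (hm n mn)).
  by move: ke; move: (k.+1%:R^-1) => z; lra.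
move=> k; pose t : R := k.+1%:R^-1.
have t0 : 0 < t by rewrite /t invr_gt0 ltr0n.
pose C := [set x | `|b x| <= t].
have bC : <<s @open B >> C.
  have := measurable_dual b measurableT (measurable_itv `[- t, t]).
  rewrite setTI; congr (<<s _ >> _); apply/seteqP; split=> x.
    by rewrite /C/= in_itv/= ler_norml.
  by rewrite /C/= in_itv/= ler_norml.
have midC x z : C (x + z) -> C (x - z) -> C x.
  rewrite /C/= dualD dualB => h1 h2.
  have := ler_normD (b x + b z) (b x - b z); rewrite addrACA subrr addr0 -mulr2n normrMn; lra.
pose G m := [set w | ~ C (W w - psum m w)].
pose U m := \bigcup_j [set w | ~ C (psum (m + j) w - psum m w)].
have [mU mG] : (forall m, measurable (U m)) /\ (forall m, measurable (G m)).
  by split=> m; have [] := measurable_exits m bC.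
have GL2 m : (P (G m) <= ((t ^+ 2)^-1 * nrm2 P (fun w => b (psum m w) - b (W w)) ^+ 2)%:E)%E.
  have sD := sq_intB (sS b m) (sW b).
  rewrite -(fineK (fin_num_measure P _ (mG m))) lee_fin ler_pdivlMl ?exprn_gt0//.
  rewrite nrm2_sqr -(Rintegral_indic P (mG m)) -RintegralZl//; last first.
    exact: bdd_meas_integrable (bdd_meas_indic R (mG m)).
  apply: le_Rintegral => //.
  - exact: integrableZ_EFin (bdd_meas_integrable P (bdd_meas_indic R (mG m))).
  - exact: sq_int_mul.
  - move=> w _; rewrite -expr2 indicE; have [|_] := boolP (w \in G m); last first.
      by rewrite mulr0 sqr_ge0.
    rewrite inE /G/= /C/= dualB => /negP; rewrite -ltNge distrC mulr1 => tb.
    by rewrite -[leRHS]real_normK ?num_real// lerXn2r ?nnegrE ?(ltW t0)// ltW.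
(* The factor 3 is 2 from Levy's inequality for [U m] plus 1 for [G m] itself. *)
have aeb : {ae P, forall w, exists m, ~ (U m `|` G m) w}.
  apply: (@ae_exists_not _ _ _ P _
    (fun m => 3 * ((t ^+ 2)^-1 * nrm2 P (fun w => b (psum m w) - b (W w)) ^+ 2))).
  - by move=> m; exact: measurableU.
  - move=> m; apply: (@le_trans _ _ (P (U m) + P (G m))%E); first exact: measureU2.
    have := levy_inequality m bC midC; rewrite -/(U m) -/(G m) => lev.
    apply: (le_trans (leeD lev (lexx _))).
    have -> : (2%:E * P (G m) + P (G m) = 3%:E * P (G m))%E.
      by rewrite -[in X in (_ + X)%E](mul1e (P (G m))) -ge0_muleDl// -EFinD natr1.
    by rewrite EFinM lee_pmul2l.
  - have c := psum_cvgL2 b.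
    have -> : (0 : R) = 3 * ((t ^+ 2)^-1 * (0 * 0)) by rewrite !mulr0.
    by apply: cvgMr; apply: cvgMr; under eq_fun do rewrite expr2; exact: cvgM.
move: aeb; apply: filterS => w [m nbad]; exists m => n mn.
have nG : C (W w - psum m w) by apply: contrapT => h'; apply: nbad; right.
have nU : C (psum n w - psum m w).
apply: contrapT => h'; apply: nbad; left; exists (n - m)%N => //=.
  by rewrite subnKC.
move: nG nU; rewrite /C/= !dualB => h1 h2; rewrite distrC in h2.
have := ler_normD (b (W w) - b (psum m w)) (b (psum m w) - b (psum n w)).
by rewrite addrA subrK -/t; lra.
Qed.

(** Levy's inequality from [m = 0], where the partial sum is 0: the bound is twice the probability
    that [W] itself misses the neighbourhood, and this tends to 0 because the zonotopes contain a
    dense sequence. *)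
Lemma psum_zonotope_ae (x : nat -> B) (e : R) :
  (forall y a, 0 < a -> exists n, `|y - x n| < a) -> 0 < e ->
  {ae P, forall w, exists j, forall n, zonotope_nbhd x j e (psum n w)}.
Proof.
move=> dx e0; pose C j := zonotope_nbhd x j e.
have bC j : <<s @open B >> (C j) by apply: sub_sigma_algebra; exact: zonotope_nbhd_open.
have midC j y z : C j (y + z) -> C j (y - z) -> C j y by exact: zonotope_nbhd_midpoint.
pose G j := [set w | ~ C j (W w - psum 0 w)].
pose U j := \bigcup_k [set w | ~ C j (psum (0 + k) w - psum 0 w)].
have psum0 w : psum 0 w = 0.
  by rewrite psumE big_geq.
have [mU mG] : (forall j, measurable (U j)) /\ (forall j, measurable (G j)).
  by split=> j; have [] := measurable_exits 0 (bC j).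
have aeb : {ae P, forall w, exists j, ~ U j w}.
  apply: (@ae_exists_not _ _ _ P U (fun j => 2 * E (fun w => \1_(G j) w))).
  - exact: mU.
  - move=> j; apply: (le_trans (levy_inequality 0 (bC j) (midC j))).
    rewrite EFinM lee_pmul2l// -/(G j) Rintegral_indic// fineK//.
    exact: fin_num_measure.
  - rewrite -(mulr0 2); apply: cvgMr; rewrite -[X in _ --> X](Rintegral_cst1 P).
    apply: (@cvg_Rintegral_dominated _ _ _ P (fun j w => \1_(G j) w) _ (cst 1)).
    + by move=> j; exact: measurable_indic.
    + exact: bdd_meas_integrable (bdd_meas_cst _ _).
    + by move=> j w; rewrite indicE normr_nat lern1 leq_b1.
    (* If [x k] is within [e] of [W w], then [w] has left [G j] for every [j > k]. *)
    + move=> w; apply: cvg_near_cst; have [k kW] := dx (W w) e e0.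
      exists k.+1 => // j /= kj; rewrite indicE memNset//; apply.
      by rewrite psum0 subr0; exists (x k) => //; exact: zonotope_mem.
move: aeb; apply: filterS => w [j nU]; exists j => n; apply: contrapT => nC; apply: nU.
by exists n => //=; rewrite add0n psum0 subr0.
Qed.

Lemma psum_ae : {ae P, forall w, psum n w @[n --> \oo] --> W w}.
Proof.
have a1 : {ae P, forall w, forall j, norming_seq sepB j (psum n w) @[n --> \oo] -->
    norming_seq sepB j (W w)}.
  by apply: ae_foralln => j; exact: psum_dual_ae.
have a2 : {ae P, forall w, forall k : nat, exists j, forall n,
    zonotope_nbhd (dense_seq sepB) j k.+1%:R^-1 (psum n w)}.
  apply: ae_foralln => k; apply: psum_zonotope_ae; first exact: dense_seqP.
  by rewrite invr_gt0 ltr0n.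
apply: filterS2 a1 a2 => w w1 w2; apply: (cvg_near_compact _ w1) => e e0.
have [k _ hk] := near_infty_natSinv_lt (PosNum e0).
have [j jP] := w2 k; exists (zonotope (dense_seq sepB) j); first exact: zonotope_compact.
move=> n; have [c zc nc] := jP n; exists c => //; apply: (lt_trans nc).
exact: (hk k (leqnn k)).
Qed.

End expansion_convergence.

Theorem theorem4p3 (R : realType) (B : completeNormedModType R)
    (sepB : separable B)
    (d : measure_display) (Omega : measurableType d)
    (P : probability Omega R) (W : Omega -> B)
    (gaussW : centered_gaussian P W)
    (I : set nat) (h : nat -> B) (onh : complete_orthonormal P W I h) :
  [/\ mutually_independent P I (fun i => rkhs_U P W (h i)),
      forall i, I i -> has_law P (rkhs_U P W (h i)) (normal_prob 0 1)
    & {ae P, forall w : Omega,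
        (\sum_(0 <= i < n | i \in I) rkhs_U P W (h i) w *: h i)
          @[n --> \oo] --> W w}].
Proof.
split.
- move=> J A JI mA; apply: (coord_independent sepB gaussW onh) => //.
  exact: fset_uniq.
- by move=> i Ii; exact: (coord_law sepB gaussW onh).
- have := psum_ae sepB gaussW onh; apply: filterS => w.
  by under eq_fun do rewrite psumE.
Qed.
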